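(* Let $\{x_k,y_k,f_k,g_k\}_{k=1}^\infty$ be a dependent sequence and set $z_k=x_k-y_k$. Then for all natural numbers $m\le k_1<\cdots<k_m$ and all real numbers $c_1,\dots,c_m$, $$\Big\|\sum_{i=1}^mc_iu_{k_i}\Big\|_u\le\Big\|\sum_{i=1}^mc_iz_{k_i}\Big\|\le146\Big\|\sum_{i=1}^mc_iu_{k_i}\Big\|_u,$$ where $\{u_k\}_k$ denotes the unconditional basis of Pełczyński.
   Context: Notation. $c_{00}$ is the space of finitely supported real sequences on $\mathbb{N}$ with unit vectors $e_n$; for $f,x\in c_{00}$, $f(x)=\sum_i f(i)x(i)$. $\operatorname{ran}x$ is the smallest interval of $\mathbb{N}$ containing $\operatorname{supp}x$; $Ef$ is the restriction of $f$ to the interval $E$; $x<y$ means $\max\operatorname{supp}x<\min\operatorname{supp}y$; $\|\cdot\|_0$ is the supremum norm. A block sequence is a (finite or infinite) sequence of nonzero finitely supported vectors $x_1<x_2<\cdots$. Schreier families: $\mathcal{S}_0=\{\{n\}:n\in\mathbb{N}\}$, $\mathcal{S}_1=\{F\subset\mathbb{N}:\#F\le\min F\}$, $\mathcal{S}_{n+1}=\{F=\bigcup_{j=1}^kF_j: F_1<\cdots<F_k\in\mathcal{S}_n,\ k\le\min F_1\}$. A finite sequence $f_1<\cdots<f_k$ in $c_{00}$ is $\mathcal{S}_n$-admissible if $\{\min\operatorname{supp}f_i\}_{i=1}^k\in\mathcal{S}_n$. Pełczyński basis: fix a norm dense sequence $\{s_k\}_k$ in the unit sphere of $C[0,1]$;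 $\{u_k\}_k$ is the unit vector basis of $c_{00}$ with norm $\|\sum_{k=1}^na_ku_k\|_u=\sup\{\|\sum_{k\in F}a_ks_k\|:F\subset\{1,\dots,n\}\}$; $\{u_k^*\}_k$ are its biorthogonals, with dual norm also denoted $\|\cdot\|_u$. Averages: for $G\subset c_{00}$, $f\in G$ is an average of size $s(f)=n$ in $G$ if $f=\frac1n(f_1+\cdots+f_d)$ with $f_i\in G$, $d\le n$. A sequence of averages $\{f_j\}_j$ is very fast growing if $f_1<f_2<\cdots$ and $s(f_j)>2^{\max\operatorname{supp}f_{j-1}}$, $s(f_j)>s(f_{j-1})$ for $j>1$. Coding: fix an infinite $L_0=\{\ell_k:k\in\mathbb{N}\}\subset\mathbb{N}$ with $\ell_1>9$, $\ell_{k+1}>2^{2\ell_k}$, $\sum_k2^{-\ell_k}<\frac1{1000}$, decomposed into infinite (disjoint) sets $L_1,L_2,L_3$. Let $\mathcal{Q}$ be the set of finite sequences $(f_1,\dots,f_m)$, $f_1<\cdots<f_m$ in $c_{00}$ with rational coordinates, and fix a one to one $\sigma:\mathcal{Q}\to L_2$ with $\sigma(f_1,\dots,f_m)>2^{1/\|f_m\|_0}\max\operatorname{supp}f_m$. Norming set: $W$ is the smallest subset of $c_{00}$ such that: 1. $\pm e_n\in W$ for all $n$ (type 0 functionals); $W$ is symmetric, closed under restrictions to intervals and under rational convex combinations. 2. $W$ contains every $f=\frac1{2^n}\sum_{q=1}^d\alpha_q$, $n\in\mathbb N$, with $\{\alpha_q\}_{q=1}^d$ an $\mathcal{S}_n$-admissible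 very fast growing sequence of $\alpha$-averages in $W$; $g=\pm Ef$ ($E$ interval) is called of type I$_\alpha$ with weight $w(g)=n$. 3. The same with $\beta$-averages $\{\beta_q\}_{q=1}^d$ in $W$; $g=\pm Ef$ is called of type I$_\beta$ with weight $w(g)=n$. 4. For every special sequence $\{f_q,g_q\}_{q=1}^d$ in $W$ and $F\subset\{1,\dots,d\}$ with $2\#F\le\min\operatorname{supp}f_{\min F}$, $W$ contains $f=\frac12\sum_{q\in F}(f_q+g_q)$; $g=\pm Ef$ is called of type II$_+$, with weights $\widehat w(g)=\{w(f_q):q\in F,\operatorname{ran}(f_q+g_q)\cap E\ne\varnothing\}$. 5. For special sequences and $F$ as in 4 and $\{\lambda_q\}_{q\in F}\subset\mathbb{Q}$ with $\|\sum_{q\in F}\lambda_qu_q^*\|_u\le1$, $W$ contains $f=\frac12\sum_{q\in F}\lambda_q(f_q-g_q)$; $g=\pm Ef$ is called of type II$_-$, with weights $\widehat w(g)=\{w(f_q):q\in F,\operatorname{ran}(f_q-g_q)\cap E\neq\varnothing\}$. Functionals of type II$_+$ or II$_-$ are of type II. A sequence of pairs of type I$_\alpha$ functionals $\{f_q,g_q\}_{q=1}^d$ is special if $f_1<g_1<f_2<\cdots<f_d<g_d$, $w(f_q)=w(g_q)$ for all $q$, $w(f_1)\in L_1$ and $\sigma(f_1,g_1,\dots,f_{q-1},g_{q-1})=w(f_q)$ for $1<q\le d$. An $\alpha$-average is $\alpha=\frac1n\sum_{j=1}^df_j\in W$, $d\le n$, with $f_1<\cdots<f_d$ in $W$. A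 $\beta$-average is $\beta=\frac1n\sum_{j=1}^df_j\in W$, $d\le n$, with $f_j\in W$ of type II with pairwise disjoint weight sets $\widehat w(f_j)$. An infinite sequence $\{f_q,g_q\}_{q=1}^\infty$ of pairs of type I$_\alpha$ functionals is a special branch if $\{f_q,g_q\}_{q=1}^d$ is a special sequence for all $d$. The space: $\|x\|=\sup\{f(x):f\in W\}$ for $x\in c_{00}$, and $\mathfrak{X}$ is the completion of $(c_{00},\|\cdot\|)$; $\{e_n\}_n$ is a bimonotone Schauder basis of it. Exact vectors: $\sum_{k\in F}c_ke_k$ is an $(n,\varepsilon)$ basic s.c.c. if $F\in\mathcal{S}_n$, $c_k\ge0$, $\sum_{k\in F}c_k=1$ and $\sum_{k\in G}c_k<\varepsilon$ for every $G\subset F$, $G\in\mathcal{S}_{n-1}$. For $x_1<\cdots<x_m$, $\sum c_kx_k$ is an $(n,\varepsilon)$ s.c.c. if $\sum c_ke_{\min\operatorname{supp}x_k}$ is an $(n,\varepsilon)$ basic s.c.c. For $C\ge1$ and strictly increasing $\{n_k\}_k\subset\mathbb{N}$, a block sequence $\{x_k\}_k$ is a $(C,\{n_k\}_k)$ $\alpha$-RIS if $\|x_k\|\le C$, $2^{-n_{k+1}}\max\operatorname{supp}x_k<2^{-n_k}$ for all $k$, and $|f(x_k)|<C/2^n$ for every $f\in W$ of type I$_\alpha$ with $w(f)=n<n_k$. For $n\in\mathbb{N}$, $C\ge1$, $\theta>0$, $x\in\mathfrak{X}$ is a $(C,\theta,n)$ exact vector if there are $0<\varepsilon<\frac1{36C2^{3n}}$,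 a block sequence $\{x_k\}_{k=1}^m$ with $\|x_k\|\le C$, and $c_k\in[0,1]$ such that $\min\operatorname{supp}x_1\ge8C2^{2n}$, $\sum_kc_kx_k$ is an $(n,\varepsilon)$ s.c.c., $x=2^n\sum_kc_kx_k$, $\|x\|\ge\theta$, and $\{x_k\}_{k=1}^m$ is a $(C,\{n_k\}_{k=1}^m)$ $\alpha$-RIS for some strictly increasing $\{n_k\}_{k=1}^m$ with $n_1>2^{2n}$. Exact pairs, nodes, dependent sequences: $\{x,f\}$ with $x\in\mathfrak{X}$, $f\in W$ is an $n$-exact pair if $f$ is of type I$_\alpha$ with $w(f)=n$, $\min\operatorname{supp}x\le\min\operatorname{supp}f$, $\max\operatorname{supp}x\le\max\operatorname{supp}f$, and there is a $(5,1,n)$ exact vector $x'$ with $1\ge f(x')>\frac{35}{36}$ and $x=x'/f(x')$. $\{x,y,f,g\}$ is an $n$-exact node if $\{x,f\}$ and $\{y,g\}$ are $n$-exact pairs and $\max\operatorname{supp}f<\min\operatorname{supp}y$. $\{x_k,y_k,f_k,g_k\}_{k=1}^\infty$ is a dependent sequence if each $\{x_k,y_k,f_k,g_k\}$ is an $n_k$-exact node (for some $n_k$), $\max\operatorname{supp}g_k<\min\operatorname{supp}x_{k+1}$ for all $k$, and $\{f_k,g_k\}_{k=1}^\infty$ is a special branch. *)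

(* Defs.v *)
From HB Require Import structures.
From mathcomp Require Import all_boot all_order all_algebra finmap.
From mathcomp Require Import all_classical all_reals all_analysis.
Set Implicit Arguments.
Unset Strict Implicit.
Unset Printing Implicit Defensive.
Import Order.TTheory GRing.Theory Num.Theory.
Import numFieldNormedType.Exports.
Local Open Scope classical_set_scope.
Local Open Scope ring_scope.

(* Conventions.
   - The natural numbers of the mathematics start at 1.  Families x_1, x_2, ...
     are functions on nat whose value at 0 is never used, and (x_1, ..., x_d) is
     [fam x d].
   - A finitely supported sequence is an element x of {poly R}: the coordinate
     x(i) is the coefficient x`_i and e_i (as well as u_i, u_i^* ) is 'X^i.  The
     ring product of {poly R} plays no role.  c_00 consists of the x with
     x`_0 = 0.
   - Types, weights, weight sets and sizes of functionals come from a
     representation, which need not be unique; they are relations, e.g.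
     [typeIa G n g] reads "g is of type I_alpha with w(g) = n".  They are
     relative to a set G of functionals, since they occur in the closure
     conditions defining W. *)

Section FinitelySupported.
Variable R : realType.
Implicit Types (x y f : {poly R}) (xs : seq {poly R}).

Definition c00 : set {poly R} := [set x | x`_0 = 0].

Definition minsupp x : nat := find (fun a : R => a != 0) x.
Definition maxsupp x : nat := (size x).-1.

(* f(x) = sum_i f(i) x(i) *)
Definition act f x : R := \sum_(i < size f) f`_i * x`_i.

(* E x for the interval E = {a, ..., b}, empty if b < a; on finitely supported
   vectors unbounded intervals act as bounded ones. *)
Definition restr (a b : nat) x : {poly R} :=
  \poly_(i < size x) (if (a <= i <= b)%N then x`_i else 0).

Definition meets_ran (a b : nat) x : Prop :=
  exists i, (minsupp x <= i <= maxsupp x)%N /\ (a <= i <= b)%N.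

Definition norm0 x : R := \big[Num.max/0]_(i < size x) `|x`_i|.

Definition fam (T : Type) (x : nat -> T) (d : nat) : seq T :=
  [seq x q | q <- iota 1 d].

(* xs = (x_1, ..., x_d) with x_1 < ... < x_d nonzero vectors of c_00 *)
Definition block xs : Prop :=
  (forall x, x \in xs -> c00 x /\ x != 0) /\
  sorted (fun x y => (maxsupp x < minsupp y)%N) xs.

End FinitelySupported.

Section Schreier.
Local Open Scope fset_scope.

(* Members of the families are nonempty. *)
Fixpoint schreier (n : nat) (F : {fset nat}) : Prop :=
  match n with
  | 0 => exists2 k, (0 < k)%N & F = [fset k]
  | S n' =>
    match n' with
    | 0 => F != fset0 /\ (forall i, i \in F -> (#|` F| <= i)%N)
    | S _ => exists k (Fs : nat -> {fset nat}),
        [/\ (0 < k)%N,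
            F = \bigcup_(A <- fam Fs k) A,
            forall j, (0 < j <= k)%N -> schreier n' (Fs j),
            forall j, (0 < j < k)%N -> forall a b,
              a \in Fs j -> b \in Fs j.+1 -> (a < b)%N
          & forall i, i \in Fs 1%N -> (k <= i)%N]
    end
  end.

Definition admissible (R : realType) (n d : nat) (x : nat -> {poly R}) : Prop :=
  block (fam x d) /\ schreier n [fset k | k in [seq minsupp y | y <- fam x d]].

Definition is_min (F : {fset nat}) (q0 : nat) : Prop :=
  q0 \in F /\ forall q, q \in F -> (q0 <= q)%N.

End Schreier.

Section Pelczynski.
Variable R : realType.

(* C[0,1] is represented by functions R -> R continuous on [0,1], of which only
   the values on [0,1] matter. *)
Definition C01 (h : R -> R) : Prop := {within `[0, 1]%classic, continuous h}.
Definition supnorm (h : R -> R) : R := sup [set `|h t| | t in `[0, 1]%classic].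

Definition dense_in_sphere (s : nat -> R -> R) : Prop :=
  (forall k, (0 < k)%N -> C01 (s k) /\ supnorm (s k) = 1) /\
  (forall h, C01 h -> supnorm h = 1 -> forall eps : R, 0 < eps ->
     exists2 k, (0 < k)%N & supnorm (fun t => h t - s k t) < eps).

Variable s : nat -> R -> R.

(* || sum_k a(k) u_k ||_u *)
Definition norm_u (a : {poly R}) : R :=
  sup [set supnorm (fun t => \sum_(k <- F) a`_k * s k t) |
        F in [set F : {fset nat} |
               forall k, k \in F -> (0 < k <= maxsupp a)%N]].

(* || sum_k b(k) u_k^* ||_u, the dual norm *)
Definition dual_norm_u (b : {poly R}) : R :=
  sup [set act b a | a in [set a | c00 a /\ norm_u a <= 1]].

End Pelczynski.

Section Coding.
Variable R : realType.

Definition coding_sets (L1 L2 L3 : set nat) : Prop :=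
  exists l : nat -> nat,
    [/\ (9 < l 1)%N,
        forall k, (0 < k)%N -> (2 ^ (2 * l k) < l k.+1)%N,
        (\sum_(1 <= k <oo) ((2 ^- l k : R)%:E) < ((1000%:R)^-1 : R)%:E)%E,
        L1 `|` L2 `|` L3 = [set l k | k in [set k | (0 < k)%N]]
      & [/\ L1 `&` L2 = set0, L1 `&` L3 = set0, L2 `&` L3 = set0
          & [/\ infinite_set L1, infinite_set L2 & infinite_set L3]]].

Definition Qseq : set (seq {poly R}) :=
  [set xs | [/\ xs != [::], block xs
              & forall x, x \in xs -> forall i, exists r : rat, x`_i = ratr r]].

Definition coding_function (L2 : set nat) (sigma : seq {poly R} -> nat) : Prop :=
  [/\ forall xs, Qseq xs -> L2 (sigma xs),
      forall xs ys, Qseq xs -> Qseq ys -> sigma xs = sigma ys -> xs = ys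
    & forall xs, Qseq xs ->
        2 `^ (norm0 (last 0 xs))^-1 * (maxsupp (last 0 xs))%:R < (sigma xs)%:R].

End Coding.

Section NormingSet.
Variable R : realType.
Variables (s : nat -> R -> R) (L1 : set nat) (sigma : seq {poly R} -> nat).
Implicit Types (G : set {poly R}) (f g : nat -> {poly R}) (h : {poly R}).

Definition alpha_average G (n : nat) (alpha : {poly R}) : Prop :=
  G alpha /\ exists d f,
    [/\ (0 < d <= n)%N, block (fam f d), forall j, (0 < j <= d)%N -> G (f j)
      & alpha = n%:R^-1 *: \sum_(1 <= j < d.+1) f j].

(* sz is the sequence of the sizes s(x_j) *)
Definition very_fast_growing (d : nat) (x : nat -> {poly R}) (sz : nat -> nat) :=
  block (fam x d) /\
  forall j, (1 < j <= d)%N ->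
    (2 ^ maxsupp (x j.-1) < sz j)%N /\ (sz j.-1 < sz j)%N.

(* The functionals 2^-n (a_1 + ... + a_d) for an S_n-admissible very fast
   growing sequence of averages; [avg k a] reads "a is an average of size k". *)
Definition schreier_sum (avg : nat -> {poly R} -> Prop) (n : nat) h : Prop :=
  (0 < n)%N /\ exists d (a : nat -> {poly R}) (sz : nat -> nat),
    [/\ (0 < d)%N, admissible n d a, very_fast_growing d a sz,
        forall q, (0 < q <= d)%N -> avg (sz q) (a q)
      & h = 2 ^- n *: \sum_(1 <= q < d.+1) a q].

Definition typeIa G (n : nat) (g : {poly R}) : Prop :=
  exists h (sg : bool) a b,
    schreier_sum (alpha_average G) n h /\ g = (-1) ^+ sg *: restr a b h.

(* (f_1, g_1, ..., f_d, g_d) *)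
Definition interleave f g (d : nat) : seq {poly R} :=
  flatten [seq [:: f q; g q] | q <- iota 1 d].

(* {f_q, g_q}_{q=1}^d is special, with w q the common weight of f_q and g_q *)
Definition special G (d : nat) f g (w : nat -> nat) : Prop :=
  [/\ forall q, (0 < q <= d)%N ->
        [/\ G (f q), G (g q), typeIa G (w q) (f q) & typeIa G (w q) (g q)],
      block (interleave f g d),
      (0 < d)%N -> L1 (w 1%N)
    & forall q, (1 < q <= d)%N -> sigma (interleave f g q.-1) = w q].

Definition special_on G (d : nat) f g (w : nat -> nat) (F : {fset nat}) : Prop :=
  [/\ special G d f g w, forall q, q \in F -> (0 < q <= d)%N
    & exists2 q0, is_min F q0 & (2 * #|` F| <= minsupp (f q0))%N].

Definition sum_plus f g (F : {fset nat}) : {poly R} :=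
  2^-1 *: \sum_(q <- F) (f q + g q).

Definition sum_minus f g (lam : nat -> rat) (F : {fset nat}) : {poly R} :=
  2^-1 *: \sum_(q <- F) ratr (lam q) *: (f q - g q).

Definition lam_ok (lam : nat -> rat) (F : {fset nat}) : Prop :=
  dual_norm_u s (\sum_(q <- F) ratr (lam q) *: 'X^q) <= 1.

(* S is the weight set of h *)
Definition typeIIplus G (S : set nat) h : Prop :=
  exists d f g w F (sg : bool) a b,
    [/\ special_on G d f g w F,
        h = (-1) ^+ sg *: restr a b (sum_plus f g F)
      & S = [set w q | q in [set q | q \in F /\ meets_ran a b (f q + g q)]]].

Definition typeIIminus G (S : set nat) h : Prop :=
  exists d f g w F lam (sg : bool) a b,
    [/\ special_on G d f g w F, lam_ok lam F,
        h = (-1) ^+ sg *: restr a b (sum_minus f g lam F)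
      & S = [set w q | q in [set q | q \in F /\ meets_ran a b (f q - g q)]]].

Definition typeII G S h : Prop := typeIIplus G S h \/ typeIIminus G S h.

Definition beta_average G (n : nat) (beta : {poly R}) : Prop :=
  G beta /\ exists d f (S : nat -> set nat),
    [/\ (0 < d <= n)%N,
        forall j, (0 < j <= d)%N -> G (f j) /\ typeII G (S j) (f j),
        forall i j, (0 < i <= d)%N -> (0 < j <= d)%N -> i != j ->
          S i `&` S j = set0
      & beta = n%:R^-1 *: \sum_(1 <= j < d.+1) f j].

Record norming_closed G : Prop := NormingClosed {
  norming_opp : forall h, G h -> G (- h);
  norming_restr : forall a b h, G h -> G (restr a b h);
  norming_convex : forall n (h : 'I_n -> {poly R}) (r : 'I_n -> rat),
    (forall i, G (h i)) -> (forall i, 0 <= r i) -> \sum_i r i = 1 ->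
    G (\sum_i ratr (r i) *: h i);
  norming_Ia : forall n h, schreier_sum (alpha_average G) n h -> G h;
  norming_Ib : forall n h, schreier_sum (beta_average G) n h -> G h;
  norming_IIplus : forall d f g w F,
    special_on G d f g w F -> G (sum_plus f g F);
  norming_IIminus : forall d f g w F lam,
    special_on G d f g w F -> lam_ok lam F -> G (sum_minus f g lam F) }.

(* Every closure condition is monotone in G, so the intersection is closed. *)
Definition W : set {poly R} :=
  smallest norming_closed
    [set h | exists2 n, (0 < n)%N & h = 'X^n \/ h = - 'X^n].

Definition normX (x : {poly R}) : R := sup [set act h x | h in W].

Definition basic_scc (n : nat) (eps : R) (v : {poly R}) : Prop :=
  (0 < n)%N /\ exists (F : {fset nat}) (c : nat -> R),
    [/\ v = \sum_(k <- F) c k *: 'X^k,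
        schreier n F,
        forall k, k \in F -> 0 <= c k,
        \sum_(k <- F) c k = 1
      & forall G : {fset nat}, (G `<=` F)%fset -> schreier n.-1 G ->
          \sum_(k <- G) c k < eps].

Definition scc (n : nat) (eps : R) (m : nat) (x : nat -> {poly R})
    (c : nat -> R) : Prop :=
  block (fam x m) /\
  basic_scc n eps (\sum_(1 <= k < m.+1) c k *: 'X^(minsupp (x k))).

Definition alpha_RIS (C : R) (m : nat) (nk : nat -> nat)
    (x : nat -> {poly R}) : Prop :=
  [/\ block (fam x m),
      forall k, (0 < k < m)%N -> (nk k < nk k.+1)%N,
      forall k, (0 < k <= m)%N -> normX (x k) <= C,
      forall k, (0 < k < m)%N -> 2 ^- nk k.+1 * (maxsupp (x k))%:R < 2 ^- nk k :> R
    & forall k, (0 < k <= m)%N -> forall n h, W h -> typeIa W n h ->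
        (n < nk k)%N -> `|act h (x k)| < C / 2 ^+ n].

Definition exact_vector (C theta : R) (n : nat) (x : {poly R}) : Prop :=
  [/\ 1 <= C, 0 < theta, (0 < n)%N &
  exists (eps : R) (m : nat) (xk : nat -> {poly R}) (c : nat -> R)
         (nk : nat -> nat),
    [/\ 0 < eps < (36 * C * 2 ^+ (3 * n))^-1,
        [/\ (0 < m)%N, block (fam xk m),
            forall k, (0 < k <= m)%N -> normX (xk k) <= C
          & forall k, (0 < k <= m)%N -> 0 <= c k <= 1],
        8 * C * 2 ^+ (2 * n) <= (minsupp (xk 1%N))%:R /\ scc n eps m xk c,
        x = 2 ^+ n *: (\sum_(1 <= k < m.+1) c k *: xk k) /\ theta <= normX x
      & alpha_RIS C m nk xk /\ (2 ^ (2 * n) < nk 1)%N]].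

Definition exact_pair (n : nat) (x h : {poly R}) : Prop :=
  [/\ W h, typeIa W n h, (minsupp x <= minsupp h)%N, (maxsupp x <= maxsupp h)%N
    & exists x', [/\ exact_vector 5 1 n x', 35 / 36 < act h x' <= 1
                   & x = (act h x')^-1 *: x']].

Definition exact_node (n : nat) (x y h h' : {poly R}) : Prop :=
  [/\ exact_pair n x h, exact_pair n y h' & (maxsupp h < minsupp y)%N].

(* The k-th node is w(f_k)-exact, where w(f_k) = w k is the weight of f_k in the
   special branch. *)
Definition dependent_sequence (x y f g : nat -> {poly R}) : Prop :=
  exists w : nat -> nat,
    [/\ forall k, (0 < k)%N -> exact_node (w k) (x k) (y k) (f k) (g k),
        forall k, (0 < k)%N -> (maxsupp (g k) < minsupp (x k.+1))%N
      & forall d, special W d f g w].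

End NormingSet.

(* Main.v *)
Require Import Defs.
From HB Require Import structures.
From mathcomp Require Import all_boot all_order all_algebra finmap.
From mathcomp Require Import all_classical all_reals all_analysis.
From mathcomp Require Import zify ring lra.
Set Implicit Arguments.
Unset Strict Implicit.
Unset Printing Implicit Defensive.
Import Order.TTheory GRing.Theory Num.Theory.
Import numFieldNormedType.Exports.
Local Open Scope classical_set_scope.
Local Open Scope ring_scope.

(** Write [z_j = x_j - y_j], [Z = \sum_i c_i z_(k_i)] and [U] for the norm of
    [\sum_i c_i u_(k_i)].

    The lower estimate ([combination_lower_bound]). The functional [f_j - g_j] takes
    the value 2 at [z_j] and vanishes on the other nodes, so that a functional of
    type II_- along the branch takes the value [\sum_i lambda_(k_i) c_i] at [Z].
    Since [m <= k_1] and supports grow much faster than indices, the set of all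
    [k_i] is admissible for such functionals. The norm [U] is the supremum of the
    numbers [|\sum_(j in F) c_j s_j(t)|], and the coefficients [s_j(t)], [j in F],
    have dual norm at most 1 by the very definition of the norm; they only have to
    be approximated by rational ones.

    The upper estimate ([combination_bounded]). One shows [|h(E Z)| <= 146 U] for all
    intervals [E] by induction over the norming set.
    - Let [h] be of type I and weight [n]. The averages in [h] grow so fast that all
      of them but the first one acting on [Z] have size at least [2 ^ min supp Z].
      The first one contributes at most half of the induction hypothesis. The rest
      is nearly zero on each node ([tail_node_error]), except possibly on the one
      node whose weight and support are on different sides of [n].
    - Let [h] be of type II. By the gaps in the coding set, the weight of each of its
      pairs is much lower than, equal to, or much higher than the weight of a given
      node. Pairs of lower weight behave like functionals of type I and their weights
      are summable; pairs of higher weight are small on the node. As the coding is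
      injective, a pair of the same weight occurs at the same position, and [h]
      follows the branch before that position ([special_coding]); so [h] acts on
      the nodes by its coefficients, except on the node where it leaves the branch
      and on the two nodes cut by [E]. For type II_+ the actions of [f_j] on [x_j]
      and of [g_j] on [- y_j] cancel; for type II_- the coefficients form a sequence
      of dual norm at most 1, which gives [U].

    What is used about the nodes is collected in the record [tame], and derived from
    estimates on exact vectors [X = 2 ^ w \sum_k c_k x_k]. The coefficients are
    spread so evenly that a set of indices whose minima form an [S_(w-1)] set has mass
    at most [eps], much less than [2 ^- (3 w)], and can be neglected. Two facts
    about Schreier families produce such sets: [S_n[S_1]] is contained in [S_(n+1)],
    which serves for functionals of low weight ([tail_estimate]), and [S_n] is
    contained in [S_r[S_(n-r)]], which serves for those of high weight
    ([group_estimate]). A functional of type II also has exceptional indices, at which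
    one of its weights is comparable to that of [x_k]; they are negligible since the
    number of pairs is bounded by the first support ([mass_exceptional]). An induction
    over the norming set bounds every functional on [E X] by [5 C] times the mass of
    [E], up to a small error ([exact_bounded_W]); from this it follows that averages
    of large size, hence all functionals of lower weight up to their first average,
    are small on [X]. *)

Ltac nlia :=
  repeat match goal with
  | H : is_true (leq _ _) |- _ => revert H
  | H : is_true (andb _ _) |- _ => revert H
  | H : is_true (orb _ _) |- _ => revert H
  | H : is_true (negb _) |- _ => revert H
  | H : @eq nat _ _ |- _ => revert H
  | H : @eq bool _ _ |- _ => revert H
  end; clear; intros; lia.

(** * Schreier families *)

Section SchreierFamilies.
Local Open Scope fset_scope.
Local Open Scope nat_scope.
Implicit Types (F G T : {fset nat}).

Lemma schreier_nonempty n F : schreier n F -> exists x, x \in F.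
Proof.
elim: n F => [F [k k0 ->]|[|n] IH F]; first by exists k; rewrite inE.
  by case=> /fset0Pn.
move=> [k [Fs [k0 -> HFs _ _]]].
have [x xF1] := IH _ (HFs 1 ltac:(lia)).
exists x; apply/bigfcupP; exists (Fs 1) => //.
by rewrite andbT; apply/mapP; exists 1 => //; rewrite mem_iota; lia.
Qed.

Lemma schreier_gt0 n F x : schreier n F -> x \in F -> 0 < x.
Proof.
elim: n F => [F [k k0 ->]|[|n] IH F]; first by rewrite inE => /eqP ->.
  by case=> F0 HF xF; apply: leq_trans (HF x xF); rewrite cardfs_gt0.
move=> [k [Fs [k0 -> HFs _ _]]] /bigfcupP[A]; rewrite andbT => /mapP[j].
by rewrite mem_iota => jk -> xj; apply: (IH _ (HFs j _)) => //; lia.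
Qed.

Definition fibre (lab : nat -> nat) F (l : nat) : {fset nat} :=
  [fset y in F | lab y == l].

Lemma in_fibre lab F l x : (x \in fibre lab F l) = (x \in F) && (lab x == l).
Proof. by rewrite !inE. Qed.

Lemma sorted_fset (L : {fset nat}) : exists v : nat -> nat,
  [/\ forall j, 0 < j <= #|` L| -> v j \in L,
      forall i j, 0 < i -> i < j <= #|` L| -> v i < v j
    & forall l, l \in L -> exists2 j, 0 < j <= #|` L| & v j = l].
Proof.
pose s := sort leq (enum_fset L).
have sL : size s = #|` L| by rewrite size_sort.
have mems x : (x \in s) = (x \in L) by rewrite mem_sort.
have srt : sorted ltn s.
  by rewrite ltn_sorted_uniq_leq sort_uniq fset_uniq (sort_sorted leq_total).
exists (fun j => nth 0 s j.-1); split.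
- by move=> j jk; rewrite -mems mem_nth // sL; lia.
- move=> i j i0 /andP[ij jk].
  by rewrite (sorted_ltn_nth ltn_trans) // ?inE ?sL; lia.
- move=> l; rewrite -mems => ls; exists (index l s).+1; last by rewrite nth_index.
  by rewrite -sL /= index_mem.
Qed.

(** In contrast with the definition, the labels of the [S_n] pieces may be chosen
    freely and the case [n = 0] is uniform; inductions over [n] use this form. *)
Lemma schreierSP n F :
  schreier n.+1 F <->
  F != fset0 /\ exists lab : nat -> nat,
    [/\ forall x y, x \in F -> y \in F -> x <= y -> lab x <= lab y,
        forall x, x \in F -> schreier n (fibre lab F (lab x))
      & forall x, x \in F -> #|` lab @` F| <= x].
Proof.
split.
- move=> SF; split; first by apply/fset0Pn; exact: schreier_nonempty SF.
  case: n SF => [|n].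
  + move=> SF; exists id; split => //.
    * move=> x xF; exists x; first exact: schreier_gt0 SF xF.
      by apply/fsetP => y; rewrite in_fibre !inE andbC; case: eqP => //= ->.
    * by move=> x xF; rewrite imfset_id; case: SF => _; exact.
  + move=> [k [Fs [k0 FE HFs Hord Hk]]].
    have {}HFs j : 0 < j <= k -> schreier n.+1 (Fs j) := HFs j.
    have Fsin j x : 0 < j <= k -> x \in Fs j -> x \in F.
      move=> jk xj; rewrite FE; apply/bigfcupP; exists (Fs j) => //.
      by rewrite andbT; apply/mapP; exists j => //; rewrite mem_iota; lia.
    have inFs x : x \in F -> exists2 j, 0 < j <= k & x \in Fs j.
      rewrite FE => /bigfcupP[A]; rewrite andbT => /mapP[j].
      by rewrite mem_iota => jk -> xj; exists j => //; lia.
    have ord i d a b : 0 < i -> i + d < k -> a \in Fs i -> b \in Fs (i + d.+1) ->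
        a < b.
      elim: d a b => [|d IH] a b i0 idk ai bj.
        by apply: (Hord i) => //; [lia|rewrite addn1 in bj].
      have [c cd] := schreier_nonempty (HFs (i + d.+1) ltac:(lia)).
      apply: (@ltn_trans c); first by apply: IH => //; lia.
      apply: (Hord (i + d.+1)) => //; first lia.
      by rewrite -addnS.
    have /choice[lab Hlab] x : exists j, x \in F -> 0 < j <= k /\ x \in Fs j.
      have [/inFs[j jk xj]|nF] := boolP (x \in F); first by exists j.
      by exists 0.
    have labE j x : 0 < j <= k -> x \in Fs j -> lab x = j.
      move=> jk xj; have xF := Fsin _ _ jk xj; have [lk xl] := Hlab _ xF.
      case: (ltngtP (lab x) j) => // lj.
        have := @ord (lab x) (j - lab x).-1 x x ltac:(lia) ltac:(lia) xl.
        by rewrite (_ : lab x + _ = j) ?ltnn; [move=> /(_ xj)|lia].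
      have := @ord j (lab x - j).-1 x x ltac:(lia) ltac:(lia) xj.
      by rewrite (_ : j + _ = lab x) ?ltnn; [move=> /(_ xl)|lia].
    exists lab; split.
    * move=> x y xF yF xy; have [lx xl] := Hlab _ xF; have [ly yl] := Hlab _ yF.
      case: leqP => // lxy.
      have := @ord (lab y) (lab x - lab y).-1 y x ltac:(lia) ltac:(lia) yl.
      by rewrite (_ : lab y + _ = lab x); [move=> /(_ xl); lia|lia].
    * move=> x xF; have [lx xl] := Hlab _ xF.
      rewrite (_ : fibre _ _ _ = Fs (lab x)); first exact: HFs.
      apply/fsetP => y; rewrite in_fibre; apply/andP/idP.
        by move=> [yF /eqP <-]; case: (Hlab _ yF).
      by move=> yl; split; [exact: Fsin yl|rewrite (labE _ _ lx yl)].
    * move=> x xF; have cardk : #|` lab @` F| <= k.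
        rewrite -(size_iota 1 k) cardfE -(cardfE) ; apply: uniq_leq_size.
          exact: fset_uniq.
        move=> j /imfsetP[y /= yF ->]; rewrite mem_iota.
        by have [] := Hlab _ yF; lia.
      apply: (leq_trans cardk); have [lx xl] := Hlab _ xF.
      have [c c1] := schreier_nonempty (HFs 1 ltac:(lia)).
      have := Hk _ c1; have [l1|l1] := eqVneq (lab x) 1; last first.
        have := @ord 1 (lab x - 2) c x ltac:(lia) ltac:(lia) c1.
        by rewrite (_ : 1 + _ = lab x); [move=> /(_ xl); lia|lia].
      by move=> _; apply: Hk; rewrite -l1.
- move=> [F0 [lab [mono HF Hk]]].
  case: n HF => [|n] HF.
  + split => // i iF; apply: leq_trans (Hk _ iF).
    rewrite card_in_imfset //= => x y xF yF lxy.
    have [z z0 /fsetP fE] := HF x xF.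
    have := fE x; have := fE y; rewrite !in_fibre !inE xF yF lxy eqxx /=.
    by move=> /esym/eqP -> /esym/eqP ->.
  + have [v [v1 v2 v3]] := sorted_fset (lab @` F).
    have vP j : 0 < j <= #|` lab @` F| -> exists2 x, x \in F & lab x = v j.
      by move=> /v1 /imfsetP[x /= xF ->]; exists x.
    exists #|` lab @` F|, (fun j => fibre lab F (v j)); split.
    * rewrite cardfs_gt0; case/fset0Pn : F0 => x xF; apply/fset0Pn.
      by exists (lab x); apply/imfsetP; exists x.
    * apply/fsetP => x; apply/idP/bigfcupP.
        move=> xF; have [|j jk vj] := v3 (lab x).
          by apply/imfsetP; exists x.
        exists (fibre lab F (v j)); last by rewrite in_fibre xF vj eqxx.
        by rewrite andbT; apply/mapP; exists j => //; rewrite mem_iota; lia.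
      by move=> [A]; rewrite andbT => /mapP[j _ ->]; rewrite in_fibre => /andP[].
    * by move=> j /vP[x xF <-]; exact: HF.
    * move=> j jk a b; rewrite !in_fibre => /andP[aF /eqP la] /andP[bF /eqP lb].
      rewrite ltnNge; apply/negP => ba; have := mono _ _ bF aF ba.
      have := v2 j j.+1 ltac:(lia) ltac:(lia); lia.
    * by move=> i; rewrite in_fibre => /andP[iF _]; exact: Hk.
Qed.

(** Spreading and heredity in one statement: the induction needs both, since
    the level sets of the labels of [G] are only mapped into those of [F]. *)
Lemma schreier_spread n F G (phi : nat -> nat) :
  schreier n F -> G != fset0 ->
  (forall x, x \in G -> phi x \in F /\ phi x <= x) ->
  (forall x y, x \in G -> y \in G -> x < y -> phi x < phi y) ->
  schreier n G.
Proof.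
elim: n F G => [|n IH] F G.
  move=> [k k0 ->] /fset0Pn[x xG] H1 H2; exists x.
    by have := H1 _ xG; rewrite inE => -[/eqP ->]; lia.
  apply/fsetP => y; rewrite inE; apply/idP/eqP => [yG|-> //].
  have [] := H1 _ xG; have [] := H1 _ yG; rewrite !inE => /eqP ey _ /eqP ex _.
  by have := H2 _ _ xG yG; have := H2 _ _ yG xG; rewrite ex ey; lia.
move=> /schreierSP[F0 [lab [mono HF Hk]]] G0 H1 H2.
apply/schreierSP; split => //; exists (lab \o phi); split.
- move=> x y xG yG; rewrite leq_eqVlt => /orP[/eqP -> //|xy] /=.
  have [? _] := H1 _ xG; have [? _] := H1 _ yG.
  by apply: mono => //; apply/ltnW/H2.
- move=> x xG; have [pF px] := H1 _ xG; apply: IH (HF _ pF) _ _ _ => /=.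
  + by apply/fset0Pn; exists x; rewrite in_fibre xG /=.
  + move=> y; rewrite in_fibre /= => /andP[yG /eqP ly]; have [? ?] := H1 _ yG.
    by rewrite in_fibre ly eqxx andbT.
  + by move=> y z; rewrite !in_fibre => /andP[? _] /andP[? _]; exact: H2.
- move=> x xG; have [pF px] := H1 _ xG; apply: leq_trans px; apply: leq_trans (Hk _ pF).
  apply/fsubset_leq_card/fsubsetP => l /imfsetP[y /= yG ->].
  by apply/imfsetP; exists (phi y) => //=; case: (H1 _ yG).
Qed.

Lemma schreier_sub n F G : schreier n F -> G != fset0 ->
  {subset G <= F} -> schreier n G.
Proof.
move=> SF G0 sGF; apply: (@schreier_spread n F G id) => //.
by move=> x xG; split => //; exact: sGF.
Qed.

Lemma schreierS n F : schreier n F -> schreier n.+1 F.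
Proof.
move=> SF; have [x0 x0F] := schreier_nonempty SF.
apply/schreierSP; split; first by apply/fset0Pn; exists x0.
exists (fun=> 0); split => //.
- move=> x _; rewrite (_ : fibre _ _ _ = F) //.
  by apply/fsetP => y; rewrite in_fibre andbT.
- move=> x xF; apply: leq_trans (schreier_gt0 SF xF).
  rewrite -(cardfs1 0); apply/fsubset_leq_card/fsubsetP => l /imfsetP[y /= _ ->].
  by rewrite inE.
Qed.

Lemma schreierW n n' F : n <= n' -> schreier n F -> schreier n' F.
Proof.
move=> nn'; rewrite -(subnK nn'); elim: (n' - n) => // k IH SF.
by rewrite addSn; apply/schreierS/IH.
Qed.

(** The inclusion of [S_n[S_1]] in [S_(n+1)], with the [S_1] sets given as fibres
    of a labelling by an [S_n] set. *)
Lemma schreier_comp1 n F T (lab : nat -> nat) :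
  schreier n T -> F != fset0 ->
  (forall x, x \in F -> lab x \in T /\ lab x <= x) ->
  (forall x y, x \in F -> y \in F -> x <= y -> lab x <= lab y) ->
  (forall x, x \in F -> schreier 1 (fibre lab F (lab x))) ->
  schreier n.+1 F.
Proof.
elim: n F T => [|n IH] F T.
  move=> [t t0 ->] /fset0Pn[x xF] H1 H2 H3.
  have := H3 _ xF; rewrite (_ : fibre _ _ _ = F) //.
  apply/fsetP => y; rewrite in_fibre; case: (boolP (y \in F)) => //= yF.
  have [] := H1 _ xF; have [] := H1 _ yF; rewrite !inE => /eqP -> _ /eqP -> _.
  by rewrite eqxx.
move=> /schreierSP[T0 [mu [mono HT Hk]]] F0 H1 H2 H3.
apply/schreierSP; split => //; exists (mu \o lab); split.
- move=> x y xF yF xy /=; have [? _] := H1 _ xF; have [? _] := H1 _ yF.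
  by apply: mono => //; apply: H2.
- move=> x xF; have [lT lx] := H1 _ xF.
  apply: (IH _ _ (HT _ lT)).
  + by apply/fset0Pn; exists x; rewrite in_fibre xF /=.
  + move=> y; rewrite in_fibre /= => /andP[yF /eqP e].
    by have [? ?] := H1 _ yF; rewrite in_fibre e eqxx andbT.
  + by move=> y z; rewrite !in_fibre => /andP[? _] /andP[? _]; exact: H2.
  + move=> y; rewrite in_fibre => /andP[yF /eqP /= e].
    apply: schreier_sub (H3 _ yF) _ _.
      by apply/fset0Pn; exists y; rewrite !in_fibre yF /= e !eqxx.
    by move=> z; rewrite !in_fibre => /andP[/andP[-> _] ->].
- move=> x xF; have [lT lx] := H1 _ xF; apply: leq_trans lx; apply: leq_trans (Hk _ lT).
  apply/fsubset_leq_card/fsubsetP => l /imfsetP[y /= yF ->].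
  by apply/imfsetP; exists (lab y) => //=; case: (H1 _ yF).
Qed.

(** The inclusion of [S_n] in [S_r[S_(n-r)]]: the points of [B] are the minima of
    the [S_(n-r)] pieces. *)
Lemma schreier_split n r F : r <= n -> schreier n F ->
  exists B : {fset nat},
    [/\ schreier r B, {subset B <= F},
        exists2 b, b \in B & forall x, x \in F -> b <= x
      & forall G, G != fset0 -> {subset G <= F} ->
          (forall b x y, b \in B -> x \in G -> y \in G -> ~ (x < b <= y)) ->
          schreier (n - r) G].
Proof.
elim: r n F => [|r IH] n F rn SF.
  have [x0 x0F] := schreier_nonempty SF.
  have [v [v1 v2 v3]] := sorted_fset F.
  have c0 : 0 < #|` F| by rewrite cardfs_gt0; apply/fset0Pn; exists x0.
  have v1F : v 1 \in F by apply: v1; lia.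
  exists [fset v 1]; split.
  - by exists (v 1) => //; exact: schreier_gt0 SF v1F.
  - by move=> x; rewrite inE => /eqP ->.
  - exists (v 1); first by rewrite inE.
    move=> x /v3[j jk <-]; case: (ltngtP j 1); [lia| |by move=> ->].
    by move=> j1; have := v2 1 j ltac:(lia) ltac:(lia); lia.
  - by move=> G G0 sG _; rewrite subn0; exact: schreier_sub SF _ _.
case: n rn SF => // n rn /schreierSP[F0 [lab [mono HF Hk]]].
have /choice[B HB] l : exists B : {fset nat}, l \in lab @` F ->
    [/\ schreier r B, {subset B <= fibre lab F l},
        exists2 b, b \in B & forall x, x \in fibre lab F l -> b <= x
      & forall G, G != fset0 -> {subset G <= fibre lab F l} ->
          (forall b x y, b \in B -> x \in G -> y \in G -> ~ (x < b <= y)) ->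
          schreier (n - r) G].
  have [/imfsetP[x /= xF ->]|_] := boolP (l \in lab @` F); last by exists fset0.
  by have [B HB] := IH n _ rn (HF _ xF); exists B.
have labF x : x \in F -> lab x \in lab @` F by move=> xF; apply/imfsetP; exists x.
pose BB := \bigcup_(l <- lab @` F) B l.
have BBP b : reflect (b \in F /\ b \in B (lab b)) (b \in BB).
  apply: (iffP idP) => [/bigfcupP[l /andP[lF _] bl]|[bF bl]].
    have [_ sB _ _] := HB _ lF; have := sB _ bl; rewrite in_fibre.
    by move=> /andP[bF /eqP lb]; rewrite lb.
  by apply/bigfcupP; exists (lab b) => //; rewrite labF.
have [x0 x0F] : exists x, x \in F by apply/fset0Pn.
exists BB; split.
- apply/schreierSP; split.
    have [_ sB [b bB _] _] := HB _ (labF _ x0F).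
    apply/fset0Pn; exists b; apply/BBP.
    by have := sB _ bB; rewrite in_fibre => /andP[bF /eqP ->].
  exists lab; split.
  + by move=> x y /BBP[xF _] /BBP[yF _]; exact: mono.
  + move=> x /BBP[xF xB]; have [SB sB _ _] := HB _ (labF _ xF).
    rewrite (_ : fibre _ _ _ = B (lab x)) //; apply/fsetP => y.
    rewrite in_fibre; apply/andP/idP => [[/BBP[yF yB] /eqP <-] //|yB].
    have := sB _ yB; rewrite in_fibre => /andP[yF /eqP e]; split; last by rewrite e.
    by apply/BBP; rewrite e.
  + move=> x /BBP[xF _]; apply: leq_trans (Hk _ xF).
    apply/fsubset_leq_card/fsubsetP => l /imfsetP[y /= /BBP[yF _] ->].
    exact: labF.
- by move=> x /BBP[].
- have [v [v1 v2 v3]] := sorted_fset F.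
  have c0 : 0 < #|` F| by rewrite cardfs_gt0.
  have v1F : v 1 \in F by apply: v1; lia.
  have vmin x : x \in F -> v 1 <= x.
    move=> /v3[j jk <-]; case: (ltngtP j 1); [lia| |by move=> ->].
    by move=> j1; have := v2 1 j ltac:(lia) ltac:(lia); lia.
  have [_ sB [b bB bmin] _] := HB _ (labF _ v1F).
  exists b; last by move=> x xF; apply: leq_trans (vmin _ xF); apply: bmin;
    rewrite in_fibre v1F eqxx.
  by apply/BBP; have := sB _ bB; rewrite in_fibre => /andP[bF /eqP ->].
- move=> G G0 sG sep; have [x xG] : exists x, x \in G by apply/fset0Pn.
  have [_ sB _ HG] := HB _ (labF _ (sG _ xG)).
  have nsep y z : y \in G -> z \in G -> ~ (lab y < lab z).
    move=> yG zG lyz; have [_ sBz [b bB bmin] _] := HB _ (labF _ (sG _ zG)).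
    have := sBz _ bB; rewrite in_fibre => /andP[bF /eqP lb].
    apply: (sep b y z) => //; first by apply/BBP; rewrite lb.
    rewrite bmin ?in_fibre ?sG ?eqxx // andbT ltnNge; apply/negP => yb.
    by have := mono _ _ bF (sG _ yG) yb; rewrite lb; lia.
  rewrite subSS; apply: HG => //.
    move=> y yG; rewrite in_fibre sG //=; apply/eqP.
    by have := nsep _ _ xG yG; have := nsep _ _ yG xG; lia.
  move=> b y z bB yG zG; apply: sep => //; apply/BBP.
  by have := sB _ bB; rewrite in_fibre => /andP[bF /eqP ->].
Qed.

End SchreierFamilies.

(** * Sums and finitely supported vectors *)

Section BigSums.
Variable R : realType.

Lemma sum_at_most_one (I : eqType) (r : seq I) (P : pred I) (F : I -> R) (M : R) :
  uniq r -> 0 <= M -> (forall i, i \in r -> P i -> `|F i| <= M) ->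
  (forall i j, i \in r -> j \in r -> P i -> P j -> F i != 0 -> F j != 0 -> i = j) ->
  `|\sum_(i <- r | P i) F i| <= M.
Proof.
move=> ur M0 HM H1.
have [/hasP[i ir /andP[Pi Fi]]|/hasPn H0] := boolP (has (fun i => P i && (F i != 0)) r).
  rewrite big_mkcond (bigD1_seq i) //= Pi big1_seq ?addr0; first exact: HM.
  move=> j /andP[ji jr]; case: ifP => // Pj; apply/eqP; apply: contraNT ji => Fj.
  by rewrite (H1 j i).
rewrite big1_seq ?normr0 // => i /andP[Pi ir]; apply/eqP.
by have := H0 _ ir; rewrite Pi negbK.
Qed.

Lemma sum_subseq_le (I : eqType) (r t : seq I) (F : I -> R) :
  uniq r -> uniq t -> {subset r <= t} -> (forall i, i \in t -> 0 <= F i) ->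
  \sum_(i <- r) F i <= \sum_(i <- t) F i.
Proof.
move=> ur ut srt F0; rewrite [leRHS](bigID (mem r)) /=.
have -> : \sum_(i <- r) F i = \sum_(i <- t | i \in r) F i.
  rewrite -[RHS]big_filter; apply/perm_big/uniq_perm; rewrite ?filter_uniq //.
  by move=> i; rewrite mem_filter; case: (boolP (i \in r)) => // /srt ->.
by rewrite lerDl big_seq_cond; apply: sumr_ge0 => i /andP[it _]; exact: F0.
Qed.

Lemma sum_geom_le N (r : seq nat) : uniq r -> (forall v, v \in r -> (N <= v)%N) ->
  \sum_(v <- r) (2 ^- v : R) <= 2 * 2 ^- N.
Proof.
move=> ur HN.
have [M HM] : exists M, forall v, v \in r -> (v < N + M)%N.
  exists (\sum_(v <- r) v).+1 => v vr; rewrite (bigD1_seq v) //=; lia.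
apply: (@le_trans _ _ (\sum_(v <- index_iota N (N + M)) 2 ^- v)).
  apply: sum_subseq_le; rewrite ?iota_uniq //.
  by move=> v vr; rewrite mem_index_iota HN //= HM.
suff -> : \sum_(v <- index_iota N (N + M)) (2 ^- v : R) = 2 * 2 ^- N - 2 * 2 ^- (N + M).
  by rewrite gerBl mulr_ge0.
elim: {HM}M => [|M IH]; first by rewrite addn0 /index_iota subnn big_nil subrr.
rewrite addnS big_nat_recr ?leq_addr //= IH exprS invfM mulrA divff ?pnatr_eq0 // mul1r.
lra.
Qed.

(** For families of functionals with disjoint weight sets: bounds by sums over the
    weights of each of them combine into a sum over distinct weights. *)
Lemma sum_disjoint_union d (V : nat -> seq nat) (F : nat -> R) :
  (forall j, (0 < j <= d)%N -> uniq (V j)) ->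
  (forall i j v, (0 < i <= d)%N -> (0 < j <= d)%N -> i != j ->
     v \in V i -> v \in V j -> False) ->
  exists U, [/\ uniq U, forall v, v \in U -> exists2 j, (0 < j <= d)%N & v \in V j
    & \sum_(1 <= j < d.+1) \sum_(v <- V j) F v = \sum_(v <- U) F v].
Proof.
elim: d => [|d IH] uV dV; first by exists [::]; rewrite big_geq // big_nil.
have [| |U [uU HU EU]] := IH.
- by move=> j jd; apply: uV; lia.
- by move=> i j v id jd; apply: dV; lia.
exists (U ++ V d.+1); split.
- rewrite cat_uniq uU uV ?andbT ?ltnSn //=; apply/hasPn => v vd.
  apply/negP => /HU[j jd vj]; apply: (dV j d.+1 v) => //; [lia|lia|].
  by apply/eqP; lia.
- move=> v; rewrite mem_cat => /orP[/HU[j jd vj]|vd]; [exists j => //; lia|].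
  by exists d.+1 => //; lia.
- by rewrite big_nat_recr //= EU big_cat.
Qed.

End BigSums.

Lemma sum_nat_shift (V : nmodType) (F : nat -> V) e d :
  \sum_(e.+1 <= q < (e + d).+1) F q = \sum_(1 <= j < d.+1) F (e + j)%N.
Proof.
rewrite -(add1n e) big_addn (_ : (e + d).+1 - e = d.+1)%N; last lia.
by apply: eq_bigr => q _; rewrite addnC.
Qed.

(** The members of a block sequence that end, or that start, before a given point
    form an initial segment. *)
Lemma downward_threshold d (P : pred nat) :
  (forall q q', (0 < q)%N -> (q <= q' <= d)%N -> P q' -> P q) ->
  exists2 e, (e <= d)%N & forall q, (0 < q <= d)%N -> P q = (q <= e)%N.
Proof.
elim: d => [|d IH] HP; first by exists 0%N => // q; lia.
have [|e ed He] := IH; first by move=> q q' q0 qd; apply: HP => //; lia.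
have [Pd|nPd] := boolP (P d.+1).
  exists d.+1 => // q qd; have -> : (q <= d.+1)%N by lia.
  by apply: HP Pd; lia.
exists e => [|q qd]; first lia.
have [qd'|qd'] := leqP q d; first by apply: He; lia.
have -> : q = d.+1 by lia.
by rewrite (negPf nPd); apply/esym/negbTE; rewrite -ltnNge; lia.
Qed.

Section Vectors.
Variable R : realType.
Implicit Types (x y f g h : {poly R}).

Lemma coef_restr a b x i : (restr a b x)`_i = if (a <= i <= b)%N then x`_i else 0.
Proof. by rewrite coef_poly; case: ltnP => // si; rewrite nth_default ?if_same. Qed.

Lemma restrD a b x y : restr a b (x + y) = restr a b x + restr a b y.
Proof. by apply/polyP => i; rewrite coefD !coef_restr coefD; case: ifP; rewrite ?addr0. Qed.

Lemma restrZ a b c x : restr a b (c *: x) = c *: restr a b x.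
Proof. by apply/polyP => i; rewrite coefZ !coef_restr coefZ; case: ifP; rewrite ?mulr0. Qed.

Lemma restrN a b x : restr a b (- x) = - restr a b x.
Proof. by rewrite -scaleN1r restrZ scaleN1r. Qed.

Lemma restr0 a b : restr a b (0 : {poly R}) = 0.
Proof. by apply/polyP => i; rewrite coef_restr coef0 if_same. Qed.

Lemma restr_sum a b (I : Type) (r : seq I) (P : pred I) (F : I -> {poly R}) :
  restr a b (\sum_(i <- r | P i) F i) = \sum_(i <- r | P i) restr a b (F i).
Proof.
by apply: (big_morph (restr a b)) => [x y|]; rewrite ?restrD ?restr0.
Qed.

Lemma restr_restr a b a' b' x :
  restr a b (restr a' b' x) = restr (maxn a a') (minn b b') x.
Proof.
apply/polyP => i; rewrite !coef_restr geq_max leq_min.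
by case: (a <= i)%N; case: (i <= b)%N; case: (a' <= i)%N; case: (i <= b')%N.
Qed.

Lemma nz_minsupp x : x != 0 -> x`_(minsupp x) != 0.
Proof.
move=> x0; apply: (@nth_find _ 0 (fun a : R => a != 0)).
apply/hasP; exists (lead_coef x); last by rewrite lead_coef_eq0.
by rewrite lead_coefE mem_nth // prednK // lt0n size_poly_eq0.
Qed.

Lemma lt_minsupp x i : (i < minsupp x)%N -> x`_i = 0.
Proof. by move=> im; have /negbFE/eqP := @before_find _ 0 _ _ _ im. Qed.

Lemma gt_maxsupp x i : (maxsupp x < i)%N -> x`_i = 0.
Proof. by move=> im; rewrite nth_default // (leq_trans (leqSpred _) im). Qed.

Lemma nz_supp x i : x`_i != 0 -> (minsupp x <= i <= maxsupp x)%N.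
Proof.
move=> xi; apply/andP; split; rewrite leqNgt; apply/negP => H;
  by move: xi; rewrite ?(lt_minsupp H) ?(gt_maxsupp H) eqxx.
Qed.

Lemma min_le_maxsupp x : x != 0 -> (minsupp x <= maxsupp x)%N.
Proof. by move=> /nz_minsupp/nz_supp/andP[]. Qed.

Lemma minsupp_gt0 x : c00 x -> x != 0 -> (0 < minsupp x)%N.
Proof.
move=> cx /nz_minsupp; case: (posnP (minsupp x)) => // ->.
by rewrite [_`_0]cx eqxx.
Qed.

Lemma restr_id a b x : (a <= minsupp x)%N -> (maxsupp x <= b)%N -> restr a b x = x.
Proof.
move=> ax xb; apply/polyP => i; rewrite coef_restr.
by case: ifPn => // H; apply/esym/eqP; apply: contraNT H => /nz_supp; lia.
Qed.

Lemma restr_eq0 a b x : (maxsupp x < a)%N || (b < minsupp x)%N -> restr a b x = 0.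
Proof.
move=> H; apply/polyP => i; rewrite coef_restr coef0.
by case: ifP => // iab; apply/eqP; apply/negPn; apply/negP => /nz_supp; lia.
Qed.

Lemma act_wide N f x : (size f <= N)%N -> act f x = \sum_(i < N) f`_i * x`_i.
Proof.
move=> sN; rewrite /act (big_ord_widen N (fun i => f`_i * x`_i) sN) [RHS](bigID (fun i : 'I_N => (i < size f)%N)) /=.
rewrite [X in _ = _ + X]big1 ?addr0 // => i; rewrite -leqNgt => H.
by rewrite nth_default ?mul0r.
Qed.

Lemma actC f x : act f x = act x f.
Proof.
rewrite (@act_wide (maxn (size f) (size x)) f) ?leq_maxl //.
rewrite (@act_wide (maxn (size f) (size x)) x) ?leq_maxr //.
by apply: eq_bigr => i _; rewrite mulrC.
Qed.

Lemma actDr f x y : act f (x + y) = act f x + act f y.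
Proof. by rewrite -big_split /=; apply: eq_bigr => i _; rewrite coefD mulrDr. Qed.

Lemma actZr f c x : act f (c *: x) = c * act f x.
Proof. by rewrite mulr_sumr; apply: eq_bigr => i _; rewrite coefZ mulrCA. Qed.

Lemma act0r f : act f 0 = 0.
Proof. by apply: big1 => i _; rewrite coef0 mulr0. Qed.

Lemma actNr f x : act f (- x) = - act f x.
Proof. by rewrite -scaleN1r actZr mulN1r. Qed.

Lemma act_sumr f (I : Type) (r : seq I) (P : pred I) (F : I -> {poly R}) :
  act f (\sum_(i <- r | P i) F i) = \sum_(i <- r | P i) act f (F i).
Proof. by apply: (big_morph (act f)) => [x y|]; rewrite ?actDr ?act0r. Qed.

Lemma actDl f g x : act (f + g) x = act f x + act g x.
Proof. by rewrite actC actDr !(actC x). Qed.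

Lemma actZl c f x : act (c *: f) x = c * act f x.
Proof. by rewrite actC actZr (actC x). Qed.

Lemma act0l x : act 0 x = 0.
Proof. by rewrite actC act0r. Qed.

Lemma actNl f x : act (- f) x = - act f x.
Proof. by rewrite actC actNr (actC x). Qed.

Lemma act_suml (I : Type) (r : seq I) (P : pred I) (F : I -> {poly R}) x :
  act (\sum_(i <- r | P i) F i) x = \sum_(i <- r | P i) act (F i) x.
Proof. by rewrite actC act_sumr; apply: eq_bigr => i _; rewrite actC. Qed.

Lemma act_Xn n x : act 'X^n x = x`_n.
Proof.
rewrite (@act_wide n.+1) ?size_polyXn // (bigD1 ord_max) //= coefXn eqxx mul1r.
rewrite big1 ?addr0 // => i /negPf; rewrite coefXn -val_eqE /= => ->.
by rewrite mul0r.
Qed.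

Lemma act_restr a b f x : act (restr a b f) x = act f (restr a b x).
Proof.
rewrite (@act_wide (size f)) ?size_poly // /act; apply: eq_bigr => i _.
by rewrite !coef_restr; case: ifP; rewrite ?mul0r ?mulr0.
Qed.

Lemma act_eq0 f x : (forall i, f`_i != 0 -> x`_i = 0) -> act f x = 0.
Proof.
move=> H; apply: big1 => i _; have [->|/H ->] := eqVneq f`_i 0; first by rewrite mul0r.
by rewrite mulr0.
Qed.

Lemma act_restr_apart a b f x :
  (maxsupp f < minsupp x)%N || (maxsupp x < minsupp f)%N -> act f (restr a b x) = 0.
Proof.
move=> H; apply: act_eq0 => i /nz_supp fi; rewrite coef_restr; case: ifP => // _.
apply/eqP/negPn/negP => /nz_supp; lia.
Qed.

(* Only the coordinates of x in {1, ..., N} contribute. *)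
Lemma act_le_sup f x (t A : R) N : 0 <= t -> 0 <= A -> x`_0 = 0 -> (maxsupp x <= N)%N ->
  (forall i, `|f`_i| <= t) -> (forall i, `|x`_i| <= A) ->
  `|act f x| <= t * A * N%:R.
Proof.
move=> t0 A0 x0 xN Hf Hx; have sx : (size x <= N.+1)%N by exact: leq_trans (leqSpred _) (xN : ((size x).-1 < N.+1)%N).
rewrite actC (act_wide _ sx).
rewrite big_ord_recl /= x0 mul0r add0r; apply: le_trans (ler_norm_sum _ _ _) _.
apply: (@le_trans _ _ (\sum_(i < N) (t * A))).
  by apply: ler_sum => i _; rewrite normrM mulrC ler_pM.
by rewrite sumr_const card_ord mulr_natr.
Qed.

Lemma blockP (d : nat) (x : nat -> {poly R}) :
  block (fam x d) <->
  (forall q, (0 < q <= d)%N -> c00 (x q) /\ x q != 0) /\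
  (forall q q', (0 < q)%N -> (q < q' <= d)%N -> (maxsupp (x q) < minsupp (x q'))%N).
Proof.
split=> [[H1 H2]|[H1 H2]].
  have nz q : (0 < q <= d)%N -> c00 (x q) /\ x q != 0.
    by move=> qd; apply: H1; apply/mapP; exists q => //; rewrite mem_iota; lia.
  split=> // q q' q0 /andP[]; elim: q' => // q' IH qq' qd.
  have step : (0 < q' < d)%N -> (maxsupp (x q') < minsupp (x q'.+1))%N.
    move=> q'd; have := (sortedP 0 H2); rewrite size_map size_iota.
    move=> /(_ q'.-1 ltac:(lia)).
    rewrite !(nth_map 0%N) ?size_iota ?nth_iota; try lia.
    by rewrite !add1n prednK //; lia.
  move: qq'; rewrite ltnS leq_eqVlt => /orP[/eqP e|qq'].
    by rewrite e; apply: step; lia.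
  have [_ n0] := nz q' ltac:(lia).
  have := IH qq' ltac:(lia); have := min_le_maxsupp n0; have := step ltac:(lia); lia.
split=> [y /mapP[q]|]; first by rewrite mem_iota => qd ->; apply: H1; lia.
apply/(sortedP 0) => i; rewrite size_map size_iota => id.
by rewrite !(nth_map 0%N) ?size_iota ?nth_iota; try lia; apply: H2; lia.
Qed.

Lemma block_at_most_one d (x : nat -> {poly R}) i q q' : block (fam x d) ->
  (0 < q <= d)%N -> (0 < q' <= d)%N -> (x q)`_i != 0 -> (x q')`_i != 0 -> q = q'.
Proof.
move=> /blockP[_ H] qd q'd /nz_supp Hq /nz_supp Hq'.
case: (ltngtP q q') => // qq'.
  by have := H q q' ltac:(lia) ltac:(lia); lia.
by have := H q' q ltac:(lia) ltac:(lia); lia.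
Qed.

Lemma block_sum_coef d (x : nat -> {poly R}) M i : block (fam x d) -> 0 <= M ->
  (forall q, (0 < q <= d)%N -> `|(x q)`_i| <= M) ->
  `|(\sum_(1 <= q < d.+1) x q)`_i| <= M.
Proof.
move=> bx M0 H; rewrite coef_sum; apply: sum_at_most_one => //.
- exact: iota_uniq.
- by move=> q; rewrite mem_index_iota => qd _; apply: H; lia.
- move=> q q'; rewrite !mem_index_iota => qd q'd _ _.
  by apply: block_at_most_one bx _ _; lia.
Qed.

End Vectors.

(** * The norm of the universal unconditional basis and its dual *)

Section PelczynskiNorm.
Variables (R : realType) (s : nat -> R -> R).
Hypothesis hs : dense_in_sphere s.
Implicit Types (a b : {poly R}) (F : {fset nat}).

Lemma sphere_bounded k : (0 < k)%N -> has_ubound [set `|s k t| | t in `[0, 1]%classic].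
Proof.
move=> k0; have [cs _] := hs.1 k k0.
have [c _ Hc] := EVT_max (@ler01 R) cs.
have [c' _ Hc'] := EVT_min (@ler01 R) cs.
exists (Num.max `|s k c| `|s k c'|) => _ [t t01 <-].
have := Hc t; have := Hc' t; rewrite !inE => /(_ t01) H1 /(_ t01) H2.
rewrite ler_norml; apply/andP; split.
  rewrite lerNl le_max; apply/orP; right.
  by rewrite -(normrN (s k c')) (le_trans _ (ler_norm _)) // lerN2.
by rewrite le_max (le_trans H2 (ler_norm _)).
Qed.

Lemma sphere_le1 k t : (0 < k)%N -> `[0, 1]%classic t -> `|s k t| <= 1.
Proof.
move=> k0 t01; have [_ <-] := hs.1 k k0.
by apply: (ub_le_sup (sphere_bounded k0)); exists t.
Qed.

Let psum a F t : R := \sum_(k <- F) a`_k * s k t.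

Let psum_le a F t : (forall k, k \in F -> (0 < k)%N) -> `[0, 1]%classic t ->
  `|psum a F t| <= \sum_(k <- F) `|a`_k|.
Proof.
move=> F0 t01; apply: le_trans (ler_norm_sum _ _ _) _.
rewrite big_seq [leRHS]big_seq; apply: ler_sum => k /F0 k0.
by rewrite normrM ler_piMr // sphere_le1.
Qed.

Let supnorm_ge a F t : (forall k, k \in F -> (0 < k)%N) -> `[0, 1]%classic t ->
  `|psum a F t| <= supnorm (psum a F).
Proof.
move=> F0 t01; apply: ub_le_sup; last by exists t.
by exists (\sum_(k <- F) `|a`_k|) => _ [u u01 <-]; exact: psum_le.
Qed.

Let supnorm_le a F M : (forall t, `[0, 1]%classic t -> `|psum a F t| <= M) ->
  supnorm (psum a F) <= M.
Proof.
move=> H; apply: ge_sup => [|_ [t t01 <-]]; last exact: H.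
by exists `|psum a F 0|; exists 0 => //=; rewrite in_itv /= lexx ler01.
Qed.

Lemma norm_u_le a M :
  (forall F t, (forall k, k \in F -> (0 < k)%N) -> `[0, 1]%classic t ->
     `|\sum_(k <- F) a`_k * s k t| <= M) ->
  norm_u s a <= M.
Proof.
move=> H; apply: ge_sup => [|_ [F FP <-]].
  by exists (supnorm (psum a fset0)); exists fset0.
by apply: supnorm_le => t t01; apply: H => // k /FP/andP[].
Qed.

Lemma norm_u_ge a F t : (forall k, k \in F -> (0 < k)%N) -> `[0, 1]%classic t ->
  `|\sum_(k <- F) a`_k * s k t| <= norm_u s a.
Proof.
move=> F0 t01; pose F' := [fset k in F | (k <= maxsupp a)%N]%fset.
have F'P k : k \in F' = (k \in F) && (k <= maxsupp a)%N by rewrite !inE.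
have -> : \sum_(k <- F) a`_k * s k t = psum a F' t.
  rewrite /psum big_fset /= [RHS]big_mkcond [LHS]big_seq [RHS]big_seq /=.
  apply: eq_bigr => k kF; case: leqP => // /gt_maxsupp ->.
  by rewrite mul0r.
have F'0 k : k \in F' -> (0 < k)%N by rewrite F'P => /andP[/F0].
apply: le_trans (supnorm_ge _ F'0 t01) _; apply: ub_le_sup; last first.
  by exists F' => // k kF'; rewrite F'0 //=; move: kF'; rewrite F'P => /andP[].
exists (\sum_(k <- index_iota 1 (maxsupp a).+1) `|a`_k|) => _ [G GP <-].
apply: supnorm_le => u u01; apply: le_trans (psum_le _ _ u01) _.
  by move=> k /GP/andP[].
apply: sum_subseq_le; rewrite ?iota_uniq ?fset_uniq //.
by move=> k /GP; rewrite mem_index_iota; lia.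
Qed.

Lemma norm_u_coef a k : (0 < k)%N -> `|a`_k| <= norm_u s a.
Proof.
move=> k0; have [->|ak] := eqVneq a`_k 0.
  rewrite normr0; apply: le_trans (@norm_u_ge a fset0 0 _ _) => //=.
  by rewrite in_itv /= lexx ler01.
have ak0 : 0 < `|a`_k| by rewrite normr_gt0.
suff : 1 <= norm_u s a / `|a`_k| by rewrite ler_pdivlMr // mul1r.
have [_ <-] := hs.1 k k0; apply: ge_sup => [|_ [t t01 <-]].
  by exists `|s k 0|; exists 0 => //=; rewrite in_itv /= lexx ler01.
rewrite ler_pdivlMr // mulrC -normrM.
have := @norm_u_ge a [fset k]%fset t _ t01; rewrite big_seq_fset1; apply => j.
by rewrite inE => /eqP ->.
Qed.

Lemma norm_u_ge0 a : 0 <= norm_u s a.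
Proof. exact: le_trans (normr_ge0 _) (@norm_u_coef a 1%N isT). Qed.

Lemma norm_uZ (c : R) a : norm_u s (c *: a) <= `|c| * norm_u s a.
Proof.
apply: norm_u_le => F t F0 t01.
under eq_bigr do rewrite coefZ -mulrA.
by rewrite -mulr_sumr normrM ler_wpM2l // norm_u_ge.
Qed.

(** The norm is a supremum over all finite sets of coordinates. *)
Lemma norm_u_suppress a a' :
  (forall k, a'`_k = a`_k \/ a'`_k = 0) -> norm_u s a' <= norm_u s a.
Proof.
move=> H; apply: norm_u_le => F t F0 t01.
pose F' := [fset k in F | a'`_k == a`_k]%fset.
have -> : \sum_(k <- F) a'`_k * s k t = \sum_(k <- F') a`_k * s k t.
  rewrite big_fset /= [RHS]big_mkcond /=; apply: eq_bigr => k _.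
  by case: eqVneq => [->//|n]; case: (H k) => [/eqP|->]; [rewrite (negPf n)|rewrite mul0r].
by apply: norm_u_ge => // k; rewrite !inE /= => /andP[/F0].
Qed.

Let act_bound a b : c00 a -> norm_u s a <= 1 -> act b a <= \sum_(i < size b) `|b`_i|.
Proof.
move=> ca a1; apply: ler_sum => i _; apply: le_trans (ler_norm _) _.
rewrite normrM ler_piMr //; have [i0|i0] := posnP i.
  by rewrite i0 [_`_0]ca normr0.
by apply: le_trans (norm_u_coef _ i0) a1.
Qed.

(** Where [norm_u s a] vanishes, so does [a]; otherwise [a] is normalized. *)
Lemma dual_norm_act a b : dual_norm_u s b <= 1 -> c00 a -> `|act b a| <= norm_u s a.
Proof.
move=> b1 ca.
have pos a' : c00 a' -> norm_u s a' <= 1 -> act b a' <= 1.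
  move=> ca' a1; apply: le_trans b1; apply: ub_le_sup; last by exists a'.
  by exists (\sum_(i < size b) `|b`_i|) => _ [a2 [? ?] <-]; exact: act_bound.
have scaled (c : R) : `|c| = 1 -> c * act b a <= norm_u s a.
  move=> c1; have [u0|u0] := eqVneq (norm_u s a) 0.
    have -> : a = 0.
      apply/polyP => k; rewrite coef0; case: (posnP k) => [->|k0]; first exact: ca.
      by apply/eqP; rewrite -normr_le0 (le_trans (norm_u_coef a k0)) // u0.
    by rewrite act0r mulr0 norm_u_ge0.
  have ug : 0 < norm_u s a by rewrite lt_neqAle eq_sym u0 norm_u_ge0.
  rewrite -[leRHS]mul1r -ler_pdivrMr //.
  have := pos ((c / norm_u s a) *: a); rewrite actZr mulrAC; apply.
    by rewrite /c00 /= coefZ [a`_0]ca mulr0.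
  apply: le_trans (norm_uZ _ _) _.
  by rewrite normrM c1 mul1r ger0_norm ?invr_ge0 ?norm_u_ge0 // mulVf.
rewrite ler_norml; apply/andP; split.
  by have := scaled (-1); rewrite normrN1 mulN1r lerNl; apply.
by have := scaled 1; rewrite normr1 mul1r; apply.
Qed.

Lemma dual_norm_le1 b : (forall a, c00 a -> act b a <= norm_u s a) -> dual_norm_u s b <= 1.
Proof.
move=> H; apply: ge_sup => [|_ [a [ca a1] <-]]; last exact: le_trans (H _ ca) a1.
exists (act b 0); exists 0 => //; split; first by rewrite /c00 /= coef0.
apply: norm_u_le => F t _ _; rewrite big1 ?normr0 // => k _.
by rewrite coef0 mul0r.
Qed.

Lemma norm_u_Xn q : (0 < q)%N -> norm_u s 'X^q <= 1.
Proof.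
move=> q0; apply: norm_u_le => F t F0 t01.
apply: sum_at_most_one => //.
- by move=> k kF _; rewrite coefXn; case: eqP => [->|_]; rewrite ?mul1r ?mul0r ?normr0 // sphere_le1.
- move=> i j _ _ _ _; rewrite !coefXn.
  case: (i =P q) => [->|_]; last by rewrite mul0r eqxx.
  by case: (j =P q) => [->//|_]; rewrite mul0r eqxx.
Qed.

End PelczynskiNorm.

(** * Special sequences and the norming set *)

Lemma fset_min (F : {fset nat}) : F != fset0 -> exists q0, is_min F q0.
Proof.
move=> /fset0Pn[x xF]; have ex : exists n, n \in F by exists x.
case: (ex_minnP ex) => q qF qmin; exists q; split=> // y; exact: qmin.
Qed.

Section SpecialSequences.
Variable R : realType.
Implicit Types (f g : nat -> {poly R}) (G : set {poly R}).

Let mixed f g (j : nat) := if odd j then f j.+1./2 else g j./2.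

Lemma interleave_fam f g d : interleave f g d = fam (mixed f g) d.*2.
Proof.
rewrite /interleave /fam; elim: d => // d IH.
rewrite doubleS -[in LHS](addn1 d) -(addn2 d.*2) !iotaD !map_cat flatten_cat IH /=.
congr (_ ++ _); rewrite !add1n /mixed /= odd_double /=.
by rewrite doubleK.
Qed.

Lemma mixed_odd f g q : (0 < q)%N -> mixed f g q.*2.-1 = f q.
Proof.
by case: q => // q _; rewrite doubleS /= /mixed /= odd_double /= doubleK.
Qed.

Lemma mixed_even f g q : mixed f g q.*2 = g q.
Proof. by rewrite /mixed odd_double doubleK. Qed.

Lemma block_interleave f g d : block (interleave f g d) ->
  [/\ forall q, (0 < q <= d)%N -> c00 (f q) /\ f q != 0,
      forall q, (0 < q <= d)%N -> c00 (g q) /\ g q != 0,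
      forall q, (0 < q <= d)%N -> (maxsupp (f q) < minsupp (g q))%N
    & forall q q', (0 < q)%N -> (q < q' <= d)%N -> (maxsupp (g q) < minsupp (f q'))%N].
Proof.
rewrite interleave_fam => /blockP[H1 H2]; split.
- by move=> q qd; have := H1 q.*2.-1 ltac:(lia); rewrite mixed_odd //; lia.
- by move=> q qd; have := H1 q.*2 ltac:(lia); rewrite mixed_even.
- move=> q qd; have := H2 q.*2.-1 q.*2 ltac:(lia) ltac:(lia).
  by rewrite mixed_odd ?mixed_even //; lia.
- move=> q q' q0 qd; have := H2 q.*2 q'.*2.-1 ltac:(lia) ltac:(lia).
  by rewrite mixed_odd ?mixed_even //; lia.
Qed.

Lemma interleave_inj f g f' g' d d' : interleave f g d = interleave f' g' d' ->
  d = d' /\ forall j, (0 < j <= d)%N -> f j = f' j /\ g j = g' j.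
Proof.
rewrite !interleave_fam => E; have dd' : d = d'.
  by have /(congr1 size) := E; rewrite !size_map !size_iota; lia.
split=> // j jd; subst d'.
have nthE u i : (0 < i <= d.*2)%N -> nth 0 (fam u d.*2) i.-1 = u i :> {poly R}.
  by move=> id; rewrite (nth_map 0%N) ?size_iota ?nth_iota ?add1n ?prednK //; lia.
have mE i : (0 < i <= d.*2)%N -> mixed f g i = mixed f' g' i.
  by move=> id; rewrite -(nthE (mixed f g)) // -(nthE (mixed f' g')) // E.
by have := mE j.*2.-1 ltac:(lia); have := mE j.*2 ltac:(lia); rewrite !mixed_even !mixed_odd //; lia.
Qed.

Lemma last_interleave f g d : (0 < d)%N -> last 0 (interleave f g d) = g d.
Proof.
move=> d0; rewrite interleave_fam -nth_last size_map size_iota (nth_map 0%N) ?size_iota ?nth_iota; try lia.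
by rewrite add1n prednK ?mixed_even //; lia.
Qed.

Lemma mem_interleave f g d x : x \in interleave f g d ->
  exists2 q, (0 < q <= d)%N & x = f q \/ x = g q.
Proof.
move=> /flatten_mapP[q]; rewrite mem_iota !inE => qd H; exists q; first lia.
by case/orP: H => /eqP ->; [left|right].
Qed.

Variables (L1 : set nat) (sigma : seq {poly R} -> nat).

(* Passing to a subset only raises the first support. *)
Lemma special_onS G d f g w (F F' : {fset nat}) :
  special_on L1 sigma G d f g w F -> F' != fset0 -> {subset F' <= F} ->
  special_on L1 sigma G d f g w F'.
Proof.
move=> [sp Fd [q0 [q0F q0min] card]] F'0 sF; split => // [q /sF/Fd //|].
have [q1 [q1F q1min]] := fset_min F'0; exists q1 => //.
have : (#|` F'| <= #|` F|)%N by apply/fsubset_leq_card/fsubsetP.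
suff : (minsupp (f q0) <= minsupp (f q1))%N by lia.
have q01 := q0min _ (sF _ q1F); case: (ltngtP q0 q1) q01 => // [q01 _|-> //].
have [_ bl _ _] := sp; have [H1 H2 H3 H4] := block_interleave bl.
have q0d := Fd _ q0F; have q1d := Fd _ (sF _ q1F).
have [_ n1] := H1 _ q0d; have [_ n2] := H2 _ q0d.
have := min_le_maxsupp n1; have := min_le_maxsupp n2.
by have := H3 _ q0d; have := H4 q0 q1 ltac:(lia) ltac:(lia); lia.
Qed.

Lemma special_mono G G' d f g w : G `<=` G' ->
  special L1 sigma G d f g w -> special L1 sigma G' d f g w.
Proof.
move=> GG' [H1 H2 H3 H4]; split => // q qd; have [Gf Gg Tf Tg] := H1 q qd.
have TW n h : typeIa G n h -> typeIa G' n h.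
  move=> [h' [sg [a [b [[n0 [d' [al [sz [d0 adm vfg avs ->]]]]] ->]]]]].
  exists (2 ^- n *: \sum_(1 <= q < d'.+1) al q), sg, a, b; split => //.
  split=> //; exists d', al, sz; split=> // j jd.
  have [Gj [dj [fj [? ? ? ?]]]] := avs j jd; split; first exact: GG'.
  by exists dj, fj; split => // i id; apply/GG'; auto.
by split; auto.
Qed.

Lemma special_on_mono G G' d f g w F : G `<=` G' ->
  special_on L1 sigma G d f g w F -> special_on L1 sigma G' d f g w F.
Proof. by move=> GG' [sp ? ?]; split => //; exact: special_mono sp. Qed.

End SpecialSequences.

Section Monotonicity.
Variables (R : realType) (s : nat -> R -> R) (L1 : set nat) (sigma : seq {poly R} -> nat).
Implicit Types (G : set {poly R}) (h : {poly R}).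

Lemma schreier_sum_mono (avg avg' : nat -> {poly R} -> Prop) n h :
  (forall k a, avg k a -> avg' k a) -> schreier_sum avg n h -> schreier_sum avg' n h.
Proof.
move=> H [n0 [d [a [sz [d0 adm vfg Ha hE]]]]]; split=> //.
by exists d, a, sz; split => // q qd; apply/H/Ha.
Qed.

Lemma alpha_average_mono G G' n h : G `<=` G' -> alpha_average G n h -> alpha_average G' n h.
Proof.
move=> GG' [Gh [d [f [? ? H ?]]]]; split; first exact: GG'.
by exists d, f; split=> // j jd; apply/GG'/H.
Qed.

Lemma typeIa_mono G G' n h : G `<=` G' -> typeIa G n h -> typeIa G' n h.
Proof.
move=> GG' [h' [sg [a [b [Hh' E]]]]]; exists h', sg, a, b; split=> //.
by apply: schreier_sum_mono Hh' => k al; exact: alpha_average_mono.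
Qed.

Lemma typeII_mono G G' S h : G `<=` G' ->
  typeII s L1 sigma G S h -> typeII s L1 sigma G' S h.
Proof.
move=> GG' [[d [f [g [w [F [sg [a [b [so ? ?]]]]]]]]]|[d [f [g [w [F [lam [sg [a [b [so ? ? ?]]]]]]]]]]].
  by left; exists d, f, g, w, F, sg, a, b; split=> //; exact: special_on_mono so.
by right; exists d, f, g, w, F, lam, sg, a, b; split=> //; exact: special_on_mono so.
Qed.

Lemma beta_average_mono G G' n h : G `<=` G' ->
  beta_average s L1 sigma G n h -> beta_average s L1 sigma G' n h.
Proof.
move=> GG' [Gh [d [f [S [? H ? ?]]]]]; split; first exact: GG'.
exists d, f, S; split=> // j jd; have [? ?] := H j jd; split; first exact: GG'.
exact: typeII_mono GG' _.
Qed.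

Notation W := (W s L1 sigma).

Lemma W_closed : norming_closed s L1 sigma W.
Proof.
have sub G : norming_closed s L1 sigma G /\
    [set h | exists2 n, (0 < n)%N & h = 'X^n \/ h = - 'X^n] `<=` G -> W `<=` G.
  by move=> HG h; apply.
split.
- by move=> h Wh G HG; apply: (norming_opp HG.1); exact: sub HG _ Wh.
- by move=> a b h Wh G HG; apply: (norming_restr HG.1); exact: sub HG _ Wh.
- move=> n h r Wh r0 r1 G HG; apply: (norming_convex HG.1) => // i.
  exact: sub HG _ (Wh i).
- move=> n h Hh G HG; apply: (norming_Ia HG.1); apply: schreier_sum_mono Hh => k a.
  by apply: alpha_average_mono; exact: sub.
- move=> n h Hh G HG; apply: (norming_Ib HG.1); apply: schreier_sum_mono Hh => k a.
  by apply: beta_average_mono; exact: sub.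
- move=> d f g w F so G HG; apply: (norming_IIplus HG.1).
  by apply: special_on_mono so; exact: sub.
- move=> d f g w F lam so lo G HG; apply: (norming_IIminus HG.1) lo.
  by apply: special_on_mono so; exact: sub.
Qed.

Lemma W_Xn n : (0 < n)%N -> W 'X^n.
Proof. by move=> n0 G [_ HG]; apply: HG; exists n => //; left. Qed.

(** Induction over [W]: the functionals a new one is built from satisfy [P]
    and also belong to [W]. *)
Lemma W_ind (P : set {poly R}) :
  (forall n, (0 < n)%N -> P 'X^n) ->
  (forall h, W h -> P h -> P (- h)) ->
  (forall a b h, W h -> P h -> P (restr a b h)) ->
  (forall n (h : 'I_n -> {poly R}) (r : 'I_n -> rat),
     (forall i, W (h i)) -> (forall i, P (h i)) -> (forall i, 0 <= r i) ->
     \sum_i r i = 1 -> P (\sum_i ratr (r i) *: h i)) ->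
  (forall n h, W h -> schreier_sum (alpha_average (W `&` P)) n h -> P h) ->
  (forall n h, W h -> schreier_sum (beta_average s L1 sigma (W `&` P)) n h -> P h) ->
  (forall d f g w F, special_on L1 sigma (W `&` P) d f g w F ->
     W (sum_plus f g F) -> P (sum_plus f g F)) ->
  (forall d f g w F lam, special_on L1 sigma (W `&` P) d f g w F -> lam_ok s lam F ->
     W (sum_minus f g lam F) -> P (sum_minus f g lam F)) ->
  W `<=` P.
Proof.
move=> HX HN Hr Hc Ha Hb Hp Hm h Wh.
suff /(_ h Wh)[] : W `<=` W `&` P by [].
have sW : W `&` P `<=` W by move=> ? [].
have WC := W_closed.
move=> {h Wh} h; apply; split; last first.
  move=> _ [n n0 [->|->]]; first by split; [exact: W_Xn|exact: HX].
  have WX := W_Xn n0; split; [exact: norming_opp WC _ WX|apply: HN => //; exact: HX].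
split.
- by move=> f [Wf Pf]; split; [exact: norming_opp WC _ Wf|exact: HN].
- by move=> a b f [Wf Pf]; split; [exact: norming_restr WC _ _ _ Wf|exact: Hr].
- move=> n f r WPf r0 r1.
  split; first by apply: (norming_convex WC) => // i; exact: (WPf i).1.
  by apply: Hc => // i; [exact: (WPf i).1|exact: (WPf i).2].
- move=> n f Hf; have Wf : W f.
    apply: (norming_Ia WC (n := n)); apply: schreier_sum_mono Hf => k a.
    exact: alpha_average_mono.
  by split => //; apply: Ha Hf.
- move=> n f Hf; have Wf : W f.
    apply: (norming_Ib WC (n := n)); apply: schreier_sum_mono Hf => k a.
    exact: beta_average_mono.
  by split => //; apply: Hb Hf.
- move=> d f g w F so; have Wf := norming_IIplus WC (special_on_mono sW so).
  by split => //; apply: Hp so Wf.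
- move=> d f g w F lam so lo; have Wf := norming_IIminus WC (special_on_mono sW so) lo.
  by split => //; apply: Hm so lo Wf.
Qed.

Lemma schreier_sum_alpha_W n h : schreier_sum (alpha_average W) n h -> W h.
Proof. exact: norming_Ia W_closed _ _. Qed.

Lemma schreier_sum_beta_W n h : schreier_sum (beta_average s L1 sigma W) n h -> W h.
Proof. exact: norming_Ib W_closed _ _. Qed.

End Monotonicity.

Section NormingFacts.
Variables (R : realType) (s : nat -> R -> R) (L1 L2 L3 : set nat).
Variable sigma : seq {poly R} -> nat.
Hypothesis hs : dense_in_sphere s.
Implicit Types (f g : nat -> {poly R}) (G : set {poly R}) (h x : {poly R}).
Implicit Types (F : {fset nat}).

Notation W := (W s L1 sigma).

Lemma interleave_at_most_one f g d q q' i : block (interleave f g d) ->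
  (0 < q <= d)%N -> (0 < q' <= d)%N ->
  ((f q)`_i != 0) || ((g q)`_i != 0) -> ((f q')`_i != 0) || ((g q')`_i != 0) -> q = q'.
Proof.
move=> /block_interleave[H1 H2 H3 H4].
wlog qq' : q q' / (q <= q')%N.
  move=> H qd q'd a b; case: (leqP q q') => [|/ltnW] qq'; first exact: H.
  by apply/esym; exact: H.
move=> qd q'd; move: qq'; rewrite leq_eqVlt => /orP[/eqP //|qq'].
have [_ n1] := H1 _ qd; have [_ n2] := H2 _ qd; have [_ n3] := H1 _ q'd.
have := min_le_maxsupp n1; have := min_le_maxsupp n2; have := min_le_maxsupp n3.
have := H3 _ qd; have := H3 _ q'd; have := H4 q q' ltac:(lia) ltac:(lia).
by move=> ? ? ? ? ? ? /orP[/nz_supp|/nz_supp] ? /orP[/nz_supp|/nz_supp] ?; lia.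
Qed.

Lemma pair_coef f g d F (e e' : nat -> R) M i : block (interleave f g d) ->
  (forall q, q \in F -> (0 < q <= d)%N) -> 0 <= M ->
  (forall q, q \in F -> `|(f q)`_i| <= 1 /\ `|(g q)`_i| <= 1) ->
  (forall q, q \in F -> `|e q| <= M /\ `|e' q| <= M) ->
  `|(\sum_(q <- F) (e q *: f q + e' q *: g q))`_i| <= M.
Proof.
move=> bl Fd M0 c1 eM; rewrite coef_sum; apply: sum_at_most_one => //.
  move=> q qF _; rewrite coefD !coefZ; have [f1 g1] := c1 _ qF; have [e1 e2] := eM _ qF.
  have [H1 H2 H3 _] := block_interleave bl.
  have [fi0|fi0] := eqVneq (f q)`_i 0.
    rewrite fi0 mulr0 add0r normrM; apply: le_trans (ler_pM _ _ e2 g1) _ => //.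
    by rewrite mulr1.
  have -> : (g q)`_i = 0.
    apply/eqP/negPn/negP => /nz_supp; move/nz_supp: fi0; have := H3 _ (Fd _ qF); lia.
  rewrite mulr0 addr0 normrM; apply: le_trans (ler_pM _ _ e1 f1) _ => //.
  by rewrite mulr1.
have nz q : (e q *: f q + e' q *: g q)`_i != 0 -> ((f q)`_i != 0) || ((g q)`_i != 0).
  rewrite coefD !coefZ; apply: contraNT; rewrite negb_or !negbK => /andP[/eqP -> /eqP ->].
  by rewrite !mulr0 addr0.
move=> q q' qF q'F _ _ /nz Hq /nz Hq'.
exact: interleave_at_most_one bl (Fd _ qF) (Fd _ q'F) Hq Hq'.
Qed.

Lemma sum_plusE f g F :
  sum_plus f g F = \sum_(q <- F) (2^-1 *: f q + 2^-1 *: g q) :> {poly R}.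
Proof. by rewrite /sum_plus scaler_sumr; apply: eq_bigr => q _; rewrite scalerDr. Qed.

Lemma sum_minusE f g lam F : sum_minus f g lam F =
  \sum_(q <- F) ((ratr (lam q) / 2) *: f q + (- (ratr (lam q) / 2)) *: g q) :> {poly R}.
Proof.
rewrite /sum_minus scaler_sumr; apply: eq_bigr => q _.
by rewrite !scalerBr !scalerA scaleNr mulrC.
Qed.

Lemma act_lam (lam : nat -> rat) F (a : {poly R}) :
  act (\sum_(q <- F) ratr (lam q) *: 'X^q) a = \sum_(q <- F) ratr (lam q) * a`_q.
Proof. by rewrite act_suml; apply: eq_bigr => q _; rewrite actZl act_Xn. Qed.

(* Test the dual norm on a unit vector. *)
Lemma lam_ok_le1 lam F q : lam_ok s lam F -> q \in F -> (0 < q)%N -> `|ratr (lam q) : R| <= 1.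
Proof.
move=> lo qF q0; apply: le_trans (norm_u_Xn hs q0).
have c0 : c00 ('X^q : {poly R}).
  by rewrite /c00 /= coefXn; case: q q0 {qF}.
have := dual_norm_act hs lo c0; rewrite act_lam (bigD1_seq q) //= coefXn eqxx mulr1.
rewrite big1 ?addr0 // => i /negPf; rewrite coefXn => ->; exact: mulr0.
Qed.

Lemma lam_half lam F q : lam_ok s lam F -> q \in F -> (0 < q)%N ->
  `|ratr (lam q) / 2 : R| <= 2^-1 /\ `|- (ratr (lam q) / 2) : R| <= 2^-1.
Proof.
move=> lo qF q0; rewrite normrN normrM; have := lam_ok_le1 lo qF q0.
by rewrite (ger0_norm (_ : 0 <= 2^-1)) // => H; split; lra.
Qed.

Lemma act_pair_le (e e' M : R) (h h' z : {poly R}) : `|e| <= 2^-1 -> `|e'| <= 2^-1 ->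
  `|act h z| <= M -> `|act h' z| <= M -> `|act (e *: h + e' *: h') z| <= M.
Proof.
move=> e1 e2 hM h'M; rewrite actDl !actZl.
apply: le_trans (ler_normD _ _) _; rewrite !normrM.
apply: (@le_trans _ _ (2^-1 * M + 2^-1 * M)); last lra.
by apply: lerD; apply: ler_pM.
Qed.

Definition rational (r : R) := exists q : rat, r = ratr q.

Lemma rationalD r r' : rational r -> rational r' -> rational (r + r').
Proof. by move=> [q ->] [q' ->]; exists (q + q'); rewrite rmorphD. Qed.

Lemma rationalM r r' : rational r -> rational r' -> rational (r * r').
Proof. by move=> [q ->] [q' ->]; exists (q * q'); rewrite rmorphM. Qed.

Lemma rationalN r : rational r -> rational (- r).
Proof. by move=> [q ->]; exists (- q); rewrite rmorphN. Qed.

Lemma rational_inv_nat n : rational (n%:R^-1).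
Proof. by exists (n%:R^-1); rewrite fmorphV rmorph_nat. Qed.

Lemma rational0 : rational 0. Proof. by exists 0; rewrite rmorph0. Qed.

Lemma rational_pow2 n : rational (2 ^- n).
Proof. by rewrite -natrX; exact: rational_inv_nat. Qed.

Lemma rational_sum (I : eqType) (r : seq I) (F : I -> R) :
  (forall i, i \in r -> rational (F i)) -> rational (\sum_(i <- r) F i).
Proof.
move=> H; rewrite big_seq; apply: big_ind => [||i]; [exact: rational0| |exact: H].
exact: rationalD.
Qed.

Let good h := [/\ c00 h, forall i, rational h`_i & forall i, `|h`_i| <= 1].

Lemma schreier_sum_coef (avg : nat -> {poly R} -> Prop) n h i :
  (forall k a, avg k a -> forall i, `|a`_i| <= 1) -> schreier_sum avg n h ->
  `|h`_i| <= 2 ^- n.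
Proof.
move=> H [n0 [d [a [sz [d0 [bl _] _ Ha ->]]]]].
rewrite coefZ normrM ger0_norm ?invr_ge0 ?exprn_ge0 // ler_piMr ?invr_ge0 ?exprn_ge0 //.
by apply: block_sum_coef => // q qd; exact: (H _ _ (Ha q qd)).
Qed.

Let good_schreier_sum (avg : nat -> {poly R} -> Prop) n h :
  (forall k a, avg k a -> good a) -> schreier_sum avg n h -> good h.
Proof.
move=> H Hh; split; last first.
- move=> i; apply: le_trans (schreier_sum_coef i _ Hh) _.
    by move=> k a /H[].
  by rewrite invf_le1 ?exprn_gt0 // exprn_ege1 // ler1n.
- move=> i; have [n0 [d [a [sz [d0 _ _ Ha ->]]]]] := Hh.
  rewrite coefZ; apply: rationalM; first exact: rational_pow2.
  rewrite coef_sum; apply: rational_sum => q; rewrite mem_index_iota => qd.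
  by have [] := H _ _ (Ha q ltac:(lia)).
have [n0 [d [a [sz [d0 _ _ Ha ->]]]]] := Hh; rewrite /c00 /= coefZ coef_sum.
rewrite big_nat big1 ?mulr0 // => q qd.
by have [] := H _ _ (Ha q ltac:(lia)).
Qed.

Let good_pair_sum f g w d F (e e' : nat -> R) : special_on L1 sigma good d f g w F ->
  (forall q, q \in F -> `|e q| <= 2^-1 /\ `|e' q| <= 2^-1) ->
  (forall q, q \in F -> rational (e q) /\ rational (e' q)) ->
  good (\sum_(q <- F) (e q *: f q + e' q *: g q)).
Proof.
move=> [[sp1 bl _ _] Fd _] eM er; split.
- rewrite /c00 /= coef_sum big_seq big1 // => q qF.
  have [[f0 _ _] [g0 _ _] _ _] := sp1 _ (Fd _ qF).
  by rewrite coefD !coefZ [(f q)`_0]f0 [(g q)`_0]g0 !mulr0 addr0.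
- move=> i; rewrite coef_sum; apply: rational_sum => q qF.
  have [[_ f0 _] [_ g0 _] _ _] := sp1 _ (Fd _ qF).
  rewrite coefD !coefZ; have [? ?] := er _ qF.
  by apply: rationalD; apply: rationalM.
- move=> i; apply: (@le_trans _ _ 2^-1); last by rewrite invf_le1 // ler1n.
  apply: (pair_coef bl Fd _ _ eM) => // q qF.
  by have [[_ _ f0] [_ _ g0] _ _] := sp1 _ (Fd _ qF).
Qed.

(** Rationality puts special sequences into the domain of the coding; the bound on
    the coordinates makes the supremum that defines [normX] finite. *)
Lemma W_facts h : W h -> good h.
Proof.
move: h; apply: W_ind.
- move=> n n0; split=> [|i|i]; rewrite ?/c00 /= coefXn.
  + by case: n n0.
  + by exists (i == n)%:R; rewrite rmorph_nat.
  + by case: (i == n); rewrite ?normr1 ?normr0.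
- move=> h _ [h1 h2 h3]; split=> [|i|i]; rewrite ?/c00 /= coefN ?normrN //.
    by rewrite [h`_0]h1 oppr0.
  exact: rationalN.
- move=> a b h _ [h1 h2 h3]; split=> [|i|i]; rewrite ?/c00 /= coef_restr.
  + by rewrite [h`_0]h1 if_same.
  + by case: ifP => // _; exact: rational0.
  + by case: ifP => // _; rewrite normr0.
- move=> n h r _ Hh r0 r1; split=> [|i|i]; rewrite ?/c00 /= coef_sum.
  + by apply: big1 => i _; rewrite coefZ; have [-> _ _] := Hh i; rewrite mulr0.
  + apply: rational_sum => j _; rewrite coefZ; apply: rationalM; first by exists (r j).
    by have [_ + _] := Hh j; apply.
  + apply: le_trans (ler_norm_sum _ _ _) _.
    apply: (@le_trans _ _ (\sum_j ratr (r j))); last by rewrite -rmorph_sum /= r1 rmorph1.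
    apply: ler_sum => j _; rewrite coefZ normrM ger0_norm ?ler0q //.
    by have [_ _ H] := Hh j; rewrite ler_piMr // ler0q.
- move=> n h _; apply: good_schreier_sum => k a [[]] //.
- move=> n h _; apply: good_schreier_sum => k a [[]] //.
- move=> d f g w F so _; rewrite sum_plusE.
  apply: (good_pair_sum (special_on_mono _ so)); first by move=> ? [].
    by move=> q _; rewrite ger0_norm ?invr_ge0.
  by move=> q _; split; exact: (rational_inv_nat 2).
- move=> d f g w F lam so lo _; rewrite sum_minusE.
  have rl q : rational (ratr (lam q) / 2).
    by apply: rationalM; [exists (lam q)|exact: (rational_inv_nat 2)].
  apply: (good_pair_sum (special_on_mono _ so)); first by move=> ? [].
    by move=> q qF; have [_ Fd _] := so; apply: (lam_half lo qF); have := Fd _ qF; lia.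
  by move=> q _; split => //; exact: rationalN.
Qed.
Lemma W_coef h i : W h -> `|h`_i| <= 1. Proof. by case/W_facts. Qed.

Let act_le_sum h x : W h -> `|act h x| <= \sum_(i < size x) `|x`_i|.
Proof.
move=> Wh; rewrite actC; apply: le_trans (ler_norm_sum _ _ _) _.
by apply: ler_sum => i _; rewrite normrM ler_piMr // W_coef.
Qed.

Lemma act_le_normX h x : W h -> `|act h x| <= normX s L1 sigma x.
Proof.
have pos h' : W h' -> act h' x <= normX s L1 sigma x.
  move=> Wh; apply: ub_le_sup; last by exists h'.
  exists (\sum_(i < size x) `|x`_i|) => _ [h'' Wh'' <-].
  exact: le_trans (ler_norm _) (act_le_sum _ Wh'').
move=> Wh; rewrite ler_norml lerNl -actNl !pos //.
exact: (norming_opp (W_closed s L1 sigma)) Wh.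
Qed.

Lemma normX_le x M : (forall h, W h -> act h x <= M) -> normX s L1 sigma x <= M.
Proof.
move=> H; apply: ge_sup => [|_ [h Wh <-]]; last exact: H.
by exists (act 'X^1 x); exists 'X^1 => //; exact: W_Xn.
Qed.

Lemma typeIa_restr G n h a b : typeIa G n h -> typeIa G n (restr a b h).
Proof.
move=> [h' [sg [a' [b' [Hh ->]]]]]; exists h', sg, (maxn a a'), (minn b b'); split=> //.
by rewrite restrZ restr_restr.
Qed.

Lemma typeIa_coef n h i : typeIa W n h -> `|h`_i| <= 2 ^- n.
Proof.
move=> [h' [sg [a [b [Hh' ->]]]]]; rewrite coefZ normrMsign coef_restr.
case: ifP => _; last by rewrite normr0 invr_ge0 exprn_ge0.
by apply: schreier_sum_coef Hh' => k al [] /W_coef H _ j; exact: H.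
Qed.

(** A piece of type II with the pairs that its interval misses left out, so that
    [S] contains the weights of all remaining pairs; the signs, the factor 1/2
    and the coefficients [lambda] are absorbed in [e] and [e']. *)
Definition pair_sum G (S : set nat) h := exists d f g w F (e e' : nat -> R) a b,
  [/\ special_on L1 sigma G d f g w F,
      forall q, q \in F -> `|e q| <= 2^-1 /\ `|e' q| <= 2^-1,
      h = restr a b (\sum_(q <- F) (e q *: f q + e' q *: g q))
    & forall q, q \in F -> S (w q)].

Lemma pair_sum_trim G S d f g w F (e e' : nat -> R) a b :
  special_on L1 sigma G d f g w F ->
  (forall q, q \in F -> `|e q| <= 2^-1 /\ `|e' q| <= 2^-1) ->
  (forall q, q \in F -> S (w q) \/ (restr a b (f q) = 0 /\ restr a b (g q) = 0)) ->
  let h := restr a b (\sum_(q <- F) (e q *: f q + e' q *: g q)) in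
  h = 0 \/ pair_sum G S h.
Proof.
move=> so eM HS h; pose F' := [fset q in F | `[< S (w q) >]]%fset.
have F'P q : q \in F' = (q \in F) && `[< S (w q) >] by rewrite !inE.
have hE : h = restr a b (\sum_(q <- F') (e q *: f q + e' q *: g q)).
  rewrite /h !restr_sum big_fset /= [RHS]big_mkcond big_seq [RHS]big_seq /=.
  apply: eq_bigr => q qF; case: asboolP => // nS.
  by have [//|[f0 g0]] := HS _ qF; rewrite restrD !restrZ f0 g0 !scaler0 addr0.
have [F'0|F'0] := eqVneq F' fset0.
  by left; rewrite hE F'0 big_seq_fset0 restr0.
right; exists d, f, g, w, F', e, e', a, b; split => //.
- by apply: special_onS so F'0 _ => q; rewrite F'P => /andP[].
- by move=> q; rewrite F'P => /andP[/eM].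
- by move=> q; rewrite F'P => /andP[_ /asboolP].
Qed.

(* The supports of [f q] and [g q] are disjoint, so that nothing cancels. *)
Let missed d f g q a b c : block (interleave f g d) -> (0 < q <= d)%N -> c != 0 ->
  ~ meets_ran a b (f q + c *: g q) -> restr a b (f q) = 0 /\ restr a b (g q) = 0.
Proof.
move=> bl qd c0 nm; have [H1 H2 H3 _] := block_interleave bl.
have dis i : (f q)`_i = 0 \/ (g q)`_i = 0.
  have [->|/nz_supp fi] := eqVneq (f q)`_i 0; first by left.
  right; apply/eqP/negPn/negP => /nz_supp; have := H3 _ qd; lia.
split; apply/polyP => i; rewrite coef_restr coef0; case: ifP => // ab;
  apply/eqP/negPn/negP => ni; apply: nm; exists i; split => //; apply: nz_supp;
  rewrite coefD coefZ; case: (dis i) => E.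
- by rewrite E eqxx in ni.
- by rewrite E mulr0 addr0.
- by rewrite E add0r mulf_neq0.
- by rewrite E eqxx in ni.
Qed.

Lemma typeII_pair_sum G S h : typeII s L1 sigma G S h -> h = 0 \/ pair_sum G S h.
Proof.
have scale_sign (sg : bool) F (e e' : nat -> R) f g a b :
    (-1) ^+ sg *: restr a b (\sum_(q <- F) (e q *: f q + e' q *: g q)) =
    restr a b (\sum_(q <- F) (((-1) ^+ sg * e q) *: f q + ((-1) ^+ sg * e' q) *: g q))
    :> {poly R}.
  by rewrite -restrZ scaler_sumr; congr restr; apply: eq_bigr => q _; rewrite scalerDr !scalerA.
case=> [[d [f [g [w [F [sg [a [b [so -> SE]]]]]]]]]|
        [d [f [g [w [F [lam [sg [a [b [so lo -> SE]]]]]]]]]]];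
  have [[_ bl _ _] Fd _] := so.
- rewrite sum_plusE scale_sign; apply: (pair_sum_trim so) => q qF.
    by rewrite normrMsign ger0_norm ?invr_ge0.
  have [m|nm] := pselect (meets_ran a b (f q + g q)).
    by left; rewrite SE; exists q.
  by right; apply: (missed bl (Fd _ qF) (oner_neq0 _)); rewrite scale1r.
- rewrite sum_minusE scale_sign; apply: (pair_sum_trim so) => q qF.
    by rewrite !normrMsign; apply: (lam_half lo qF); have := Fd _ qF; lia.
  have [m|nm] := pselect (meets_ran a b (f q - g q)).
    by left; rewrite SE; exists q.
  right; apply: (@missed _ _ _ _ _ _ (-1) bl (Fd _ qF)); first by rewrite oppr_eq0 oner_neq0.
  by rewrite scaleN1r.
Qed.

Definition minsupps d (a : nat -> {poly R}) : {fset nat} :=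
  [fset k | k in [seq minsupp y | y <- fam a d]]%fset.

Lemma minsuppsP d a t :
  reflect (exists2 q, (0 < q <= d)%N & t = minsupp (a q)) (t \in minsupps d a).
Proof.
rewrite /minsupps in_fset /= -map_comp; apply: (iffP mapP) => [[q]|[q qd ->]].
  by rewrite mem_iota => qd ->; exists q => //; lia.
by exists q => //; rewrite mem_iota; lia.
Qed.

End NormingFacts.

Section AverageFamilies.
Variable R : realType.
Implicit Types (avg : nat -> {poly R} -> Prop) (a : nat -> {poly R}).

Definition average_sum n d a : {poly R} := 2 ^- n *: \sum_(1 <= j < d.+1) a j.

(** The witnesses in [schreier_sum avg n (average_sum n d a)]. *)
Definition average_family avg n d a (sz : nat -> nat) : Prop :=
  [/\ (0 < n)%N, block (fam a d), schreier n (minsupps d a), very_fast_growing d a sz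
    & forall j, (0 < j <= d)%N -> avg (sz j) (a j)].

Lemma schreier_sumP avg n h : schreier_sum avg n h <->
  exists d a sz, average_family avg n d a sz /\ h = average_sum n d a.
Proof.
split=> [[n0 [d [a [sz [_ [bl ST] vfg Ha ->]]]]]|[d [a [sz [[n0 bl ST vfg Ha] ->]]]]].
  by exists d, a, sz.
split=> //; exists d, a, sz; split=> //.
by have [t /minsuppsP[q qd _]] := schreier_nonempty ST; lia.
Qed.

Lemma average_family_sum avg n d a sz : average_family avg n d a sz ->
  schreier_sum avg n (average_sum n d a).
Proof. by move=> AF; apply/schreier_sumP; exists d, a, sz. Qed.

Lemma average_family_mono avg avg' n d a sz : (forall k b, avg k b -> avg' k b) ->
  average_family avg n d a sz -> average_family avg' n d a sz.
Proof. by move=> H [n0 bl ST vfg Ha]; split=> // j /Ha/H. Qed.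

Lemma average_family_slice avg n n' d d' a sz e : average_family avg n d a sz ->
  (0 < n')%N -> (e + d' <= d)%N -> schreier n' (minsupps d' (fun j => a (e + j)%N)) ->
  average_family avg n' d' (fun j => a (e + j)%N) (fun j => sz (e + j)%N).
Proof.
move=> [n0 /blockP[bl1 bl2] ST [_ vfg] Ha] n'0 ed Hs.
have bl' : block (fam (fun j => a (e + j)%N) d').
  by apply/blockP; split => [q qd|q q' q0 qd]; [apply: bl1|apply: bl2]; lia.
split=> //; last by move=> q qd; apply: Ha; lia.
split=> // j jd; have := vfg (e + j)%N ltac:(lia).
by rewrite -(_ : e + j.-1 = (e + j).-1)%N //; lia.
Qed.

End AverageFamilies.

(** * The coding *)

Section Coding.
Variables (R : realType) (s : nat -> R -> R) (L1 L2 L3 : set nat).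
Variable sigma : seq {poly R} -> nat.
Hypotheses (hs : dense_in_sphere s) (hL : coding_sets R L1 L2 L3).
Hypothesis hsigma : coding_function L2 sigma.
Implicit Types (f g : nat -> {poly R}).

Notation W := (W s L1 sigma).
Notation L0 := (L1 `|` L2 `|` L3).

Lemma coding_ge10 v : L0 v -> (10 <= v)%N.
Proof.
have [l [l1 lS _ -> _]] := hL; move=> [k /= k0 <-].
elim: k k0 => // -[|k] IH _ //; apply: leq_trans (IH isT) _.
apply: ltnW; apply: leq_ltn_trans (lS k.+1 isT).
by apply: leq_trans (ltnW (ltn_expl _ (ltnSn 1))) _; rewrite leq_exp2l //; lia.
Qed.

Lemma coding_gap u v : L0 u -> L0 v -> (u < v)%N -> (2 ^ (2 * u) < v)%N.
Proof.
have [l [l1 lS _ -> _]] := hL; move=> [i /= i0 <-] [j /= j0 <-].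
have mono k d : (0 < k)%N -> (l k <= l (k + d))%N.
  move=> k0; elim: d => [|d IH]; first by rewrite addn0.
  apply: leq_trans IH _; rewrite addnS.
  apply: leq_trans (ltnW (lS (k + d)%N ltac:(lia))).
  by apply: leq_trans (ltnW (ltn_expl _ (ltnSn 1))) _; rewrite leq_exp2l //; lia.
have [ij|ji] := ltnP i j => lij.
  by apply: leq_trans (lS i i0) _; have := mono i.+1 (j - i.+1)%N isT; rewrite subnKC.
by have := mono j (i - j)%N j0; rewrite subnKC //; lia.
Qed.

Lemma interleave_prefix f g d q : (q <= d)%N -> block (interleave f g d) ->
  block (interleave f g q).
Proof.
move=> qd; rewrite !interleave_fam => /blockP[H1 H2]; apply/blockP.
by split=> [i id|i j i0 ij]; [apply: H1|apply: H2]; lia.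
Qed.

Variables (d : nat) (f g : nat -> {poly R}) (w : nat -> nat).
Hypothesis sp : special L1 sigma W d f g w.

Lemma special_Qseq q : (0 < q <= d)%N -> Qseq (interleave f g q).
Proof.
move=> qd; have [H1 bl _ _] := sp; split.
- apply/eqP => /(congr1 size); rewrite interleave_fam size_map size_iota /=; lia.
- by apply: interleave_prefix bl; lia.
- move=> x /mem_interleave[j jq xE] i; have [Wf Wg _ _] := H1 j ltac:(lia).
  have [Wx|Wx] : W x \/ W x by case: xE => ->; [left|right].
  + by have [_ + _] := W_facts hs Wx; apply.
  + by have [_ + _] := W_facts hs Wx; apply.
Qed.

Lemma special_weight q : (0 < q <= d)%N ->
  (q = 1%N /\ L1 (w q)) \/ ((1 < q)%N /\ L2 (w q)).
Proof.
move=> qd; have [H1 bl Hw1 Hw] := sp.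
have [q1|q1] := ltnP 1 q; last by left; have -> : q = 1%N by [lia|]; split=> //; apply: Hw1; lia.
right; split=> //; rewrite -Hw; last lia.
by have [H _ _] := hsigma; apply/H/special_Qseq; lia.
Qed.

Lemma special_L0 q : (0 < q <= d)%N -> L0 (w q).
Proof. by move=> /special_weight[] [_ H]; left; [left|right]. Qed.

Lemma special_ge10 q : (0 < q <= d)%N -> (10 <= w q)%N.
Proof. by move=> /special_L0; exact: coding_ge10. Qed.

(* The factor [2 `^ (1 / norm0)] in the growth condition is at least 1. *)
Lemma special_growth q : (0 < q < d)%N -> (maxsupp (g q) < w q.+1)%N.
Proof.
move=> qd; have [H1 bl _ Hw] := sp; have [_ _ H] := hsigma.
have := H _ (@special_Qseq q ltac:(lia)); rewrite last_interleave; last lia.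
rewrite (Hw q.+1) /=; last lia.
rewrite -(ltr_nat R); apply: le_lt_trans; rewrite ler_peMl ?ler0n //.
apply: (@le_trans _ _ ((2 : R) `^ 0)); first by rewrite powRr0.
apply: ler_powR; rewrite ?ler1n // invr_ge0.
rewrite /norm0; elim/big_ind : _ => // x y x0 y0.
by rewrite le_max x0.
Qed.

End Coding.

Section CodingTree.
Variables (R : realType) (s : nat -> R -> R) (L1 L2 L3 : set nat).
Variable sigma : seq {poly R} -> nat.
Hypotheses (hs : dense_in_sphere s) (hL : coding_sets R L1 L2 L3).
Hypothesis hsigma : coding_function L2 sigma.
Notation W := (W s L1 sigma).

(** By injectivity of the coding; the first weights are in [L1] and cannot agree
    with the later ones, which are in [L2]. *)
Lemma special_coding d f g w d' f' g' w' q q' :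
  special L1 sigma W d f g w -> special L1 sigma W d' f' g' w' ->
  (0 < q <= d)%N -> (0 < q' <= d')%N -> w q = w' q' ->
  q = q' /\ forall j, (0 < j < q)%N -> f j = f' j /\ g j = g' j.
Proof.
move=> sp sp' qd q'd E.
have L12 v : L1 v -> L2 v -> False.
  have [l [_ _ _ _ [L12 _ _ _]]] := hL => v1 v2.
  by have : (L1 `&` L2) v by []; rewrite L12.
have [[q1 Lq]|[q1 Lq]] := special_weight hs hsigma sp qd;
  have [[q'1 Lq']|[q'1 Lq']] := special_weight hs hsigma sp' q'd.
- by rewrite q1 q'1; split=> // j; lia.
- by case: (L12 (w q)) => //; rewrite E.
- by case: (L12 (w q)) => //; rewrite E.
- have [_ _ _ Hw] := sp; have [_ _ _ Hw'] := sp'.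
  have [_ inj _] := hsigma.
  have Q1 : Qseq (interleave f g q.-1) by apply: (special_Qseq hs sp); lia.
  have Q2 : Qseq (interleave f' g' q'.-1) by apply: (special_Qseq hs sp'); lia.
  have /(inj _ _ Q1 Q2)/interleave_inj[qq H] :
      sigma (interleave f g q.-1) = sigma (interleave f' g' q'.-1).
    by rewrite Hw ?Hw' //; lia.
  split; first lia.
  by move=> j jq; apply: H; lia.
Qed.

Lemma special_weight_inj d f g w q q' : special L1 sigma W d f g w ->
  (0 < q <= d)%N -> (0 < q' <= d)%N -> w q = w q' -> q = q'.
Proof. by move=> sp qd q'd E; have [] := special_coding sp sp qd q'd E. Qed.

End CodingTree.

(** * Negligible sets of indices of an exact vector *)

Section ExactData.
Variables (R : realType) (s : nat -> R -> R) (L1 : set nat).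
Variable sigma : seq {poly R} -> nat.
Notation W := (W s L1 sigma).

Definition minima m (x : nat -> {poly R}) (P : pred nat) : {fset nat} :=
  [fset t in [seq minsupp (x k) | k <- iota 1 m & P k]]%fset.

(** The data hidden in an exact vector [2 ^+ w *: \sum_k c k *: x k]; here [nk]
    has one entry more than the rapidly increasing sequence itself, so that
    [nk k.+1] makes sense for its last vector. *)
Record exact_data (C eps : R) (w m : nat) (x : nat -> {poly R}) (c : nat -> R)
    (nk : nat -> nat) : Prop := ExactData {
  ed_C : 1 <= C;
  ed_w : (10 <= w)%N;
  ed_eps : 0 < eps < (36 * C * 2 ^+ (3 * w))^-1;
  ed_block : block (fam x m);
  ed_m : (0 < m)%N;
  ed_c : forall k, (0 < k <= m)%N -> 0 <= c k;
  ed_sum : \sum_(1 <= k < m.+1) c k = 1;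
  ed_mass : forall P : pred nat, schreier w.-1 (minima m x P) ->
    \sum_(1 <= k < m.+1 | P k) c k < eps;
  ed_norm : forall k h, (0 < k <= m)%N -> W h -> `|act h (x k)| <= C;
  ed_ris : forall k n h, (0 < k <= m)%N -> W h -> typeIa W n h -> (n < nk k)%N ->
    `|act h (x k)| <= C * 2 ^- n;
  ed_jump : forall k, (0 < k <= m)%N ->
    (maxsupp (x k))%:R <= (2 ^+ (nk k.+1 - nk k) : R);
  ed_nkS : forall k, (0 < k <= m)%N -> (nk k < nk k.+1)%N;
  ed_nk1 : (2 ^ (2 * w) < nk 1)%N;
  ed_min : 8 * C * 2 ^+ (2 * w) <= (minsupp (x 1%N))%:R }.

Variables (C eps : R) (w m : nat) (x : nat -> {poly R}) (c : nat -> R) (nk : nat -> nat).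
Hypothesis ed : exact_data C eps w m x c nk.

Notation p k := (minsupp (x k)).
Notation r k := (maxsupp (x k)).
Notation pset := (minima m x).

Lemma psetP (P : pred nat) t : reflect (exists k, [/\ (0 < k <= m)%N, P k & t = p k]) (t \in pset P).
Proof.
rewrite in_fset /=; apply: (iffP mapP) => [[k]|[k [km Pk ->]]].
  by rewrite mem_filter mem_iota => /andP[Pk km] ->; exists k; split=> //; lia.
by exists k => //; rewrite mem_filter mem_iota Pk; lia.
Qed.

Lemma ed_nz k : (0 < k <= m)%N -> c00 (x k) /\ x k != 0.
Proof. by have /blockP[H _] := ed_block ed; exact: H. Qed.

Lemma ed_lt k k' : (0 < k)%N -> (k < k' <= m)%N -> (r k < p k')%N.
Proof. by have /blockP[_ H] := ed_block ed; exact: H. Qed.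

Lemma ed_le k : (0 < k <= m)%N -> (0 < p k <= r k)%N.
Proof. by move=> /ed_nz[c0 n0]; rewrite minsupp_gt0 //= min_le_maxsupp. Qed.

Lemma ed_plt k k' : (0 < k)%N -> (k < k' <= m)%N -> (p k < p k')%N.
Proof.
move=> k0 kk; have := ed_lt k0 kk; have := @ed_le k ltac:(lia); lia.
Qed.

Lemma ed_p_lt k k' : (0 < k <= m)%N -> (0 < k' <= m)%N -> (p k < p k')%N -> (k < k')%N.
Proof.
move=> km km' E; case: (ltngtP k k') => // [kk|kk]; last by move: E; rewrite kk ltnn.
by have := @ed_plt k' k ltac:(lia) ltac:(lia); lia.
Qed.

Lemma ed_ran_inj k k' t : (0 < k <= m)%N -> (0 < k' <= m)%N ->
  (p k <= t <= r k)%N -> (p k' <= t <= r k')%N -> k = k'.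
Proof.
move=> km km' Hk Hk'; case: (ltngtP k k') => // kk.
  by have := @ed_lt k k' ltac:(lia) ltac:(lia); lia.
by have := @ed_lt k' k ltac:(lia) ltac:(lia); lia.
Qed.

Lemma ed_nk_mono k k' : (0 < k)%N -> (k <= k' <= m.+1)%N -> (nk k <= nk k')%N.
Proof.
move=> k0 /andP[]; elim: k' => [|k' IH]; first lia.
rewrite leq_eqVlt => /orP[/eqP <- //|kk] km.
have := IH ltac:(lia) ltac:(lia); have := ed_nkS ed (k := k') ltac:(lia); lia.
Qed.

Lemma ed_C0 : 0 < C. Proof. exact: lt_le_trans ltr01 (ed_C ed). Qed.
Lemma ed_eps0 : 0 < eps. Proof. by have /andP[] := ed_eps ed. Qed.

Lemma ed_normE k h a b : (0 < k <= m)%N -> W h -> `|act h (restr a b (x k))| <= C.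
Proof.
move=> km Wh; rewrite -act_restr; apply: (ed_norm ed km).
exact: (norming_restr (W_closed s L1 sigma)).
Qed.

Lemma sum_range_eq (P : pred nat) (F F' : nat -> R) :
  (forall k, (0 < k <= m)%N -> P k -> F k = F' k) ->
  \sum_(1 <= k < m.+1 | P k) F k = \sum_(1 <= k < m.+1 | P k) F' k.
Proof. by move=> H; rewrite big_nat_cond [RHS]big_nat_cond; apply: eq_bigr => k /andP[]; exact: H. Qed.

Lemma sum_range_le (P : pred nat) (F F' : nat -> R) :
  (forall k, (0 < k <= m)%N -> P k -> F k <= F' k) ->
  \sum_(1 <= k < m.+1 | P k) F k <= \sum_(1 <= k < m.+1 | P k) F' k.
Proof. by move=> H; rewrite big_nat_cond [leRHS]big_nat_cond; apply: ler_sum => k /andP[]; exact: H. Qed.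

Lemma sum_c_mono (P Q : pred nat) :
  (forall k, (0 < k <= m)%N -> P k -> Q k) ->
  \sum_(1 <= k < m.+1 | P k) c k <= \sum_(1 <= k < m.+1 | Q k) c k.
Proof.
move=> H; rewrite big_mkcond [leRHS]big_mkcond /= big_nat [leRHS]big_nat.
apply: ler_sum => k km; case: ifP => [Pk|_]; first by rewrite (H k) //; lia.
by case: ifP => // _; apply: (ed_c ed); lia.
Qed.

Lemma sum_c_ge0 (P : pred nat) : 0 <= \sum_(1 <= k < m.+1 | P k) c k.
Proof. by rewrite big_nat_cond; apply: sumr_ge0 => k /andP[km _]; apply: (ed_c ed); lia. Qed.

Lemma sum_c_le1 (P : pred nat) : \sum_(1 <= k < m.+1 | P k) c k <= 1.
Proof. by rewrite -(ed_sum ed); exact: (@sum_c_mono P xpredT). Qed.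

Lemma sum_c_pick (Q : pred nat) k : (0 < k <= m)%N -> Q k ->
  \sum_(1 <= j < m.+1 | Q j) c j = c k + \sum_(1 <= j < m.+1 | Q j && (j != k)) c j.
Proof.
move=> km Qk; rewrite big_mkcond (bigD1_seq k) ?iota_uniq ?mem_index_iota //= Qk.
congr (_ + _); rewrite -big_mkcondr; apply: eq_bigl => j; exact: andbC.
Qed.

(* Schreier sets are nonempty, which the hypothesis accounts for. *)
Lemma mass_le (P : pred nat) :
  (pset P != fset0 -> schreier w.-1 (pset P)) -> \sum_(1 <= k < m.+1 | P k) c k <= eps.
Proof.
move=> H; have [P0|P0] := eqVneq (pset P) fset0; last by apply/ltW/(ed_mass ed)/H.
rewrite big_nat_cond big1 ?ltW ?ed_eps0 // => k /andP[km Pk].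
have /psetP : exists k', [/\ (0 < k' <= m)%N, P k' & p k = p k'] by exists k; split=> //; lia.
by rewrite P0.
Qed.

(** The minima of the [x k] with [P k] form an [S_1] set, or the empty set. *)
Definition small (P : pred nat) :=
  forall k, (0 < k <= m)%N -> P k -> (#|` pset P| <= p k)%N.

Lemma small_schreier1 (P : pred nat) : small P -> pset P != fset0 -> schreier 1 (pset P).
Proof. by move=> sP P0; split=> // i /psetP[k [km Pk ->]]; exact: sP. Qed.

Lemma mass_small (P : pred nat) : small P -> \sum_(1 <= k < m.+1 | P k) c k <= eps.
Proof.
move=> sP; apply: mass_le => P0; apply: (@schreierW 1); last exact: small_schreier1.
by have := ed_w ed; lia.
Qed.

Lemma small1 k : (0 < k <= m)%N -> small (pred1 k).
Proof.
move=> km k' k'm /= /eqP ->; apply: (@leq_trans 1); last by have := ed_le km; lia.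
rewrite -(cardfs1 (p k)); apply/fsubset_leq_card/fsubsetP => t /psetP[j [_ /eqP -> ->]].
by rewrite inE.
Qed.

Lemma c_le_eps k : (0 < k <= m)%N -> c k <= eps.
Proof.
move=> km; apply: le_trans (mass_small (small1 km)).
by rewrite (@sum_c_pick (pred1 k) k km) /= ?eqxx // lerDl sum_c_ge0.
Qed.

(** 0 when no element of [T] lies below [x]. *)
Definition below (T : {fset nat}) x : nat := \max_(t <- T | (t < x)%N) t.

Lemma belowP (T : {fset nat}) y t0 : t0 \in T -> (t0 < y)%N ->
  [/\ below T y \in T, (below T y < y)%N & forall t, t \in T -> (t < y)%N -> (t <= below T y)%N].
Proof.
move=> t0T t0y; have leb t : t \in T -> (t < y)%N -> (t <= below T y)%N.
  by move=> tT ty; rewrite /below (big_rem t) //= ty leq_maxl.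
suff [bT|b0] : (below T y \in T /\ (below T y < y)%N) \/ below T y = 0%N.
- by case: bT; split.
- have : t0 = 0%N by have := leb _ t0T t0y; rewrite b0; lia.
  by move=> E; rewrite b0; split; [rewrite -E|lia|rewrite -b0].
rewrite /below big_seq_cond; elim/big_ind : _ => [|a b [[? ?]|->] [[? ?]|->]|t].
- by right.
- by left; rewrite /maxn; case: ltnP.
- by left; rewrite maxn0.
- by left; rewrite max0n.
- by right.
- by move=> /andP[? ?]; left.
Qed.

(** All the indices whose range meets [T] except the first one can be moved to
    the left, injectively into [T]; so their minima form an [S_n] set. The first
    one alone has mass at most [eps]. *)
Lemma mass_starts n T : (n < w)%N -> schreier n T ->
  \sum_(1 <= k < m.+1 | has (fun t => p k <= t <= r k)%N T) c k <= 2 * eps.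
Proof.
move=> nw ST; pose P k := has (fun t => p k <= t <= r k)%N T.
have [/hasP[k1 k1m Pk1]|/hasPn nP] := boolP (has P (iota 1 m)); last first.
  rewrite big_nat_cond big1; first by have := ed_eps0; lra.
  move=> k /andP[km Pk]; have kI : k \in iota 1 m by rewrite mem_iota; lia.
  by have := nP _ kI; rewrite [P k]Pk.
have ex : exists k, (0 < k <= m)%N && P k.
  by exists k1; rewrite Pk1; move: k1m; rewrite mem_iota; lia.
case: (ex_minnP ex) => k0 /andP[k0m Pk0] k0min.
have [t0 t0T Ht0] : exists2 t0, t0 \in T & (p k0 <= t0 <= r k0)%N by apply/hasP.
have split0 : \sum_(1 <= k < m.+1 | P k) c k <=
    c k0 + \sum_(1 <= k < m.+1 | P k && (k != k0)) c k.
  by rewrite (sum_c_pick k0m Pk0).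
apply: le_trans split0 _; rewrite mulrC mulrDr mulr1; apply: lerD; first exact: c_le_eps.
apply: mass_le => P0; apply: (@schreierW n); first by have := ed_w ed; lia.
have gt0 k : (0 < k <= m)%N -> P k && (k != k0) -> (t0 < p k)%N.
  move=> km /andP[Pk kk0]; have := k0min k; rewrite Pk km => /(_ isT) k0k.
  have := @ed_lt k0 k ltac:(lia) ltac:(lia); lia.
apply: (@schreier_spread n T _ (below T)) => //.
- move=> _ /psetP[k [km Pk ->]]; have [? ? _] := belowP t0T (gt0 k km Pk).
  by split=> //; lia.
- move=> _ _ /psetP[k [km Pk ->]] /psetP[k' [km' Pk' ->]] kk'.
  have {kk'}kk := ed_p_lt km km' kk'.
  have [b1 b2 b3] := belowP t0T (gt0 k km Pk).
  have [b1' b2' b3'] := belowP t0T (gt0 k' km' Pk').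
  apply: leq_trans b2 _.
  have /hasP[t tT Ht] : P k by case/andP: Pk.
  apply: (@leq_trans t); first by case/andP: Ht.
  apply: b3' => //; apply: leq_ltn_trans (_ : (r k < _)%N); first by case/andP: Ht.
  by apply: ed_lt; rewrite ?kk //; case/andP: km; case/andP: km'.
Qed.

(** Small sets, one behind each point of an [S_n] set, form an [S_(n+1)] set. *)
Lemma mass_comp n T (P : pred nat) : (n.+2 <= w)%N -> schreier n T ->
  (forall k, (0 < k <= m)%N -> P k -> exists2 t, t \in T & (t < p k)%N) ->
  (forall t, t \in T -> small (fun k => P k && (below T (p k) == t))) ->
  \sum_(1 <= k < m.+1 | P k) c k <= eps.
Proof.
move=> nw ST Hlt Hs; apply: mass_le => P0; apply: (@schreierW n.+1); first lia.
apply: (@schreier_comp1 n _ T (below T)) => //.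
- move=> _ /psetP[k [km Pk ->]]; have [t tT tp] := Hlt _ km Pk.
  by have [? ? _] := belowP tT tp; split=> //; lia.
- move=> _ _ /psetP[k [km Pk ->]] /psetP[k' [km' Pk' ->]] kk'.
  have [t tT tp] := Hlt _ km Pk; have [b1 b2 b3] := belowP tT tp.
  have [t' tT' tp'] := Hlt _ km' Pk'; have [_ _ b3'] := belowP tT' tp'.
  by apply: b3' => //; lia.
- move=> _ /psetP[k [km Pk ->]]; have [t tT tp] := Hlt _ km Pk.
  have [b1 b2 b3] := belowP tT tp.
  rewrite (_ : fibre _ _ _ = pset (fun j => P j && (below T (p j) == below T (p k)))).
    apply: small_schreier1; first exact: Hs.
    by apply/fset0Pn; exists (p k); apply/psetP; exists k; rewrite Pk eqxx.
  apply/fsetP => y; rewrite in_fibre; apply/andP/psetP.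
    by move=> [/psetP[j [jm Pj ->]] E]; exists j; rewrite Pj E.
  by move=> [j [jm /andP[Pj E] ->]]; rewrite E; split=> //; apply/psetP; exists j.
Qed.

(** At most [t0] indices behind [t0] form a small set; only one more [x k] can have
    a range that contains [t0]. The heavier one of the two sets is kept. *)
Lemma split_small (I Q : pred nat) t0 :
  (size [seq k <- iota 1 m | Q k] <= t0)%N ->
  exists G : pred nat, [/\ forall k, G k -> I k, small G
    & \sum_(1 <= k < m.+1 | [&& I k, Q k & (t0 <= r k)%N]) c k
      <= 2 * \sum_(1 <= k < m.+1 | G k) c k].
Proof.
move=> Qt; pose H1 k := [&& I k, Q k & (t0 < p k)%N].
pose H2 k := [&& I k, Q k & (p k <= t0 <= r k)%N].
have le12 : \sum_(1 <= k < m.+1 | [&& I k, Q k & (t0 <= r k)%N]) c k <=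
    \sum_(1 <= k < m.+1 | H1 k) c k + \sum_(1 <= k < m.+1 | H2 k) c k.
  rewrite [leRHS]addrC (bigID (fun k => p k <= t0)%N) /=; apply: lerD; apply: sum_c_mono => k km;
    rewrite /H1 /H2.
    by move=> /andP[/and3P[-> -> ->] ->].
  by move=> /andP[/and3P[-> -> _]]; rewrite -ltnNge => ->.
have s1 : small H1.
  move=> k km /and3P[_ _ tp]; apply: leq_trans (ltnW tp); apply: leq_trans Qt.
  rewrite -(size_map (fun k => p k)); apply: uniq_leq_size; first exact: fset_uniq.
  move=> _ /psetP[j [jm /and3P[_ Qj _] ->]]; apply/mapP; exists j => //.
  by rewrite mem_filter Qj mem_iota; lia.
have s2 : small H2.
  move=> k km H2k; have : (#|` pset (pred1 k)| <= p k)%N by apply: small1 => /=.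
  apply: leq_trans; apply/fsubset_leq_card/fsubsetP => t /psetP[j [jm /and3P[_ _ Hj] ->]].
  move: H2k => /and3P[_ _ Hk]; apply/psetP; exists k; split => //=.
  by rewrite (ed_ran_inj jm km Hj Hk).
case: (leP (\sum_(1 <= k < m.+1 | H1 k) c k) (\sum_(1 <= k < m.+1 | H2 k) c k)) => H12.
- exists H2; split=> //; first by move=> k /and3P[].
  by apply: le_trans le12 _; lra.
- exists H1; split=> //; first by move=> k /and3P[].
  by apply: le_trans le12 _; lra.
Qed.

(** Bounds for functionals of type I_alpha and weight [v] on [x_k], off the range of
    exceptional weights between [nk k] and [nk k.+1]: small weights are
    controlled by the rapidly increasing sequence, large ones by the coordinates. *)
Definition tau k v : R :=
  C * 2 ^- v + (if (nk k.+1 <= v)%N then C * 2 ^- nk k * 2 ^- (v - nk k.+1) else 0).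

Lemma tau_ge0 k v : 0 <= tau k v.
Proof.
have C0 := ltW ed_C0.
by rewrite /tau addr_ge0 ?mulr_ge0 ?invr_ge0 ?exprn_ge0 //; case: ifP => // _;
  rewrite !mulr_ge0 ?invr_ge0 ?exprn_ge0.
Qed.

Lemma pow2_ge0 n : 0 <= 2 ^- n :> R. Proof. by rewrite invr_ge0 exprn_ge0. Qed.

End ExactData.

(** * Functionals of type II on an exact vector *)

Section TypeTwo.
Variables (R : realType) (s : nat -> R -> R) (L1 L2 L3 : set nat).
Variable sigma : seq {poly R} -> nat.
Hypotheses (hs : dense_in_sphere s) (hL : coding_sets R L1 L2 L3).
Hypothesis hsigma : coding_function L2 sigma.
Notation W := (W s L1 sigma).
Variables (C eps : R) (w m : nat) (x : nat -> {poly R}) (c : nat -> R) (nk : nat -> nat).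
Hypothesis ed : exact_data s L1 sigma C eps w m x c nk.

Notation p k := (minsupp (x k)).
Notation r k := (maxsupp (x k)).
Notation tau := (tau C nk).

Lemma tau_typeIa k v h a b : (0 < k <= m)%N -> W h -> typeIa W v h ->
  ~~ (nk k <= v < nk k.+1)%N -> `|act h (restr a b (x k))| <= tau k v.
Proof.
move=> km Wh Th nexc; rewrite /tau.
have C0 := ltW (ed_C0 ed).
have [vk|kv] := ltnP v (nk k).
  rewrite -act_restr; apply: (@le_trans _ _ (C * 2 ^- v)).
    apply: (ed_ris ed km _ _ vk); first exact: (norming_restr (W_closed s L1 sigma)).
    exact: typeIa_restr.
  by rewrite lerDl; case: ifP => // _; rewrite !mulr_ge0 ?pow2_ge0.
have kv' : (nk k.+1 <= v)%N by move: nexc; rewrite kv /= -leqNgt.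
rewrite kv'; apply: (@le_trans _ _ (2 ^- v * C * (r k)%:R)).
  have [x0 xn] := ed_nz ed km.
  rewrite -act_restr; apply: act_le_sup => //; rewrite ?pow2_ge0 //.
    by move=> i; exact: (typeIa_coef hs _ (typeIa_restr _ _ Th)).
  move=> i; have [->|i0] := posnP i; first by rewrite [(x k)`_0]x0 normr0.
  by rewrite -act_Xn; apply: (ed_norm ed km); exact: W_Xn.
apply: (@le_trans _ _ (2 ^- v * C * 2 ^+ (nk k.+1 - nk k))).
  by rewrite ler_wpM2l ?mulr_ge0 ?pow2_ge0 // (ed_jump ed km).
have nkS := ed_nkS ed km.
have -> : 2 ^- v * C * 2 ^+ (nk k.+1 - nk k) = C * 2 ^- nk k * 2 ^- (v - nk k.+1) :> R.
  have -> : v = (nk k + (nk k.+1 - nk k) + (v - nk k.+1))%N by lia.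
  rewrite (_ : nk k + _ + _ - nk k.+1 = v - nk k.+1)%N; last lia.
  by rewrite !exprD; field; rewrite !expf_neq0 ?pnatr_eq0.
by rewrite lerDr mulr_ge0 ?pow2_ge0.
Qed.

Lemma tau_sum k N (V : seq nat) : uniq V ->
  \sum_(v <- V | (N <= v)%N) tau k v <= 2 * C * 2 ^- N + 2 * C * 2 ^- nk k.
Proof.
move=> uV; have C0 := ltW (ed_C0 ed); rewrite /tau big_split /=; apply: lerD.
  rewrite -mulr_sumr (_ : 2 * C * _ = C * (2 * 2 ^- N)); last by ring.
  rewrite ler_wpM2l // -big_filter.
  apply: sum_geom_le; first exact: filter_uniq.
  by move=> v; rewrite mem_filter => /andP[].
rewrite -big_mkcondr -mulr_sumr (_ : 2 * C * _ = C * 2 ^- nk k * 2); last by ring.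
rewrite ler_wpM2l ?mulr_ge0 ?pow2_ge0 // -big_filter.
rewrite -(big_map (fun v => v - nk k.+1)%N xpredT (fun v => 2 ^- v)).
apply: (@le_trans _ _ (2 * 2 ^- 0)); last by rewrite expr0 invr1 mulr1.
apply: sum_geom_le => //; rewrite map_inj_in_uniq ?filter_uniq //.
by move=> u v; rewrite !mem_filter => /andP[/andP[_ ?] _] /andP[/andP[_ ?] _]; lia.
Qed.

(** A type II functional splits at a threshold [N] into pieces of weight below
    [N] and pieces of weight at least [N]. On a single [x k] the
    high part is a sum of small terms with distinct weights, unless one of the
    weights lies between [nk k] and [nk k.+1]; each weight does so for one [k] only, and the
    number of weights is at most the beginning [t0] of the support. *)
Lemma pair_split G d f g w' F (e e' : nat -> R) A B N : G `<=` W ->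
  special_on L1 sigma G d f g w' F ->
  (forall q, q \in F -> `|e q| <= 2^-1 /\ `|e' q| <= 2^-1) ->
  let term q := e q *: f q + e' q *: g q in
  W (restr A B (\sum_(q <- F) term q)) -> (N <= nk 1)%N ->
  let V := [seq w' q | q <- F] in
  let hl := restr A B (\sum_(q <- F | (w' q < N)%N) term q) in
  let hh := restr A B (\sum_(q <- F | (N <= w' q)%N) term q) in
  exists (Q : pred nat) (t0 : nat),
  [/\ uniq V /\ (forall v, v \in V -> (10 <= v)%N),
      restr A B (\sum_(q <- F) term q) = hl + hh,
      forall z (phi : nat -> R),
        (forall v f a b, v \in V -> (v < N)%N -> G f -> typeIa G v f ->
           `|act f (restr a b z)| <= phi v) ->
        `|act hl z| <= \sum_(v <- V | (v < N)%N) phi v,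
      (size [seq k <- iota 1 m | Q k] <= t0)%N
    & forall k a b, (0 < k <= m)%N ->
        `|act hh (restr a b (x k))| <= \sum_(v <- V | (N <= v)%N) tau k v +
           (if Q k && (t0 <= r k)%N then 2 * C else 0)].
Proof.
move=> GW so eM term Wh N1 V hl hh.
have [sp Fd [q0 [q0F q0min] card]] := so.
have spW := special_mono GW sp.
have [sp1 bl _ _] := sp; have [b1 b2 b3 b4] := block_interleave bl.
have winj q q' : q \in F -> q' \in F -> w' q = w' q' -> q = q'.
  by move=> qF q'F; exact: (special_weight_inj hs hL hsigma spW (Fd _ qF) (Fd _ q'F)).
have V10 q : q \in F -> (10 <= w' q)%N.
  by move=> qF; exact: (special_ge10 hs hL hsigma spW (Fd _ qF)).
pose Q k := has (fun q => nk k <= w' q < nk k.+1)%N F.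
pose t0 := minsupp (f q0).
have C0 := ed_C0 ed.
have term_le q z (M : R) : q \in F -> `|act (f q) z| <= M -> `|act (g q) z| <= M ->
    `|act (term q) z| <= M.
  by move=> qF fM gM; have [e1 e2] := eM _ qF; exact: act_pair_le.
have low z (phi : nat -> R) :
    (forall v f a b, v \in V -> (v < N)%N -> G f -> typeIa G v f ->
       `|act f (restr a b z)| <= phi v) ->
    `|act hl z| <= \sum_(v <- V | (v < N)%N) phi v.
  move=> Hphi; rewrite act_restr act_suml big_map; apply: le_trans (ler_norm_sum _ _ _) _.
  rewrite big_seq_cond [leRHS]big_seq_cond; apply: ler_sum => q /andP[qF qN].
  have [Gf Gg Tf Tg] := sp1 _ (Fd _ qF).
  have qV : w' q \in V by apply/mapP; exists q.
  by apply: term_le => //; apply: Hphi.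
have hlh : restr A B (\sum_(q <- F) term q) = hl + hh.
  rewrite /hl /hh -restrD (bigID (fun q => w' q < N)%N) /=.
  by congr (restr _ _ (_ + _)); apply: eq_bigl => q; rewrite -leqNgt.
exists Q, t0; split => //.
- split; first by rewrite map_inj_in_uniq ?fset_uniq.
  by move=> v /mapP[q qF ->]; exact: V10.
- have /choice[q Hq] k : exists q, Q k -> q \in F /\ (nk k <= w' q < nk k.+1)%N.
    have [/hasP[q qF Hq]|_] := boolP (Q k); first by exists q.
    by exists 0%N.
  apply: (@leq_trans #|` F|); last by rewrite /t0; lia.
  rewrite -(size_map q); apply: uniq_leq_size.
    rewrite map_inj_in_uniq ?filter_uniq ?iota_uniq // => k k'.
    rewrite !mem_filter !mem_iota => /andP[/Hq[_ Hk] km] /andP[/Hq[_ Hk'] k'm] E.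
    rewrite E in Hk; case: (ltngtP k k') => // kk.
      by have := ed_nk_mono ed (k := k.+1) (k' := k') isT ltac:(lia); lia.
    by have := ed_nk_mono ed (k := k'.+1) (k' := k) isT ltac:(lia); lia.
  by move=> _ /mapP[k + ->]; rewrite mem_filter => /andP[/Hq[]].
- move=> k a b km; have tau0 : 0 <= \sum_(v <- V | (N <= v)%N) tau k v.
    by apply: sumr_ge0 => v _; exact: (tau_ge0 ed).
  have [Qk|nQk] := boolP (Q k); last first.
    rewrite addr0 act_restr act_suml big_map; apply: le_trans (ler_norm_sum _ _ _) _.
    rewrite big_seq_cond [leRHS]big_seq_cond; apply: ler_sum => q /andP[qF qN].
    have [Gf Gg Tf Tg] := sp1 _ (Fd _ qF).
    have nexc : ~~ (nk k <= w' q < nk k.+1)%N by move/hasPn: nQk; apply.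
    by rewrite restr_restr; apply: term_le => //; apply: tau_typeIa => //;
      try exact: GW; exact: typeIa_mono GW _.
  rewrite andTb; case: leqP => [t0r|rt0].
    apply: (@le_trans _ _ (2 * C)); last by rewrite lerDr.
    have -> : hh = restr A B (\sum_(q <- F) term q) - hl by rewrite hlh addrAC subrr add0r.
    rewrite actDl actNl; apply: le_trans (ler_normB _ _) _.
    rewrite mulr_natl mulr2n; apply: lerD; first exact: (ed_normE ed).
    apply: (@le_trans _ _ (\sum_(v <- V | (v < N)%N) C * 2 ^- v)).
      apply: low => v f' a' b' vV vN Gf' Tf'; rewrite restr_restr -act_restr.
      have nk1k : (nk 1 <= nk k)%N by apply: (ed_nk_mono ed) => //; lia.
      apply: (ed_ris ed km); last lia.
        by apply: (norming_restr (W_closed s L1 sigma)); exact: GW.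
      by apply: typeIa_restr; exact: typeIa_mono GW _.
    rewrite -mulr_sumr -[leRHS]mulr1 ler_wpM2l ?(ltW C0) //.
    rewrite -big_filter; apply: (@le_trans _ _ (2 * 2 ^- 1)); last by rewrite expr1 divff.
    apply: sum_geom_le; first by rewrite filter_uniq // map_inj_in_uniq ?fset_uniq.
    by move=> v; rewrite mem_filter => /andP[_ /mapP[q /V10 qF ->]]; lia.
  rewrite addr0 (_ : act _ _ = 0) ?normr0 // act_restr act_suml big_seq_cond big1 //.
  move=> q /andP[qF _]; have qd := Fd _ qF; have q0d := Fd _ q0F.
  have fq : (t0 <= minsupp (f q))%N.
    rewrite /t0; have := q0min _ qF; case: (ltngtP q0 q) => // [q0q _|<- //].
    have [_ n1] := b1 _ q0d; have [_ n2] := b2 _ q0d.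
    have := min_le_maxsupp n1; have := min_le_maxsupp n2; have := b3 _ q0d.
    by have := b4 q0 q ltac:(lia) ltac:(lia); lia.
  have [_ n1] := b1 _ qd; have := min_le_maxsupp n1; have := b3 _ qd => H3 H4.
  by rewrite actDl !actZl restr_restr !act_restr_apart ?mulr0 ?addr0 //; apply/orP; right; lia.
Qed.

Lemma typeII_split G S h N : G `<=` W -> W h -> typeII s L1 sigma G S h ->
  (N <= nk 1)%N ->
  exists (V : seq nat) (hl hh : {poly R}) (Q : pred nat) (t0 : nat),
  [/\ uniq V /\ (forall v, v \in V -> S v /\ (10 <= v)%N),
      h = hl + hh,
      forall z (phi : nat -> R),
        (forall v f a b, v \in V -> (v < N)%N -> G f -> typeIa G v f ->
           `|act f (restr a b z)| <= phi v) ->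
        `|act hl z| <= \sum_(v <- V | (v < N)%N) phi v,
      (size [seq k <- iota 1 m | Q k] <= t0)%N
    & forall k a b, (0 < k <= m)%N ->
        `|act hh (restr a b (x k))| <= \sum_(v <- V | (N <= v)%N) tau k v +
           (if Q k && (t0 <= r k)%N then 2 * C else 0)].
Proof.
move=> GW Wh /(typeII_pair_sum hs)[->|PS] N1.
  exists [::], 0, 0, pred0, 0%N; split.
  - by [].
  - by rewrite addr0.
  - by move=> z phi _; rewrite act0l normr0 big_nil.
  - by rewrite filter_pred0.
  - by move=> k a b km; rewrite act0l normr0 big_nil add0r.
have [d [f [g [w' [F [e [e' [A [B [so eM hE SF]]]]]]]]]] := PS.
rewrite hE in Wh *; have [Q [t0 [[uV V10] H1 H2 H3 H4]]] := pair_split GW so eM Wh N1.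
exists [seq w' q | q <- F]; do 2!eexists; exists Q, t0; split; [|exact: H1| | |] => //.
by split=> // v vV; split; [case/mapP: vV => q qF ->; exact: SF|exact: V10].
Qed.

(** The indices at which a weight falls between [nk k] and [nk k.+1] are too few to
    matter: there are at most [t0] of them, and only those beyond [t0] are hit. *)
Lemma mass_exceptional (Q : pred nat) t0 :
  (size [seq k <- iota 1 m | Q k] <= t0)%N ->
  \sum_(1 <= k < m.+1 | Q k && (t0 <= r k)%N) c k <= 2 * eps.
Proof.
move=> Qt; have [G [_ sG]] := split_small ed xpredT Qt.
move=> /le_trans; apply; rewrite ler_wpM2l //; exact: (mass_small ed).
Qed.

End TypeTwo.

(** * Averages and functionals of type I on an exact vector *)

Lemma seq_argmax (R : realType) (T : eqType) (F : T -> R) (l : seq T) : l != [::] ->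
  exists2 y, y \in l & forall z, z \in l -> F z <= F y.
Proof.
elim: l => // y [_ _|z l IH _]; first by exists y; rewrite ?inE // => z; rewrite inE => /eqP ->.
have [//|u ul Hu] := IH; have [yu|uy] := leP (F y) (F u).
  exists u; first by rewrite in_cons ul orbT.
  by move=> v; rewrite in_cons => /orP[/eqP -> //|/Hu].
exists y; first exact: mem_head.
move=> v; rewrite in_cons => /orP[/eqP -> //|/Hu H].
exact: le_trans H (ltW uy).
Qed.

Section Averages.
Variables (R : realType) (s : nat -> R -> R) (L1 L2 L3 : set nat).
Variable sigma : seq {poly R} -> nat.
Hypotheses (hs : dense_in_sphere s) (hL : coding_sets R L1 L2 L3).
Hypothesis hsigma : coding_function L2 sigma.
Notation W := (W s L1 sigma).
Variables (C eps : R) (w m : nat) (x : nat -> {poly R}) (c : nat -> R) (nk : nat -> nat).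
Hypothesis ed : exact_data s L1 sigma C eps w m x c nk.

Notation p k := (minsupp (x k)).
Notation r k := (maxsupp (x k)).
Notation tau := (tau C nk).
Notation small := (small m x).
Let C0 : 0 < C := ed_C0 ed.

(** What both kinds of averages have in common: up to a small set of indices, an
    average of size [sz] acts on the [x k] with a factor [1 / sz]. *)
Definition spread_average (sz : nat) (a : {poly R}) :=
  forall (I : pred nat) A B, exists G : pred nat,
  [/\ forall k, G k -> I k, small G
    & \sum_(1 <= k < m.+1 | I k) c k * `|act a (restr A B (x k))|
      <= 4 * C / sz%:R * (\sum_(1 <= k < m.+1 | I k) c k)
         + 4 * C * \sum_(1 <= k < m.+1 | G k) c k].

Lemma average_act (h : nat -> {poly R}) n d z :
  `|act (n%:R^-1 *: \sum_(1 <= j < d.+1) h j) z| <=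
  n%:R^-1 * \sum_(1 <= j < d.+1) `|act (h j) z|.
Proof.
rewrite actZl act_suml normrM ger0_norm ?invr_ge0 ?ler0n //.
by rewrite ler_wpM2l ?invr_ge0 ?ler0n // ler_norm_sum.
Qed.

Lemma sum_average_le (I : pred nat) (h : nat -> {poly R}) n d (z : nat -> {poly R}) :
  \sum_(1 <= k < m.+1 | I k) c k * `|act (n%:R^-1 *: \sum_(1 <= j < d.+1) h j) (z k)| <=
  n%:R^-1 * \sum_(1 <= j < d.+1) \sum_(1 <= k < m.+1 | I k) c k * `|act (h j) (z k)|.
Proof.
rewrite exchange_big /= mulr_sumr; apply: sum_range_le => k km _.
rewrite -mulr_sumr mulrCA ler_wpM2l ?(ed_c ed) //; exact: average_act.
Qed.

(** Successive functionals: apart from one, those acting on [x k] start in its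
    range, and each of them starts in the range of at most one [x k]. The [d <= sz]
    starts weigh at most [d] times the largest coefficient, whose index is the
    small set. *)
Lemma alpha_spread sz a : alpha_average W sz a -> spread_average sz a.
Proof.
move=> [Wa [d [h [dsz bl Wh ->]]]] I A B.
have [Inil|Inn] := eqVneq [seq k <- iota 1 m | I k] [::].
  exists pred0; split=> //.
  have I0 k : (0 < k <= m)%N -> ~~ I k.
    move=> km; apply/negP => Ik.
    have : k \in [seq k <- iota 1 m | I k] by rewrite mem_filter Ik mem_iota.
    by rewrite Inil.
  have S0 (F : nat -> R) : \sum_(1 <= k < m.+1 | I k) F k = 0.
    rewrite big_nat_cond big1 // => k /andP[km Ik].
    by have := I0 k km; rewrite Ik.
  by rewrite !S0 big_pred0 // !mulr0 addr0.
have [ks] := seq_argmax c Inn; rewrite mem_filter mem_iota => /andP[Iks ksm] ksmax.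
have ksr : (0 < ks <= m)%N by lia.
exists (pred1 ks); split; first by move=> k /eqP ->.
  exact: (small1 ed).
have -> : \sum_(1 <= k < m.+1 | pred1 ks k) c k = c ks.
  rewrite (@sum_c_pick _ m c (pred1 ks) ks) /= ?eqxx // big1 ?addr0 //.
  by move=> k /andP[/eqP -> /eqP].
have /blockP[bl1 bl2] := bl.
pose st k j := (p k <= minsupp (h j) <= r k)%N.
have point k : (0 < k <= m)%N -> \sum_(1 <= j < d.+1) `|act (h j) (restr A B (x k))| <=
    C * \sum_(1 <= j < d.+1) (st k j)%:R + C.
  move=> km; rewrite (bigID (st k)) /=; apply: lerD.
    rewrite mulr_sumr [leLHS]big_mkcond /=; rewrite big_nat [leRHS]big_nat.
    apply: ler_sum => j jd; case: (st k j); last by rewrite mulr0.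
    rewrite mulr1 /=; apply: (ed_normE ed _ _ km); apply: Wh; lia.
  apply: le_trans (ler_norm _) _; apply: sum_at_most_one; rewrite ?iota_uniq ?(ltW C0) //.
    move=> j; rewrite mem_index_iota normr_id => jd _.
    by apply: (ed_normE ed _ _ km); apply: Wh; lia.
  move=> i j; rewrite !mem_index_iota => id jd nsi nsj ai aj.
  have hits q : (0 < q <= d)%N -> ~~ st k q -> `|act (h q) (restr A B (x k))| != 0 ->
      (minsupp (h q) < p k <= maxsupp (h q))%N.
    move=> qd nst aq; apply: contraR aq => H.
    rewrite act_restr_apart ?normr0 //; move: nst; rewrite /st.
    by move: (min_le_maxsupp (bl1 _ qd).2) (ed_le ed km) H; lia.
  have := hits i ltac:(lia) nsi ai; have := hits j ltac:(lia) nsj aj.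
  case: (ltngtP i j) => // ij.
    by have := bl2 i j ltac:(lia) ltac:(lia); lia.
  by have := bl2 j i ltac:(lia) ltac:(lia); lia.
apply: le_trans (sum_average_le I h sz d (fun k => restr A B (x k))) _.
have sz0 : 0 <= sz%:R^-1 :> R by rewrite invr_ge0 ler0n.
have szd : sz%:R^-1 * d%:R <= 1 :> R.
  by rewrite mulrC ler_pdivrMr ?ltr0n ?mul1r ?ler_nat; lia.
rewrite exchange_big /=.
apply: (@le_trans _ _ (sz%:R^-1 * (C * d%:R * c ks + C * \sum_(1 <= k < m.+1 | I k) c k))).
  rewrite ler_wpM2l //.
  apply: (@le_trans _ _ (\sum_(1 <= k < m.+1 | I k)
      (C * (\sum_(1 <= j < d.+1) (st k j)%:R * c k) + C * c k))).
    apply: sum_range_le => k km _; rewrite -mulr_sumr -mulr_suml.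
    have := ler_wpM2l (ed_c ed km) (point k km); rewrite mulrDr => /le_trans; apply.
    by rewrite le_eqVlt; apply/orP; left; apply/eqP; ring.
  rewrite big_split /= -!mulr_sumr lerD2r exchange_big /= -mulrA ler_wpM2l ?(ltW C0) //.
  apply: (@le_trans _ _ (\sum_(1 <= j < d.+1) c ks)); last first.
    by rewrite sumr_const_nat subn1 mulr_natl.
  apply: ler_sum => j _; apply: le_trans (ler_norm _) _.
  apply: sum_at_most_one; rewrite ?iota_uniq ?(ed_c ed) //.
    move=> k; rewrite mem_index_iota => km Ik; have kr : (0 < k <= m)%N by lia.
    have ckk : c k <= c ks by apply: ksmax; rewrite mem_filter Ik mem_iota; lia.
    rewrite ger0_norm ?mulr_ge0 ?ler0n ?(ed_c ed) //.
    by case: (st k j); rewrite ?mul1r ?mul0r ?(ed_c ed).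
  move=> k k'; rewrite !mem_index_iota => km k'm _ _.
  case E: (st k j); last by rewrite mul0r eqxx.
  case E': (st k' j); last by rewrite mul0r eqxx.
  by move=> _ _; apply: (ed_ran_inj ed _ _ E E'); lia.
have SI := sum_c_ge0 ed I; have cks := ed_c ed ksr.
apply: (@le_trans _ _ (sz%:R^-1 * d%:R * (C * c ks) + C / sz%:R * \sum_(1 <= k < m.+1 | I k) c k)).
  by rewrite le_eqVlt; apply/orP; left; apply/eqP; ring.
rewrite addrC; apply: lerD.
  rewrite ler_wpM2r // ler_wpM2r //; have := ltW C0; lra.
apply: (@le_trans _ _ (1 * (C * c ks))); first by rewrite ler_wpM2r // mulr_ge0 // ltW.
have := mulr_ge0 (ltW C0) cks; lra.
Qed.

(** Type II functionals with disjoint weight sets: their regular parts add up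
    because all weights are distinct, and each one has only a small set of
    exceptional indices, the heaviest of which is the small set. *)
Lemma beta_spread sz a : beta_average s L1 sigma W sz a -> spread_average sz a.
Proof.
move=> [Wa [d [h [S [dsz Hh dis ->]]]]] I A B.
have /choice[T HT] j : exists T : seq nat * pred nat * nat, (0 < j <= d)%N ->
    let: (V, Q, t0) := T in
    [/\ uniq V, forall v, v \in V -> S j v, (size [seq k <- iota 1 m | Q k] <= t0)%N
      & forall k, (0 < k <= m)%N -> `|act (h j) (restr A B (x k))| <=
          \sum_(v <- V) tau k v + (if Q k && (t0 <= r k)%N then 2 * C else 0)].
  have [jd|jd] := boolP (0 < j <= d)%N; last by exists ([::], (pred0 : pred nat), 0%N).
  have [Whj Thj] := Hh j jd.
  have [V [hl [hh [Q [t0 [[uV SV] hE low Qt high]]]]]] :=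
    typeII_split hs hL hsigma ed (fun f (Wf : W f) => Wf) Whj Thj (leq0n _).
  exists (V, Q, t0) => _; split=> // [v /SV[]//|k km].
  have := high k A B km; rewrite hE actDl.
  have : `|act hl (restr A B (x k))| <= \sum_(v <- V | (v < 0)%N) C.
    by apply: low.
  rewrite big_pred0 // normr_le0 => /eqP ->; rewrite add0r.
  by rewrite (eq_bigl xpredT).
pose V j := (T j).1.1; pose Q j := (T j).1.2; pose t0 j := (T j).2.
have {}HT j : (0 < j <= d)%N -> [/\ uniq (V j), forall v, v \in V j -> S j v,
    (size [seq k <- iota 1 m | Q j k] <= t0 j)%N
  & forall k, (0 < k <= m)%N -> `|act (h j) (restr A B (x k))| <=
          \sum_(v <- V j) tau k v + (if Q j k && (t0 j <= r k)%N then 2 * C else 0)].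
  by move=> /HT; rewrite /V /Q /t0; case: (T j) => -[].
have /choice[G HG] j : exists G : pred nat, (0 < j <= d)%N ->
    [/\ forall k, G k -> I k, small G
    & \sum_(1 <= k < m.+1 | [&& I k, Q j k & (t0 j <= r k)%N]) c k
      <= 2 * \sum_(1 <= k < m.+1 | G k) c k].
  have [jd|jd] := boolP (0 < j <= d)%N; last by exists pred0.
  by have [_ _ Qt _] := HT j jd; have [G HG] := split_small ed I Qt; exists G.
have dn : iota 1 d != [::] by rewrite -size_eq0 size_iota; lia.
have [j0 j0d j0max] := seq_argmax (fun j => \sum_(1 <= k < m.+1 | G j k) c k) dn.
have j0r : (0 < j0 <= d)%N by move: j0d; rewrite mem_iota; lia.
have [GI sG _] := HG j0 j0r; exists (G j0); split=> //.
apply: le_trans (sum_average_le I h sz d (fun k => restr A B (x k))) _.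
have szi0 : 0 <= sz%:R^-1 :> R by rewrite invr_ge0 ler0n.
have SI := sum_c_ge0 ed I.
pose g := \sum_(1 <= k < m.+1 | G j0 k) c k.
have reg k : (0 < k <= m)%N -> \sum_(1 <= j < d.+1) \sum_(v <- V j) tau k v <= 4 * C.
  move=> km; have [||U [uU _ ->]] := @sum_disjoint_union R d V (tau k).
  - by move=> j /HT[].
  - move=> i j v id jd ij vi vj; have [_ Hi _ _] := HT i id; have [_ Hj _ _] := HT j jd.
    by have := dis i j id jd ij; rewrite -subset0 => /(_ v (conj (Hi _ vi) (Hj _ vj))).
  apply: le_trans (_ : 2 * C * 2 ^- 0 + 2 * C * 2 ^- nk k <= _).
    by have := tau_sum ed k 0 uU; rewrite (eq_bigl xpredT).
  have : (2 ^- nk k : R) <= 1 by rewrite invf_le1 ?exprn_gt0 // exprn_ege1 // ler1n.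
  by have := C0; rewrite expr0 invr1; nra.
apply: (@le_trans _ _ (sz%:R^-1 * (\sum_(1 <= k < m.+1 | I k) c k * (4 * C) + d%:R * (4 * C * g)))).
  rewrite ler_wpM2l //.
  apply: (@le_trans _ _ (\sum_(1 <= j < d.+1) (\sum_(1 <= k < m.+1 | I k)
     c k * \sum_(v <- V j) tau k v + 4 * C * g))).
    rewrite big_nat [leRHS]big_nat; apply: ler_sum => j jd.
    have jr : (0 < j <= d)%N by lia.
    have [_ _ _ Hj] := HT j jr; have [_ _ HGj] := HG j jr.
    have Gj : \sum_(1 <= k < m.+1 | G j k) c k <= g by apply: j0max; rewrite mem_iota; lia.
    apply: (@le_trans _ _ (\sum_(1 <= k < m.+1 | I k) (c k * \sum_(v <- V j) tau k v +
        2 * C * (if Q j k && (t0 j <= r k)%N then c k else 0)))).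
      apply: sum_range_le => k km _; have := ler_wpM2l (ed_c ed km) (Hj k km).
      move=> /le_trans; apply; rewrite mulrDr lerD2l.
      by case: ifP; rewrite ?mulr0 // mulrC.
    rewrite big_split /= lerD2l -mulr_sumr -big_mkcondr.
    by have := C0; nra.
  rewrite big_split /= sumr_const_nat subn1 /= -[_ *+ d]mulr_natl lerD2r exchange_big /=.
  by apply: sum_range_le => k km _; rewrite -mulr_sumr ler_wpM2l ?(ed_c ed) // reg.
have szd : sz%:R^-1 * d%:R <= 1 :> R.
  by rewrite mulrC ler_pdivrMr ?ltr0n ?mul1r ?ler_nat; lia.
have g0 : 0 <= 4 * C * g by rewrite !mulr_ge0 ?(ltW C0) //; exact: sum_c_ge0 ed _.
rewrite mulrDr -mulr_suml; apply: lerD.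
  by rewrite le_eqVlt; apply/orP; left; apply/eqP; ring.
have := ler_wpM2r g0 szd; rewrite mul1r; apply: le_trans.
by rewrite -/g le_eqVlt; apply/orP; left; apply/eqP; ring.
Qed.

End Averages.

Lemma sum_nat_window (R : realType) (F : nat -> R) e e' d : (e <= e' <= d)%N ->
  (forall q, (0 < q <= d)%N -> ~~ (e < q <= e')%N -> F q = 0) ->
  \sum_(1 <= q < d.+1) F q = \sum_(e.+1 <= q < e'.+1) F q.
Proof.
move=> ee H; rewrite (big_cat_nat (n := e.+1)) /=; [|lia|lia].
rewrite [X in _ + X = _](big_cat_nat (n := e'.+1)) /=; [|lia|lia].
rewrite [X in X + _]big_nat [X in X + _]big1 ?add0r; last by move=> q qe; apply: H; lia.
by rewrite [X in _ + X]big_nat [X in _ + X]big1 ?addr0 // => q qe; apply: H; lia.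
Qed.

Section TypeOne.
Variables (R : realType) (s : nat -> R -> R) (L1 L2 L3 : set nat).
Variable sigma : seq {poly R} -> nat.
Notation W := (W s L1 sigma).
Variables (C eps : R) (w m : nat) (x : nat -> {poly R}) (c : nat -> R) (nk : nat -> nat).
Hypothesis ed : exact_data s L1 sigma C eps w m x c nk.

Notation p k := (minsupp (x k)).
Notation r k := (maxsupp (x k)).
Notation small := (small m x).
Notation spread_average := (spread_average C m x c).
Let C0 : 0 < C := ed_C0 ed.

(** The indices where an average starts have small mass by [mass_starts]; the small
    sets of all the averages together have small mass by [mass_comp]. *)
Lemma tail_estimate avg n d a sz (s0 : R) A B :
  (n.+2 <= w)%N -> average_family avg n d a sz ->
  (forall q, (0 < q <= d)%N -> spread_average (sz q) (a q)) ->
  0 < s0 -> (forall q, (0 < q <= d)%N -> s0 <= (sz q)%:R) ->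
  W (average_sum n d a) ->
  \sum_(1 <= k < m.+1) c k * `|act (average_sum n d a) (restr A B (x k))|
  <= 2 * C * eps + (4 * C / s0 + 4 * C * eps).
Proof.
move=> nw [_ bl ST _ _] Hsp s00 s0sz WT; set T := average_sum _ _ _ in WT *; pose M := minsupps d a.
have /blockP[bl1 bl2] := bl.
pose bad k := has (fun t => p k <= t <= r k)%N M.
rewrite (bigID bad) /=; apply: lerD.
  have : C * \sum_(1 <= k < m.+1 | bad k) c k <= C * (2 * eps).
    by rewrite ler_wpM2l ?(ltW C0) //; apply: (mass_starts ed _ ST); lia.
  rewrite (_ : 2 * C * eps = C * (2 * eps)); last by ring.
  apply: le_trans; rewrite mulr_sumr; apply: sum_range_le => k km _.
  by rewrite mulrC ler_wpM2r ?(ed_c ed) //; exact: (ed_normE ed).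
pose I q k := ~~ bad k && has (fun t => t < p k)%N M && (below M (p k) == minsupp (a q)).
have Iq q q' k : (0 < q <= d)%N -> (0 < q' <= d)%N -> I q k -> I q' k -> q = q'.
  move=> qd q'd /andP[_ /eqP E1] /andP[_ /eqP E2]; rewrite E1 in E2.
  have [? nq] := bl1 _ qd; have [? nq'] := bl1 _ q'd.
  have := min_le_maxsupp nq; have := min_le_maxsupp nq'.
  case: (ltngtP q q') => // qq.
    by have := bl2 q q' ltac:(lia) ltac:(lia); lia.
  by have := bl2 q' q ltac:(lia) ltac:(lia); lia.
have hit q k : (0 < q <= d)%N -> (0 < k <= m)%N -> ~~ bad k ->
    act (a q) (restr A B (x k)) != 0 -> I q k.
  move=> qd km nb aq; have [? nq] := bl1 _ qd.
  have tM : minsupp (a q) \in M by apply/minsuppsP; exists q.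
  have Hq : (minsupp (a q) <= r k)%N && (p k <= maxsupp (a q))%N.
    apply: contraR aq => H; rewrite act_restr_apart // orbC; move: H.
    by rewrite negb_and -!ltnNge.
  have tp : (minsupp (a q) < p k)%N.
    rewrite ltnNge; apply: contra nb => ptq; apply/hasP; exists (minsupp (a q)) => //.
    by rewrite ptq; case/andP: Hq.
  rewrite /I nb /=; apply/andP; split; first by apply/hasP; exists (minsupp (a q)).
  have [b1 b2 b3] := belowP tM tp; rewrite eqn_leq b3 // andbT.
  have /minsuppsP[j jd E] := b1; rewrite E in b2 b3 *; rewrite leqNgt; apply/negP => aqj.
  have qj : (q < j)%N.
    rewrite ltnNge leq_eqVlt; apply/negP => /orP[/eqP jq|jq]; first by rewrite jq ltnn in aqj.
    have [_ nj] := bl1 _ jd; have mj := min_le_maxsupp nj.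
    have j0 : (0 < j)%N by case/andP: jd.
    have jqd : (j < q <= d)%N by rewrite jq; case/andP: qd.
    by have := leq_trans (bl2 j q j0 jqd) (ltnW aqj); rewrite ltnNge mj.
  have q0 : (0 < q)%N by case/andP: qd.
  have qjd : (q < j <= d)%N by rewrite qj; case/andP: jd.
  have := ltn_trans b2 (leq_ltn_trans (proj2 (andP Hq)) (bl2 q j q0 qjd)).
  by rewrite ltnn.
have point k : (0 < k <= m)%N -> ~~ bad k ->
    `|act T (restr A B (x k))| <=
    \sum_(1 <= q < d.+1) (if I q k then `|act (a q) (restr A B (x k))| else 0).
  move=> km nb; rewrite actZl act_suml normrM ger0_norm ?pow2_ge0 //.
  apply: (@le_trans _ _ `|\sum_(1 <= q < d.+1) act (a q) (restr A B (x k))|).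
    by rewrite ler_piMl // invf_le1 ?exprn_gt0 // exprn_ege1 // ler1n.
  apply: le_trans (ler_norm_sum _ _ _) _; rewrite big_nat [leRHS]big_nat; apply: ler_sum => q qd.
  have [aq|aq] := eqVneq (act (a q) (restr A B (x k))) 0.
    by rewrite aq normr0 if_same.
  by rewrite hit //; lia.
apply: (@le_trans _ _ (\sum_(1 <= q < d.+1) \sum_(1 <= k < m.+1 | I q k)
    c k * `|act (a q) (restr A B (x k))|)).
  rewrite [leRHS](eq_bigr (fun q => \sum_(1 <= k < m.+1) (if I q k then c k * `|act (a q) (restr A B (x k))| else 0)));
    last by move=> q _; rewrite big_mkcond.
  rewrite [leRHS]exchange_big /= big_mkcond; apply: sum_range_le => k km _.
  have [nb|b] := boolP (~~ bad k); last first.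
    apply: sumr_ge0 => q _; case: ifP => // _.
    by rewrite mulr_ge0 ?(ed_c ed).
  have := ler_wpM2l (ed_c ed km) (point k km nb) => /le_trans; apply.
  by rewrite mulr_sumr; apply: ler_sum => q _; case: ifP; rewrite ?mulr0.
have /choice[G HG] q : exists G : pred nat, (0 < q <= d)%N ->
  [/\ forall k, G k -> I q k, small G
    & \sum_(1 <= k < m.+1 | I q k) c k * `|act (a q) (restr A B (x k))|
      <= 4 * C / (sz q)%:R * (\sum_(1 <= k < m.+1 | I q k) c k)
         + 4 * C * \sum_(1 <= k < m.+1 | G k) c k].
  have [qd|_] := boolP (0 < q <= d)%N; last by exists pred0.
  by have [G HG] := Hsp q qd (I q) A B; exists G.
apply: (@le_trans _ _ (\sum_(1 <= q < d.+1)
  (4 * C / s0 * (\sum_(1 <= k < m.+1 | I q k) c k) + 4 * C * \sum_(1 <= k < m.+1 | G q k) c k))).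
  rewrite big_nat [leRHS]big_nat; apply: ler_sum => q qd; have qr : (0 < q <= d)%N by lia.
  have [_ _ /le_trans] := HG q qr; apply; rewrite lerD2r ler_wpM2r ?(sum_c_ge0 ed) //.
  rewrite ler_wpM2l ?mulr_ge0 ?(ltW C0) // lef_pV2 ?posrE ?s0sz //.
  by apply: lt_le_trans s00 (s0sz q qr).
(* the index sets of different averages are disjoint *)
have disj (P : nat -> pred nat) (Q : pred nat) :
    (forall q k, (0 < q <= d)%N -> P q k -> I q k) ->
    (forall q k, (0 < q <= d)%N -> P q k -> Q k) ->
    \sum_(1 <= q < d.+1) \sum_(1 <= k < m.+1 | P q k) c k <= \sum_(1 <= k < m.+1 | Q k) c k.
  move=> PI PQ.
  rewrite [leLHS](eq_bigr (fun q => \sum_(1 <= k < m.+1) (if P q k then c k else 0)));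
    last by move=> q _; rewrite big_mkcond.
  rewrite [leLHS]exchange_big [leRHS]big_mkcond /=; apply: sum_range_le => k km _.
  have ck := ed_c ed km; have [Qk|nQk] := boolP (Q k); last first.
    rewrite big_nat big1 // => q qd; case: ifP => // Pqk.
    by have := PQ q k ltac:(lia) Pqk; rewrite (negPf nQk).
  apply: le_trans (ler_norm _) _; apply: sum_at_most_one; rewrite ?iota_uniq //.
    by move=> q _ _; case: ifP => _; rewrite ?normr0 // ger0_norm.
  move=> q q'; rewrite !mem_index_iota => qd q'd _ _.
  case: ifP => [Pq|_]; last by rewrite eqxx.
  case: ifP => [Pq'|_]; last by rewrite eqxx.
  by move=> _ _; apply: (@Iq q q' k); try apply: PI => //; lia.
rewrite big_split /= -!mulr_sumr; apply: lerD.
  have : \sum_(1 <= q < d.+1) \sum_(1 <= k < m.+1 | I q k) c k <= 1.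
    by rewrite -(ed_sum ed); apply: (disj I xpredT).
  move=> H; have := ler_wpM2l (_ : 0 <= 4 * C / s0) H; rewrite mulr1; apply.
  by rewrite !mulr_ge0 ?(ltW C0) // invr_ge0 ltW.
rewrite ler_wpM2l ?mulr_ge0 ?(ltW C0) //.
pose GG k := has (fun q => G q k) (iota 1 d).
have GGP k : GG k -> exists2 q, (0 < q <= d)%N & G q k.
  by move=> /hasP[q]; rewrite mem_iota => qd Gq; exists q => //; lia.
apply: (@le_trans _ _ (\sum_(1 <= k < m.+1 | GG k) c k)).
  apply: disj => q k qd Gq; first by have [H _ _] := HG q qd; exact: H.
  by apply/hasP; exists q => //; rewrite mem_iota; lia.
apply: (mass_comp ed nw ST).
  move=> k km /GGP[q qd Gq]; have [H _ _] := HG q qd.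
  by have := H _ Gq; rewrite /I => /andP[/andP[_ /hasP]].
move=> t /minsuppsP[q qd ->] k km /andP[/GGP[q' q'd Gq'] E].
have [GI sG _] := HG q qd; have [GI' _ _] := HG q' q'd.
have Iqk k' : G q k' -> below M (p k') == minsupp (a q) by move=> /GI/andP[].
have uniqq k' q'' : (0 < q'' <= d)%N -> G q'' k' -> below M (p k') == minsupp (a q) -> G q k'.
  move=> q''d Gq'' E'; have [H _ _] := HG q'' q''d.
  by rewrite (@Iq q q'' k') //; [move: (H _ Gq''); rewrite /I E' => /andP[-> _]|exact: H].
apply: leq_trans (sG k km (uniqq _ _ q'd Gq' E)).
apply/fsubset_leq_card/fsubsetP => t' /psetP[k' [k'm /andP[/GGP[q'' q''d Gq''] E'] ->]].
by apply/psetP; exists k'; split=> //; exact: uniqq q''d Gq'' E'.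
Qed.

(** A functional of type I of weight [n >= w - 1] is [2 ^- (w - 1)] times a sum
    of an [S_(w-1)]-admissible family of functionals of [W], by [schreier_split];
    an [x k] that meets only one of them contributes at most [2 ^- (w - 1) * C],
    and the others have small mass by [mass_starts]. *)
Lemma group_estimate (avg : nat -> {poly R} -> Prop) n h A B :
  (forall k a, avg k a -> W a) -> (forall n h, schreier_sum avg n h -> W h) ->
  schreier_sum avg n h -> (w <= n.+1)%N ->
  \sum_(1 <= k < m.+1) c k * `|act h (restr A B (x k))|
  <= 2 * C * eps + 2 ^- w.-1 * C * \sum_(1 <= k < m.+1 | restr A B (x k) != 0) c k.
Proof.
move=> avW sumW Hh nw; have Wh := sumW _ _ Hh.
have /schreier_sumP[d [a [sz [AF hE]]]] := Hh; have [n0 bl ST _ Ha] := AF.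
have /blockP[bl1 bl2] := bl; have w10 := ed_w ed.
have rn : (w.-1 <= n)%N by lia.
have [B0 [SB sB _ HB]] := schreier_split rn ST.
pose bad k := has (fun t => p k <= t <= r k)%N B0.
rewrite (bigID bad) /=; apply: lerD.
  have : C * \sum_(1 <= k < m.+1 | bad k) c k <= C * (2 * eps).
    by rewrite ler_wpM2l ?(ltW C0) //; apply: (mass_starts ed _ SB); lia.
  rewrite (_ : 2 * C * eps = C * (2 * eps)); last by ring.
  apply: le_trans; rewrite mulr_sumr; apply: sum_range_le => k km _.
  by rewrite mulrC ler_wpM2r ?(ed_c ed) //; exact: (ed_normE ed).
rewrite big_mkcond [X in _ <= _ * X]big_mkcond mulr_sumr; apply: sum_range_le => k km _.
have [->|xk0] := eqVneq (restr A B (x k)) 0; first by rewrite act0r normr0 !mulr0 if_same.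
have ck := ed_c ed km.
case: ifP => [nb|_]; last by rewrite !mulr_ge0 ?pow2_ge0 ?(ltW C0).
rewrite mulrC ler_wpM2r //.
(* the averages a_(e1 + 1), ..., a_e2 are those that meet the range of x_k *)
have [|e1 e1d He1] := @downward_threshold d (fun q => maxsupp (a q) < p k)%N.
  move=> q q' q0 qq; case: (ltngtP q q') => [qq'|qq'|-> //]; last lia.
  have := bl2 q q' q0 ltac:(lia); have := min_le_maxsupp (bl1 q' ltac:(lia)).2; lia.
have [|e2 e2d He2] := @downward_threshold d (fun q => minsupp (a q) <= r k)%N.
  move=> q q' q0 qq; case: (ltngtP q q') => [qq'|qq'|-> //]; last lia.
  have := bl2 q q' q0 ltac:(lia); have := min_le_maxsupp (bl1 q ltac:(lia)).2; lia.
have out q : (0 < q <= d)%N -> ~~ (e1 < q <= e2)%N -> act (a q) (restr A B (x k)) = 0.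
  move=> qd H; apply: act_restr_apart; rewrite He1 // orbC ltnNge He2 //.
  by move: H; rewrite negb_and -leqNgt orbC.
have bd0 : 0 <= 2 ^- w.-1 * C by rewrite mulr_ge0 ?pow2_ge0 ?(ltW C0).
have [e21|e12] := leqP e2 e1.
  rewrite hE actZl act_suml big_nat big1 ?mulr0 ?normr0 // => q qd.
  by apply: out; lia.
pose d' := (e2 - e1)%N; pose a' j := a (e1 + j)%N.
have inG j : (0 < j <= d')%N -> (p k <= maxsupp (a' j))%N && (minsupp (a' j) <= r k)%N.
  move=> jd; rewrite leqNgt He1 ?He2 /d' /a'; move: jd; rewrite /d'; lia.
have GS : schreier (n - w.-1) (minsupps d' a').
  apply: HB.
  - by apply/fset0Pn; exists (minsupp (a' 1%N)); apply/minsuppsP; exists 1%N => //; rewrite /d'; lia.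
  - by move=> t /minsuppsP[j jd ->]; apply/minsuppsP; exists (e1 + j)%N => //; move: jd; rewrite /d'; lia.
  move=> b _ _ bB /minsuppsP[i id ->] /minsuppsP[j jd ->] /andP[ib bj].
  have /minsuppsP[l ld lE] := sB _ bB.
  suff : bad k by rewrite (negPf nb).
  apply/hasP; exists b => //; have /andP[pi ri] := inG i id; have /andP[_ rj] := inG j jd.
  rewrite (leq_trans bj rj) andbT; apply: leq_trans pi _; apply: ltnW; rewrite lE.
  have eid : (0 < e1 + i <= d)%N by move: id; rewrite /d'; lia.
  apply: (bl2 (e1 + i)%N l); first by case/andP: eid.
  rewrite (proj2 (andP ld)) andbT ltnNge leq_eqVlt; apply/negP => /orP[/eqP E|lt].
    by move: ib; rewrite lE E ltnn.
  have := bl2 l (e1 + i)%N ltac:(lia) ltac:(lia); have := min_le_maxsupp (bl1 _ ld).2.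
  by move: ib; rewrite lE /a'; lia.
have hk : act h (restr A B (x k)) =
    2 ^- n * act (\sum_(1 <= j < d'.+1) a' j) (restr A B (x k)).
  rewrite hE actZl; congr (_ * _); rewrite !act_suml.
  rewrite (sum_nat_window (e := e1) (e' := e2)) //; last lia.
  by rewrite -[in LHS](subnKC (ltnW e12)) sum_nat_shift.
have d'0 : (0 < d')%N by rewrite subn_gt0.
have [nr|nr] := posnP (n - w.-1)%N.
  have d'1 : d' = 1%N.
    rewrite nr in GS; have [t _ GE] := GS.
    apply/eqP; rewrite eqn_leq d'0 andbT leqNgt; apply/negP => d'2.
    have m1 : minsupp (a' 1%N) \in minsupps d' a' by apply/minsuppsP; exists 1%N.
    have m2 : minsupp (a' 2%N) \in minsupps d' a' by apply/minsuppsP; exists 2%N.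
    move: m1 m2; rewrite GE !inE => /eqP E1 /eqP E2.
    have := bl2 (e1 + 1)%N (e1 + 2)%N ltac:(lia) ltac:(move: d'2; rewrite /d'; lia).
    have := min_le_maxsupp (bl1 (e1 + 1)%N ltac:(lia)).2.
    by rewrite /a' in E1 E2; rewrite E1 E2; lia.
  have -> : w.-1 = n by lia.
  rewrite hk d'1 big_nat1 normrM ger0_norm ?pow2_ge0 // ler_wpM2l ?pow2_ge0 //.
  by apply: (ed_normE ed _ _ km); apply: (avW _ _ (Ha _ _)); lia.
have ed' : (e1 + d' <= d)%N by rewrite /d'; lia.
have Wh' := sumW _ _ (average_family_sum (average_family_slice AF nr ed' GS)).
have := ed_normE ed A B km Wh'; rewrite actZl normrM ger0_norm ?pow2_ge0 // => H.
rewrite hk normrM ger0_norm ?pow2_ge0 //.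
have -> : 2 ^- n = 2 ^- w.-1 * 2 ^- (n - w.-1) :> R.
  by rewrite -invfM -exprD subnKC.
by rewrite -mulrA ler_wpM2l ?pow2_ge0.
Qed.

End TypeOne.

(** * Bounds for the norming set on an exact vector *)

Lemma sqr_le_exp2 n : (4 <= n)%N -> (n ^ 2 <= 2 ^ n)%N.
Proof.
elim: n => // n IH; rewrite leq_eqVlt => /orP[/eqP <- //|n4].
by have := IH n4; rewrite [(2 ^ n.+1)%N]expnS; nia.
Qed.

Lemma mul100_le_exp2 n : (10 <= n)%N -> (100 * n <= 2 ^ n)%N.
Proof.
elim: n => // n IH; rewrite leq_eqVlt => /orP[/eqP <- //|n4].
by have := IH n4; rewrite [(2 ^ n.+1)%N]expnS; lia.
Qed.

Section HeadTail.
Variables (R : realType).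
Implicit Types (avg : nat -> {poly R} -> Prop) (v : {poly R}).

(** The support of the first average that acts on a vector supported beyond [P]
    reaches [P], so that the later averages have size more than [2 ^ P]. *)
Lemma head_tail avg n d (a : nat -> {poly R}) sz v P A B (M : R) :
  average_family avg n d a sz -> (forall i, (i < P)%N -> v`_i = 0) ->
  0 <= M -> (forall j, (0 < j <= d)%N -> `|act (a j) (restr A B v)| <= M) ->
  `|act (average_sum n d a) (restr A B v)| <= 2 ^- n * M \/
  exists d' a' sz', [/\ average_family avg n d' a' sz',
    forall j, (0 < j <= d')%N -> (2 ^+ P : R) <= (sz' j)%:R
  & `|act (average_sum n d a) (restr A B v)| <=
     2 ^- n * M + `|act (average_sum n d' a') (restr A B v)|].
Proof.
rewrite /average_sum => AF vP M0 HM; have [n0 bl ST vfg Ha] := AF; have /blockP[bl1 bl2] := bl; have [_ vfg2] := vfg.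
have MM : 0 <= 2 ^- n * M by rewrite mulr_ge0 ?pow2_ge0.
have [|e ed' He] := @downward_threshold d (fun j => maxsupp (a j) < P)%N.
  move=> j j' j0 jj; case: (ltngtP j j') => [jj'|jj'|-> //]; last nlia.
  have := bl2 j j' j0 ltac:(nlia); have := min_le_maxsupp (bl1 j' ltac:(nlia)).2; nlia.
have early j : (0 < j <= e)%N -> act (a j) (restr A B v) = 0.
  move=> je; have Hj : (maxsupp (a j) < P)%N by rewrite He; nlia.
  apply: act_eq0 => i /nz_supp ai; rewrite coef_restr vP ?if_same //; nlia.
have [de|ed2] := leqP d e.
  left; rewrite actZl act_suml big_nat big1 ?mulr0 ?normr0 // => j jd.
  by apply: early; nlia.
have split_e : act (2 ^- n *: \sum_(1 <= j < d.+1) a j) (restr A B v) =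
    2 ^- n * act (a e.+1) (restr A B v) +
    act (2 ^- n *: \sum_(1 <= j < (d - e.+1).+1) a (e.+1 + j)%N) (restr A B v).
  rewrite !actZl -mulrDr; congr (_ * _); rewrite !act_suml.
  rewrite (sum_nat_window (e := e) (e' := d)); [|nlia|by move=> j jd je; apply: early; nlia].
  rewrite big_ltn //; congr (_ + _).
  by rewrite -[X in \sum_(_ <= _ < X.+1) _](subnKC ed2) sum_nat_shift.
have head_le : `|2 ^- n * act (a e.+1) (restr A B v)| <= 2 ^- n * M.
  by rewrite normrM ger0_norm ?pow2_ge0 // ler_wpM2l ?pow2_ge0 // HM //; nlia.
pose d' := (d - e.+1)%N; pose a' j := a (e.+1 + j)%N.
have [d1|d1] := posnP d'.
  by left; rewrite split_e -/d' d1 [in X in _ + X]big_geq // scaler0 act0l addr0.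
have ST' : schreier n (minsupps d' a').
  apply: schreier_sub ST _ _.
    by apply/fset0Pn; exists (minsupp (a' 1%N)); apply/minsuppsP; exists 1%N.
  by move=> t /minsuppsP[j jd ->]; apply/minsuppsP; exists (e.+1 + j)%N => //; move: jd; rewrite /d'; nlia.
have edd : (e.+1 + d' <= d)%N by rewrite /d'; nlia.
right; exists d', a', (fun j => sz (e.+1 + j)%N); split.
- exact: average_family_slice AF n0 edd ST'.
- move=> j jd; have [+ _] := vfg2 (e.+1 + j)%N ltac:(nlia).
  rewrite -natrX ler_nat => /ltnW; apply: leq_trans.
  rewrite leq_exp2l // leqNgt He ?addSn /=; nlia.
- by rewrite split_e; apply: le_trans (ler_normD _ _) _; rewrite lerD2r.
Qed.

End HeadTail.

Section Numeric.
Variables (R : realType) (s : nat -> R -> R) (L1 : set nat).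
Variable sigma : seq {poly R} -> nat.
Variables (C eps : R) (w m : nat) (x : nat -> {poly R}) (c : nat -> R) (nk : nat -> nat).
Hypothesis ed : exact_data s L1 sigma C eps w m x c nk.
Notation q := (2 ^- w : R).

Lemma q_gt0 : 0 < q. Proof. by rewrite invr_gt0 exprn_gt0. Qed.

Lemma q_mul : 2 ^+ w * q = 1. Proof. by rewrite divff // expf_neq0 // pnatr_eq0. Qed.

Lemma q_small (v : nat) : (10 <= v)%N -> (2 ^- v : R) <= 1 / 1000 /\ v%:R * (2 ^- v : R) <= 1 / 100.
Proof.
move=> v10; have := mul100_le_exp2 v10; rewrite -(ler_nat R) natrM natrX => H.
have e0 : 0 < 2 ^+ v :> R by rewrite exprn_gt0.
have v10' : (10 : R) <= v%:R by rewrite (ler_nat R 10).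
have key (a e t : R) : 0 < a -> a * e = 1 -> 100 * t <= e -> 10 <= t ->
    a <= 1 / 1000 /\ t * a <= 1 / 100.
  move=> a0 ae te t10; have : 0 <= a * (e - 100 * t) by rewrite mulr_ge0 ?subr_ge0 // ltW.
  by rewrite mulrBr ae; split; nra.
by apply: key H v10'; rewrite ?invr_gt0 // mulVf // gt_eqF.
Qed.

Lemma q_lt : q <= 1 / 1000. Proof. by have [] := q_small (ed_w ed). Qed.

Lemma wq_lt : w%:R * q <= 1 / 100. Proof. by have [] := q_small (ed_w ed). Qed.

Lemma eps_small : 2 ^+ w * (C * eps) <= q ^+ 2 / 36.
Proof.
have C0 := ed_C0 ed; have q0 := q_gt0.
have /andP[_] := ed_eps ed; rewrite mulnC exprM.
have e0 : 0 < 2 ^+ w :> R by rewrite exprn_gt0.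
rewrite -[_^-1]mul1r ltr_pdivlMr; last by rewrite !mulr_gt0 ?exprn_gt0.
move=> /ltW H; rewrite ler_pdivlMr // exprVn -[leRHS]mul1r ler_pdivlMr ?exprn_gt0 //.
by apply: le_trans H; rewrite le_eqVlt; apply/orP; left; apply/eqP; ring.
Qed.

Lemma min_large : 2 ^+ w * (4 * C / 2 ^+ minsupp (x 1%N)) <= q ^+ 2 / 36.
Proof.
have C1 := ed_C ed; have q0 := q_gt0; have q1 := q_lt; have qm := q_mul.
have e0 : 0 < 2 ^+ w :> R by rewrite exprn_gt0.
have -> : q ^+ 2 / 36 = (36 * (2 ^+ w) ^+ 2)^-1.
  by rewrite exprVn [RHS]invfM mulrC.
have := ed_min ed; rewrite mulnC exprM; set P : R := 2 ^+ w in qm e0 *; set p1 := minsupp _ => H.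
have P1000 : 1000 <= P by nra.
have p4 : (4 <= p1)%N by rewrite -(ler_nat R); nra.
have := sqr_le_exp2 p4; rewrite -(ler_nat R) !natrX => H2.
have p0 : 0 < 2 ^+ p1 :> R by rewrite exprn_gt0.
have H3 : 64 * C * P ^+ 4 <= 2 ^+ p1.
  apply: le_trans H2; apply: (@le_trans _ _ ((8 * C * P ^+ 2) ^+ 2)).
    rewrite (_ : (8 * C * P ^+ 2) ^+ 2 = 64 * C * P ^+ 4 * C); last by ring.
    by rewrite ler_peMr // !mulr_ge0 ?exprn_ge0 //; lra.
  by rewrite ler_pXn2r // ?nnegrE ?mulr_ge0 ?exprn_ge0 //; lra.
rewrite mulrA ler_pdivrMr // [leRHS]mulrC ler_pdivlMr; last by rewrite mulr_gt0 ?exprn_gt0.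
apply: le_trans H3.
rewrite (_ : P * (4 * C) * (36 * P ^+ 2) = 144 * C * P ^+ 3); last by ring.
rewrite (_ : 64 * C * P ^+ 4 = 64 * P * (C * P ^+ 3)); last by ring.
rewrite -mulrA ler_wpM2r ?mulr_ge0 ?exprn_ge0 //; lra.
Qed.

Lemma nk_large k : (0 < k <= m)%N -> (2 ^- nk k : R) <= q ^+ 3.
Proof.
move=> km; have := ed_nk1 ed; have := ed_nk_mono ed (k := 1) (k' := k) isT ltac:(lia).
have w10 := ed_w ed; have := ltn_expl (2 * w) (ltnSn 1); have := @sqr_le_exp2 (2 * w) ltac:(lia).
move=> H1 _ H2 H3; have H4 : (w * 3 <= nk k)%N by nia.
rewrite exprVn -exprM lef_pV2 ?posrE ?exprn_gt0 //.
by rewrite ler_weXn2l // ler1n.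
Qed.

End Numeric.

Section ExactEstimates.
Variables (R : realType) (s : nat -> R -> R) (L1 L2 L3 : set nat).
Variable sigma : seq {poly R} -> nat.
Hypotheses (hs : dense_in_sphere s) (hL : coding_sets R L1 L2 L3).
Hypothesis hsigma : coding_function L2 sigma.
Notation W := (W s L1 sigma).
Variables (C eps : R) (w m : nat) (x : nat -> {poly R}) (c : nat -> R) (nk : nat -> nat).
Hypothesis ed : exact_data s L1 sigma C eps w m x c nk.

Notation p k := (minsupp (x k)).
Notation r k := (maxsupp (x k)).
Notation q := (2 ^- w : R).
Notation tau := (tau C nk).
Let C0 : 0 < C := ed_C0 ed.
Let C1 : 1 <= C := ed_C ed.
Let q0 : 0 < q := q_gt0 R w.
Let q1 : q <= 1 / 1000 := q_lt ed.
Let P0 : 0 < 2 ^+ w :> R. Proof. by rewrite exprn_gt0. Qed.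

Definition exact_sum : {poly R} := 2 ^+ w *: \sum_(1 <= k < m.+1) c k *: x k.
Notation X := exact_sum.

Lemma restr_exact A B :
  restr A B X = 2 ^+ w *: \sum_(1 <= k < m.+1) c k *: restr A B (x k).
Proof. by rewrite restrZ restr_sum; congr (_ *: _); apply: eq_bigr => k _; rewrite restrZ. Qed.

Lemma act_exact_le h A B :
  `|act h (restr A B X)| <= 2 ^+ w * \sum_(1 <= k < m.+1) c k * `|act h (restr A B (x k))|.
Proof.
rewrite restr_exact actZr normrM ger0_norm ?(ltW P0) // ler_wpM2l ?(ltW P0) //.
rewrite act_sumr; apply: le_trans (ler_norm_sum _ _ _) _; apply: sum_range_le => k km _.
by rewrite actZr normrM ger0_norm ?(ed_c ed).
Qed.

Definition mass A B : R := \sum_(1 <= k < m.+1 | (A <= p k <= B)%N) c k.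

Lemma mass_ge0 A B : 0 <= mass A B. Proof. exact: (sum_c_ge0 ed). Qed.

Lemma mass_mono A B A' B' : (A' <= A)%N -> (B <= B')%N -> mass A B <= mass A' B'.
Proof. by move=> AA BB; apply: (sum_c_mono ed) => k _; nlia. Qed.

Lemma mass_le1 A B : mass A B <= 1. Proof. exact: (sum_c_le1 ed). Qed.

Lemma mass_disjoint d (h : nat -> {poly R}) A B : block (fam h d) ->
  \sum_(1 <= j < d.+1) mass (maxn A (minsupp (h j))) (minn B (maxsupp (h j))) <= 1.
Proof.
move=> /blockP[_ bl]; rewrite -(ed_sum ed) /mass.
rewrite [leLHS](eq_bigr (fun j => \sum_(1 <= k < m.+1)
   (if (maxn A (minsupp (h j)) <= p k <= minn B (maxsupp (h j)))%N then c k else 0)));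
  last by move=> j _; rewrite big_mkcond.
rewrite exchange_big /=; apply: sum_range_le => k km _; apply: le_trans (ler_norm _) _.
have ck := ed_c ed km.
apply: sum_at_most_one; rewrite ?iota_uniq //.
  by move=> j _ _; case: ifP => _; rewrite ?normr0 // ger0_norm.
move=> i j; rewrite !mem_index_iota => id jd _ _.
case: ifP => [Hi _|_]; last by rewrite eqxx.
case: ifP => [Hj _|_]; last by rewrite eqxx.
case: (ltngtP i j) => // ij.
  by have := bl i j ltac:(nlia) ltac:(nlia); nlia.
by have := bl j i ltac:(nlia) ltac:(nlia); nlia.
Qed.

Lemma mass_met A B :
  \sum_(1 <= k < m.+1 | restr A B (x k) != 0) c k <= mass A B + eps.
Proof.
rewrite (bigID (fun k => A <= p k)%N) /=; apply: lerD.
  apply: (sum_c_mono ed) => k km /andP[nz ->] /=.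
  rewrite leqNgt; apply: contra nz => H; rewrite restr_eq0 // H orbT //.
apply: le_trans (ler_norm _) _.
rewrite big_mkcond; apply: sum_at_most_one; rewrite ?iota_uniq ?(ltW (ed_eps0 ed)) //.
  move=> k; rewrite mem_index_iota => km _; case: ifP => _; last by rewrite normr0 ltW ?(ed_eps0 ed).
  by rewrite ger0_norm ?(ed_c ed) ?(c_le_eps ed) //; nlia.
move=> i j; rewrite !mem_index_iota => im jm _ _.
case: ifP => [Hi _|_]; last by rewrite eqxx.
case: ifP => [Hj _|_]; last by rewrite eqxx.
have cut k : (0 < k <= m)%N -> (restr A B (x k) != 0) && ~~ (A <= p k)%N ->
    (p k <= A <= r k)%N.
  move=> km /andP[nz]; rewrite -ltnNge => pA; rewrite ltnW //= leqNgt.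
  by apply: contra nz => H; rewrite restr_eq0 // H.
by apply: (ed_ran_inj ed) (cut _ _ Hi) (cut _ _ Hj); nlia.
Qed.

(** The first average acting on the vector is estimated by [M], the later ones by
    [tail_estimate]; the errors are at most [q ^+ 2] even after multiplication by
    [2 ^+ w], because [eps] and [2 ^- minsupp (x 1)] are that small. *)
Lemma typeI_head avg n d (a : nat -> {poly R}) sz A B (M : R) :
  (forall k b, avg k b -> spread_average C m x c k b) ->
  (forall n h, schreier_sum avg n h -> W h) ->
  (n.+2 <= w)%N -> average_family avg n d a sz ->
  0 <= M -> (forall j, (0 < j <= d)%N -> `|act (a j) (restr A B X)| <= M) ->
  `|act (average_sum n d a) (restr A B X)| <= 2 ^- n * M + q ^+ 2.
Proof.
move=> avS sumW nw AF M0 HM.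
have supp i : (i < p 1)%N -> X`_i = 0.
  move=> ip; rewrite coefZ coef_sum big_nat big1 ?mulr0 // => k km.
  rewrite coefZ lt_minsupp ?mulr0 //; apply: leq_trans ip _.
  case: (ltngtP 1 k) => [k1|k1|<- //]; last nlia.
  by have := ed_plt ed (k := 1) (k' := k) isT ltac:(nlia); nlia.
have [/le_trans|[d' [a' [sz' [AF' Hsz /le_trans]]]]] := head_tail AF supp M0 HM; apply.
  by rewrite lerDl exprn_ge0 // ltW.
have s00 : 0 < (2 ^+ p 1 : R) by rewrite exprn_gt0.
have [_ _ _ _ Ha'] := AF'.
have Ht := tail_estimate ed A B nw AF' (fun j jd => avS _ _ (Ha' j jd)) s00 Hsz
  (sumW _ _ (average_family_sum AF')).
rewrite lerD2l; apply: le_trans (act_exact_le _ _ _) _.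
apply: le_trans (ler_wpM2l (ltW P0) Ht) _.
have E1 := eps_small ed; have E2 := min_large ed.
have : 0 <= q ^+ 2 by rewrite exprn_ge0 // ltW.
rewrite (_ : 2 ^+ w * _ = 6 * (2 ^+ w * (C * eps)) + 2 ^+ w * (4 * C / 2 ^+ p 1)); last by ring.
lra.
Qed.

(** The factor [2 ^+ w] of the exact vector is cancelled by the factor
    [2 ^- (w - 1)] from [group_estimate]. *)
Lemma typeI_heavy avg n h A B :
  (forall k b, avg k b -> W b) -> (forall n h, schreier_sum avg n h -> W h) ->
  schreier_sum avg n h -> (w <= n.+1)%N ->
  `|act h (restr A B X)| <= 2 * C * mass A B + q ^+ 2.
Proof.
move=> avW sumW Hh wn; apply: le_trans (act_exact_le _ _ _) _.
apply: le_trans (ler_wpM2l (ltW P0) (group_estimate ed A B avW sumW Hh wn)) _.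
have E1 := eps_small ed; have mm := mass_met A B; have e0 := ed_eps0 ed.
have qE : 2 ^- w.-1 = 2 * q.
  have -> : w = w.-1.+1 by have := ed_w ed; nlia.
  by rewrite exprS invfM mulrA divff ?mul1r // pnatr_eq0.
rewrite qE; set S := \sum_(_ <= _ < _ | _) _ in mm *.
have qm := q_mul R w.
rewrite (_ : 2 ^+ w * (2 * C * eps + 2 * q * C * S) = 2 * (2 ^+ w * (C * eps)) + (2 ^+ w * q) * (2 * C * S)); last by ring.
rewrite qm mul1r; have : 2 * C * S <= 2 * C * (mass A B + eps) by rewrite ler_wpM2l // mulr_ge0 // ltW.
have : C * eps <= 2 ^+ w * (C * eps).
  by rewrite ler_peMl ?exprn_ege1 ?ler1n // mulr_ge0 // ltW.
have : 0 <= q ^+ 2 by rewrite exprn_ge0 // ltW.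
lra.
Qed.

(** The induction hypothesis on the functionals of [W]. The mass of the interval
    makes the bounds for successive functionals add up. *)
Definition exact_bounded : set {poly R} := [set h | forall A B,
  `|act h (restr A B X)| <= 5 * C * mass A B + C * q].

Lemma bound_ge0 A B : 0 <= 5 * C * mass A B + C * q.
Proof. by rewrite addr_ge0 ?mulr_ge0 ?mass_ge0 ?(ltW C0) ?(ltW q0). Qed.

(** A bound for the piece of weight [v] of a type II functional. *)
Definition phi A B v : R :=
  if (v < w.-1)%N then 2 ^- v * (5 * C * mass A B + C * q) + q ^+ 2
  else 2 ^+ w * \sum_(1 <= k < m.+1 | restr A B (x k) != 0) c k * tau k v.

Lemma high_sum A B N (V : seq nat) : uniq V ->
  2 ^+ w * \sum_(1 <= k < m.+1 | restr A B (x k) != 0)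
     c k * \sum_(v <- V | (N <= v)%N) tau k v <=
  2 ^+ w * (2 * C * 2 ^- N + 2 * C * q ^+ 3) * (mass A B + eps).
Proof.
move=> uV; rewrite -mulrA ler_wpM2l ?(ltW P0) //.
set M := _ + 2 * C * q ^+ 3; have M0 : 0 <= M.
  by rewrite addr_ge0 ?mulr_ge0 ?pow2_ge0 ?exprn_ge0 ?(ltW C0) ?(ltW q0).
apply: (@le_trans _ _ (M * \sum_(1 <= k < m.+1 | restr A B (x k) != 0) c k)); last first.
  by rewrite ler_wpM2l // mass_met.
rewrite mulr_sumr; apply: sum_range_le => k km _; rewrite [leRHS]mulrC.
rewrite ler_wpM2l ?(ed_c ed) //; apply: le_trans (tau_sum ed k N uV) _.
by rewrite lerD2l ler_wpM2l ?(nk_large ed) // mulr_ge0 // ltW.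
Qed.

Lemma phi_high A B (V : seq nat) :
  \sum_(v <- V | (w.-1 <= v)%N) phi A B v =
  2 ^+ w * \sum_(1 <= k < m.+1 | restr A B (x k) != 0)
     c k * \sum_(v <- V | (w.-1 <= v)%N) tau k v.
Proof.
under [in RHS]eq_bigr => k _ do rewrite mulr_sumr.
rewrite exchange_big mulr_sumr /=; apply: eq_bigr => v wv.
by rewrite /phi ltnNge wv.
Qed.

(** All weights are distinct and at least 10: the low ones add up to a small
    fraction of the bound for a single functional, the high ones to little more
    than [4 * C * mass A B]. *)
Lemma phi_sum A B (V : seq nat) : uniq V -> (forall v, v \in V -> (10 <= v)%N) ->
  \sum_(v <- V) phi A B v <= 5 * C * mass A B + C * q / 2.
Proof.
move=> uV V10; rewrite (bigID (fun v => v < w.-1)%N) /=.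
set Z := 5 * C * mass A B + C * q.
have Z0 : 0 <= Z by exact: bound_ge0.
have lowle : \sum_(v <- V | (v < w.-1)%N) phi A B v <= Z / 500 + w%:R * q ^+ 2.
  rewrite (eq_bigr (fun v => 2 ^- v * Z + q ^+ 2)); last by move=> v; rewrite /phi => ->.
  rewrite big_split /= -mulr_suml; apply: lerD.
    rewrite mulrC ler_wpM2l // -big_filter; apply: (@le_trans _ _ (2 * 2 ^- 10)).
      apply: sum_geom_le; first exact: filter_uniq.
      by move=> v; rewrite mem_filter => /andP[_ /V10].
    have [] := @q_small R 10 isT; lra.
  rewrite -big_filter big_const_seq count_predT iter_addr_0 -[_ ^+ 2 *+ _]mulr_natl ler_wpM2r ?exprn_ge0 ?(ltW q0) // ler_nat.
  apply: (@leq_trans (size (iota 0 w))); last by rewrite size_iota.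
  apply: uniq_leq_size; first exact: filter_uniq.
  by move=> v; rewrite mem_filter mem_iota => /andP[+ _]; nlia.
have highle : \sum_(v <- V | ~~ (v < w.-1)%N) phi A B v <=
    2 ^+ w * (2 * C * 2 ^- w.-1 + 2 * C * q ^+ 3) * (mass A B + eps).
  apply: le_trans (high_sum A B w.-1 uV).
  rewrite (eq_bigl (fun v => w.-1 <= v)%N); last by move=> v; rewrite -leqNgt.
  by rewrite phi_high.
apply: le_trans (lerD lowle highle) _.
have qE : 2 ^- w.-1 = 2 * q.
  have -> : w = w.-1.+1 by have := ed_w ed; nlia.
  by rewrite exprS invfM mulrA divff ?mul1r // pnatr_eq0.
rewrite qE; have qm := q_mul R w; have wq := wq_lt ed.
rewrite (_ : 2 ^+ w * _ * _ = (2 ^+ w * q) * (4 * C + 2 * C * q ^+ 2) * (mass A B + eps)); last by ring.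
rewrite qm mul1r.
have E1 := eps_small ed; have M0 := mass_ge0 A B.
have Ce : C * eps <= q ^+ 2 / 36.
  apply: le_trans E1; rewrite ler_peMl ?exprn_ege1 ?ler1n // mulr_ge0 ?(ltW C0) //.
  exact: ltW (ed_eps0 ed).
have q2 : q ^+ 2 <= q / 1000 by have := ler_wpM2l (ltW q0) q1; rewrite expr2; lra.
have e0 := ltW (ed_eps0 ed).
have CM : 0 <= C * mass A B by rewrite mulr_ge0 // ltW.
have CE : 0 <= C * eps by rewrite mulr_ge0 // ltW.
have q20 : 0 <= q ^+ 2 by rewrite exprn_ge0 // ltW.
have wq2 : w%:R * q ^+ 2 <= q / 100.
  by have := ler_wpM2l (ltW q0) wq; rewrite expr2; lra.
have qC : q <= C * q by rewrite ler_peMl // ltW.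
rewrite /Z (_ : (4 * C + 2 * C * q ^+ 2) * (mass A B + eps) =
  (4 + 2 * q ^+ 2) * (C * mass A B) + (4 + 2 * q ^+ 2) * (C * eps)); last by ring.
have q1' := q1.
have four : 4 + 2 * q ^+ 2 <= 4 + 1 / 100 by lra.
have F1 : (4 + 2 * q ^+ 2) * (C * mass A B) <= (4 + 1 / 100) * (C * mass A B).
  by rewrite ler_wpM2r.
have F2 : (4 + 2 * q ^+ 2) * (C * eps) <= (4 + 1 / 100) * (C * eps).
  by rewrite ler_wpM2r.
rewrite -!mulrA; lra.
Qed.

Lemma mass_clip A B a b : mass (maxn a A) (minn b B) <= mass A B.
Proof. by apply: mass_mono; [exact: leq_maxr|exact: geq_minr]. Qed.

Lemma typeII_exact G S h A B : G `<=` W -> G `<=` exact_bounded -> W h ->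
  typeII s L1 sigma G S h ->
  exists V, [/\ uniq V, forall v, v \in V -> S v /\ (10 <= v)%N
    & `|act h (restr A B X)| <= \sum_(v <- V) phi A B v + q ^+ 2 / 9].
Proof.
move=> GW GP Wh Th; have w10 := ed_w ed.
have wn : (w.-1 <= nk 1)%N.
  have := ed_nk1 ed; have := ltn_expl (2 * w) (ltnSn 1); nlia.
have [V [hl [hh [Q [t0 [[uV V10] hE low Qt high]]]]]] :=
  typeII_split hs hL hsigma ed GW Wh Th wn.
exists V; split=> //; rewrite hE actDl; apply: le_trans (ler_normD _ _) _.
rewrite (bigID (fun v => v < w.-1)%N) /= -addrA; apply: lerD.
  apply: low => v f a b vV vw Gf Tf; rewrite /phi vw restr_restr.
  have [h' [sg [a' [b' [Hh' ->]]]]] := Tf.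
  rewrite actZl normrMsign act_restr restr_restr.
  set A' := maxn _ _; set B' := minn _ _.
  have /schreier_sumP[d [al [sz [AF ->]]]] := Hh'; have [_ _ _ _ Ha] := AF.
  have mclip : mass A' B' <= mass A B.
    by apply: mass_mono; rewrite /A' /B' ?leq_max ?geq_min leqnn ?orbT.
  have HM j : (0 < j <= d)%N -> `|act (al j) (restr A' B' X)| <= 5 * C * mass A' B' + C * q.
    by move=> jd; have [/GP + _] := Ha j jd; apply.
  have vw' : (v.+2 <= w)%N by nlia.
  have := typeI_head (alpha_spread ed) (@schreier_sum_alpha_W _ s L1 sigma) vw'
    (average_family_mono (fun k' b => @alpha_average_mono _ _ _ k' b GW) AF) (bound_ge0 A' B') HM.
  move=> /le_trans; apply.
  by rewrite lerD2r ler_wpM2l ?pow2_ge0 // lerD2r ler_wpM2l // mulr_ge0 // ltW.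
rewrite (eq_bigl (fun v => w.-1 <= v)%N); last by move=> v; rewrite -leqNgt.
apply: le_trans (act_exact_le _ _ _) _.
apply: (@le_trans _ _ (2 ^+ w * (\sum_(1 <= k < m.+1)
   (if restr A B (x k) != 0 then c k * \sum_(v <- V | (w.-1 <= v)%N) tau k v else 0) +
   \sum_(1 <= k < m.+1) (if Q k && (t0 <= r k)%N then 2 * C * c k else 0)))).
  rewrite ler_wpM2l ?(ltW P0) // -big_split /=; apply: sum_range_le => k km _.
  have ck := ed_c ed km.
  have [->|nz] /= := eqVneq (restr A B (x k)) 0.
    by rewrite act0r normr0 mulr0 add0r; case: ifP => // _; rewrite !mulr_ge0 // ltW.
  have := ler_wpM2l ck (high k A B km); move=> /le_trans; apply.
  by rewrite mulrDr lerD2l; case: ifP; rewrite ?mulr0 // mulrC.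
rewrite mulrDr; apply: lerD.
  by rewrite phi_high -big_mkcond.
rewrite -big_mkcond -mulr_sumr /=.
have := mass_exceptional ed Qt; have := eps_small ed => E1 E2.
have : 2 * C * (\sum_(1 <= k < m.+1 | Q k && (t0 <= r k)%N) c k) <= 2 * C * (2 * eps).
  by rewrite ler_wpM2l // mulr_ge0 // ltW.
move=> H; apply: le_trans (ler_wpM2l (ltW P0) H) _.
by rewrite (_ : 2 ^+ w * _ = 4 * (2 ^+ w * (C * eps))); [lra|ring].
Qed.

End ExactEstimates.

Section NormOfExact.
Variables (R : realType) (s : nat -> R -> R) (L1 L2 L3 : set nat).
Variable sigma : seq {poly R} -> nat.
Hypotheses (hs : dense_in_sphere s) (hL : coding_sets R L1 L2 L3).
Hypothesis hsigma : coding_function L2 sigma.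
Notation W := (W s L1 sigma).

Lemma typeII_sum_plus G d f g w' F : special_on L1 sigma G d f g w' F ->
  typeII s L1 sigma G [set w' q | q in [set q | q \in F /\
     meets_ran 0 (maxsupp (sum_plus f g F)) (f q + g q)]] (sum_plus f g F).
Proof.
move=> so; left; exists d, f, g, w', F, false, 0%N, (maxsupp (sum_plus f g F)).
by split=> //; rewrite expr0 scale1r restr_id.
Qed.

Lemma typeII_sum_minus G d f g w' F lam : special_on L1 sigma G d f g w' F -> lam_ok s lam F ->
  typeII s L1 sigma G [set w' q | q in [set q | q \in F /\
     meets_ran 0 (maxsupp (sum_minus f g lam F)) (f q - g q)]] (sum_minus f g lam F).
Proof.
move=> so lo; right; exists d, f, g, w', F, lam, false, 0%N, (maxsupp (sum_minus f g lam F)).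
by split=> //; rewrite expr0 scale1r restr_id.
Qed.

Variables (C eps : R) (w m : nat) (x : nat -> {poly R}) (c : nat -> R) (nk : nat -> nat).
Hypothesis ed : exact_data s L1 sigma C eps w m x c nk.

Notation p k := (minsupp (x k)).
Notation r k := (maxsupp (x k)).
Notation q := (2 ^- w : R).
Notation X := (exact_sum w m x c).
Notation mass := (mass m x c).
Let C0 : 0 < C := ed_C0 ed.
Let q0 : 0 < q := q_gt0 R w.

Lemma q_facts : [/\ 0 <= q ^+ 2, q ^+ 2 <= q / 1000, q <= C * q & 0 <= C * q].
Proof.
have q1 := q_lt ed; have C1 := ed_C ed; split.
- by rewrite exprn_ge0 // ltW.
- by have := ler_wpM2l (ltW q0) q1; rewrite expr2; lra.
- by rewrite ler_peMl // ltW.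
- by rewrite mulr_ge0 // ltW.
Qed.

Let bound A B := 5 * C * mass A B + C * q.

Lemma pow2_le_half n : (0 < n)%N -> 2 ^- n <= 2^-1 :> R.
Proof. by move=> n0; rewrite lef_pV2 ?posrE ?exprn_gt0 // ler_eXnr // ler1n. Qed.

Let half_bound n A B : (0 < n)%N -> 2 ^- n * bound A B + q ^+ 2 <= bound A B.
Proof.
move=> n0; have b0 : 0 <= bound A B by exact: (bound_ge0 ed).
have [q20 q2 qC Cq0] := q_facts; have M0 := mass_ge0 ed A B.
have : 2 ^- n * bound A B <= 2^-1 * bound A B by rewrite ler_wpM2r // pow2_le_half.
have : 0 <= C * mass A B by rewrite mulr_ge0 // ltW.
by rewrite /bound -!mulrA; lra.
Qed.

(** Weights of at least [w - 1] are settled by [typeI_heavy] outright. A smaller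
    weight [n] reduces the induction hypothesis by the factor [2 ^- n <= 1 / 2],
    which leaves room for the errors, and the weights of the pieces of a type II
    functional are summable. *)
Lemma exact_bounded_W : W `<=` exact_bounded C w m x c.
Proof.
have [q20 q2 qC Cq0] := q_facts.
have sub G : W `&` G `<=` W by move=> ? [].
have sub2 G : W `&` G `<=` G by move=> ? [].
have CM A B : 0 <= C * mass A B by rewrite mulr_ge0 ?(mass_ge0 ed) // ltW.
have typeI avg n h : (forall k b, avg k b -> spread_average C m x c k b) ->
    (forall k b, avg k b -> W b /\ exact_bounded C w m x c b) ->
    (forall n h, schreier_sum avg n h -> W h) -> schreier_sum avg n h ->
    exact_bounded C w m x c h.
  move=> avS avW sumW Hh A B; have [wn|nw] := leqP w n.+1.
    have := typeI_heavy ed A B (fun k b H => (avW k b H).1) sumW Hh wn.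
    by move=> /le_trans; apply; have := CM A B; rewrite -!mulrA; lra.
  have /schreier_sumP[d [a [sz [AF ->]]]] := Hh; have [n0 _ _ _ Ha] := AF.
  have HM j : (0 < j <= d)%N -> `|act (a j) (restr A B X)| <= bound A B.
    by move=> jd; have [_] := avW _ _ (Ha j jd); apply.
  have := typeI_head ed avS sumW nw AF (bound_ge0 ed A B) HM.
  by move=> /le_trans; apply; exact: half_bound.
have typeII G S h : G `<=` W -> G `<=` exact_bounded C w m x c -> W h -> typeII s L1 sigma G S h ->
    exact_bounded C w m x c h.
  move=> GW GP Wh Th A B.
  have [V [uV SV /le_trans]] := typeII_exact hs hL hsigma ed A B GW GP Wh Th; apply.
  by have := phi_sum ed A B uV (fun v vV => (SV v vV).2); lra.
apply: W_ind.
- move=> n n0 A B; apply: le_trans (act_exact_le ed _ _ _) _.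
  apply: (@le_trans _ _ (2 ^+ w * (C * eps))); last first.
    have := eps_small ed; have := CM A B; rewrite -mulrA; lra.
  rewrite ler_wpM2l ?exprn_ge0 //; apply: le_trans (ler_norm _) _.
  have e0 := ltW (ed_eps0 ed).
  apply: sum_at_most_one; rewrite ?iota_uniq ?mulr_ge0 ?(ltW C0) //.
    move=> k; rewrite mem_index_iota => km _; have kr : (0 < k <= m)%N by nlia.
    rewrite ger0_norm ?mulr_ge0 ?(ed_c ed) // mulrC.
    by apply: ler_pM; rewrite ?(ed_c ed) ?(c_le_eps ed) ?(ed_normE ed) //; exact: W_Xn.
  have nz k : c k * `|act 'X^n (restr A B (x k))| != 0 -> (p k <= n <= r k)%N.
    rewrite act_Xn coef_restr; case: ifP => _; last by rewrite normr0 mulr0 eqxx.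
    by rewrite mulf_eq0 normr_eq0 negb_or => /andP[_ /nz_supp].
  move=> i j; rewrite !mem_index_iota => id jd _ _ /nz Hi /nz Hj.
  by apply: (ed_ran_inj ed) Hi Hj; nlia.
- by move=> h _ Ph A B; rewrite actNl normrN; exact: Ph.
- move=> a b h _ Ph A B; rewrite act_restr restr_restr; apply: le_trans (Ph _ _) _.
  by rewrite lerD2r ler_wpM2l ?(mass_clip ed) // mulr_ge0 // ltW.
- move=> n h r' _ Ph r0 r1 A B; rewrite act_suml; apply: le_trans (ler_norm_sum _ _ _) _.
  apply: (@le_trans _ _ (\sum_i ratr (r' i) * bound A B)).
    apply: ler_sum => i _; rewrite actZl normrM ger0_norm ?ler0q //.
    by rewrite ler_wpM2l ?ler0q //; exact: Ph.
  by rewrite -mulr_suml -rmorph_sum /= r1 rmorph1 mul1r.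
- move=> n h _; apply: typeI.
  + by move=> k b /(alpha_average_mono (sub _)); exact: (alpha_spread ed).
  + by move=> k b [].
  + move=> n' h' Hh; apply: schreier_sum_alpha_W; apply: schreier_sum_mono Hh => k b.
    exact: alpha_average_mono (sub _).
- move=> n h _; apply: typeI.
  + by move=> k b /(beta_average_mono (sub _)); exact: (beta_spread hs hL hsigma ed).
  + by move=> k b [].
  + move=> n' h' Hh; apply: schreier_sum_beta_W; apply: schreier_sum_mono Hh => k b.
    exact: beta_average_mono (sub _).
- by move=> d f g w' F so Wh; apply: typeII (typeII_sum_plus so).
- by move=> d f g w' F lam so lo Wh; apply: typeII (typeII_sum_minus so lo).
Qed.

Definition is_average (avg : nat -> {poly R} -> Prop) :=
  avg = alpha_average W \/ avg = beta_average s L1 sigma W.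

Lemma average_size_gt0 avg k a : is_average avg -> avg k a -> 0 < k%:R :> R.
Proof.
by move=> [] -> [_ [d [f]]]; [move=> [H _ _ _]|move=> [S [H _ _ _]]]; rewrite ltr0n; nlia.
Qed.

Lemma is_average_W avg k a : is_average avg -> avg k a -> W a.
Proof. by case=> -> []. Qed.

Lemma schreier_average_W avg n h : is_average avg -> schreier_sum avg n h -> W h.
Proof. by case=> ->; [exact: schreier_sum_alpha_W|exact: schreier_sum_beta_W]. Qed.

Lemma average_spread avg k a : is_average avg -> avg k a -> spread_average C m x c k a.
Proof.
by case=> ->; [exact: (alpha_spread ed)|exact: (beta_spread hs hL hsigma ed)].
Qed.

(** The pieces of an alpha-average share the mass of the interval, those of a
    beta-average share the weights. *)
Lemma average_exact avg k a A B : is_average avg -> avg k a ->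
  `|act a (restr A B X)| <= 6 * C / k%:R + C * q.
Proof.
move=> Havg Ha; have k0 := average_size_gt0 Havg Ha.
have [q20 q2 qC Cq0] := q_facts; have q1 := q_lt ed.
have Ck : 0 <= C / k%:R by rewrite divr_ge0 // ltW.
have ki0 : 0 <= (k%:R^-1 : R) by rewrite invr_ge0 ltW.
case: Havg Ha => -> [Wa [d [h]]].
  move=> [dk bl Wh ->]; apply: le_trans (average_act _ _ _ _) _.
  have /blockP[bl1 bl2] := bl.
  have kd : k%:R^-1 * d%:R <= 1 :> R.
    by rewrite mulrC ler_pdivrMr // mul1r ler_nat; case/andP: dk.
  apply: (@le_trans _ _ (k%:R^-1 * (\sum_(1 <= j < d.+1)
     (5 * C * mass (maxn A (minsupp (h j))) (minn B (maxsupp (h j))) + C * q)))).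
    rewrite ler_wpM2l // big_nat [leRHS]big_nat; apply: ler_sum => j jd.
    rewrite -{1}(restr_id (leqnn (minsupp (h j))) (leqnn (maxsupp (h j)))) act_restr restr_restr.
    rewrite [maxn A _]maxnC [minn B _]minnC.
    by apply: exact_bounded_W; apply: Wh; nlia.
  rewrite big_split /= -mulr_sumr sumr_const_nat subn1 /= -[_ *+ d]mulr_natl mulrDr.
  apply: lerD; last by have := ler_wpM2r Cq0 kd; rewrite mul1r -mulrA.
  have := mass_disjoint ed A B bl; set M := \sum_(_ <= _ < _) _ => M1.
  have := ler_wpM2l (_ : 0 <= 5 * (C / k%:R)) M1; rewrite mulr_ge0 // => /(_ isT).
  by rewrite mulr1 (_ : k%:R^-1 * (5 * C * M) = 5 * (C / k%:R) * M); [lra|ring].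
move=> [S [dk Hh dis ->]]; apply: le_trans (average_act _ _ _ _) _.
have kd : k%:R^-1 * d%:R <= 1 :> R.
  by rewrite mulrC ler_pdivrMr // mul1r ler_nat; case/andP: dk.
have /choice[V HV] j : exists V : seq nat, (0 < j <= d)%N ->
    [/\ uniq V, forall v, v \in V -> S j v /\ (10 <= v)%N
    & `|act (h j) (restr A B X)| <= \sum_(v <- V) phi C w m x c nk A B v + q ^+ 2 / 9].
  have [jd|_] := boolP (0 < j <= d)%N; last by exists [::].
  have [Whj Thj] := Hh j jd.
  have [V HV] := typeII_exact hs hL hsigma ed A B (fun f (Wf : W f) => Wf) exact_bounded_W Whj Thj.
  by exists V.
have [||U [uU HU UE]] := @sum_disjoint_union R d V (phi C w m x c nk A B).
- by move=> j /HV[].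
- move=> i j v id jd ij vi vj; have [_ Hi _] := HV i id; have [_ Hj _] := HV j jd.
  have := dis i j id jd ij; rewrite -subset0 => /(_ v).
  by apply; split; [case: (Hi _ vi)|case: (Hj _ vj)].
apply: (@le_trans _ _ (k%:R^-1 * (\sum_(1 <= j < d.+1)
    (\sum_(v <- V j) phi C w m x c nk A B v + q ^+ 2 / 9)))).
  rewrite ler_wpM2l // big_nat [leRHS]big_nat; apply: ler_sum => j jd.
  by have [] := HV j ltac:(nlia).
rewrite big_split /= sumr_const_nat subn1 /= -[_ *+ d]mulr_natl mulrDr UE.
apply: lerD.
  have := phi_sum ed A B uU; have M1 := mass_le1 ed A B.
  move=> /(_ _)H; have {}H : \sum_(v <- U) phi C w m x c nk A B v <= 6 * C.
    apply: le_trans (H _) _; first by move=> v /HU[j jd vj]; have [_ + _] := HV j jd => /(_ v vj)[].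
    have := ler_wpM2l (ltW C0) M1; have := ler_wpM2l (ltW C0) q1; rewrite -!mulrA; lra.
  by rewrite mulrC ler_wpM2r.
by have := ler_wpM2r (_ : 0 <= q ^+ 2 / 9) kd; rewrite divr_ge0 // -mulrA mul1r => /(_ isT); lra.
Qed.

(** [typeI_head], with the head estimated by [average_exact]. *)
Lemma typeI_exact avg n d (a : nat -> {poly R}) sz (s0 : R) A B :
  is_average avg -> (n.+2 <= w)%N -> average_family avg n d a sz ->
  0 < s0 -> (forall j, (0 < j <= d)%N -> s0 <= (sz j)%:R) ->
  `|act (average_sum n d a) (restr A B X)| <=
    2 ^- n * (6 * C / s0 + C * q) + q ^+ 2.
Proof.
move=> Havg nw AF s00 Hs.
apply: (typeI_head ed (fun k b => average_spread Havg) (fun n h => schreier_average_W Havg)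
  nw AF).
  have [_ _ _ Cq0] := q_facts.
  by rewrite addr_ge0 // divr_ge0 ?mulr_ge0 ?(ltW C0) ?(ltW s00).
have [_ _ _ _ Ha] := AF => j jd.
apply: le_trans (average_exact A B Havg (Ha j jd)) _.
rewrite lerD2r ler_wpM2l ?mulr_ge0 ?(ltW C0) // lef_pV2 ?posrE ?Hs //.
exact: lt_le_trans s00 (Hs j jd).
Qed.

(** Weights of at least [2 * w] leave a factor [2 ^- w] after multiplication by
    [2 ^+ w]. *)
Lemma high_exact d f g w' F (e e' : nat -> R) a b A B :
  special_on L1 sigma W d f g w' F ->
  (forall j, j \in F -> `|e j| <= 2^-1 /\ `|e' j| <= 2^-1) ->
  let term j := e j *: f j + e' j *: g j in
  W (restr a b (\sum_(j <- F) term j)) ->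
  `|act (restr a b (\sum_(j <- F | (2 * w <= w' j)%N) term j)) (restr A B X)| <= 3 * C * q.
Proof.
move=> so eM term Wh; have [q20 q2 qC Cq0] := q_facts; have q1 := q_lt ed.
have wn : (2 * w <= nk 1)%N by have := ed_nk1 ed; have := ltn_expl (2 * w) (ltnSn 1); nlia.
have [Q [t0 [[uV V10] _ _ Qt high]]] :=
  pair_split hs hL hsigma ed (fun f (Wf : W f) => Wf) so eM Wh wn.
set hh := restr a b _; set V := map _ _ in uV high.
apply: le_trans (act_exact_le ed _ _ _) _.
pose T k := \sum_(v <- V | (2 * w <= v)%N) tau C nk k v.
apply: (@le_trans _ _ (2 ^+ w * (\sum_(1 <= k < m.+1) c k * (2 * C * 2 ^- (2 * w) + 2 * C * q ^+ 3) +
   \sum_(1 <= k < m.+1 | Q k && (t0 <= r k)%N) 2 * C * c k))).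
  rewrite ler_wpM2l ?exprn_ge0 // [X in _ <= _ + X]big_mkcond -big_split /=.
  apply: sum_range_le => k km _; have ck := ed_c ed km.
  have := ler_wpM2l ck (high k A B km); move=> /le_trans; apply.
  rewrite mulrDr; apply: lerD; last by case: ifP; rewrite ?mulr0 // mulrC.
  rewrite ler_wpM2l //; apply: le_trans (tau_sum ed k _ uV) _.
  by rewrite lerD2l ler_wpM2l ?(nk_large ed) // mulr_ge0 // ltW.
rewrite -mulr_suml (ed_sum ed) mul1r -mulr_sumr.
have H1 := mass_exceptional ed Qt; have E1 := eps_small ed.
have H2 : 2 * C * (\sum_(1 <= k < m.+1 | Q k && (t0 <= r k)%N) c k) <= 2 * C * (2 * eps).
  by rewrite ler_wpM2l // mulr_ge0 // ltW.
rewrite mulrDr; have := ler_wpM2l (exprn_ge0 w (ler0n R 2)) H2.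
have qm := q_mul R w.
have -> : 2 ^- (2 * w) = q ^+ 2 :> R by rewrite mulnC exprM exprVn.
rewrite (_ : 2 ^+ w * (2 * C * q ^+ 2 + 2 * C * q ^+ 3) = (2 ^+ w * q) * (2 * (C * q) + 2 * C * q ^+ 2)); last by ring.
rewrite (_ : 2 ^+ w * (2 * C * (2 * eps)) = 4 * (2 ^+ w * (C * eps))); last by ring.
rewrite qm mul1r; have := ler_wpM2l (ltW C0) q2; rewrite -!mulrA; lra.
Qed.

End NormOfExact.

(** * The vectors of an exact pair *)

Section Tame.
Variables (R : realType) (s : nat -> R -> R) (L1 L2 L3 : set nat).
Variable sigma : seq {poly R} -> nat.
Hypotheses (hs : dense_in_sphere s) (hL : coding_sets R L1 L2 L3).
Hypothesis hsigma : coding_function L2 sigma.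
Notation W := (W s L1 sigma).

Lemma exact_vector_data C theta w X : exact_vector s L1 sigma C theta w X -> (10 <= w)%N ->
  exists eps m x c nk, exact_data s L1 sigma C eps w m x c nk /\ X = exact_sum w m x c.
Proof.
move=> [C1 _ w0 [eps [m [x [c [nk [heps [m0 bl nx c01] [xmin [_ scc]] [XE _]]]]]]]] [ris nk1] w10.
have C0 : 0 < C := lt_le_trans ltr01 C1.
have [_ nkS _ jump Ha] := ris.
have [_ [F [c' [vE SF c'0 c'1 massF]]]] := scc.
have /blockP[bl1 bl2] := bl.
have plt k k' : (0 < k)%N -> (k < k' <= m)%N -> (minsupp (x k) < minsupp (x k'))%N.
  move=> k0 kk; have := bl2 k k' k0 kk; have := min_le_maxsupp (bl1 k ltac:(nlia)).2; nlia.
have pinj k k' : (0 < k <= m)%N -> (0 < k' <= m)%N -> minsupp (x k) = minsupp (x k') -> k = k'.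
  move=> km km' E; case: (ltngtP k k') => // kk.
    by have := plt k k' ltac:(nlia) ltac:(nlia); nlia.
  by have := plt k' k ltac:(nlia) ltac:(nlia); nlia.
pose v := \sum_(1 <= k < m.+1) c k *: 'X^(minsupp (x k)).
have vF t : v`_t = if t \in F then c' t else 0.
  rewrite /v vE coef_sum; under eq_bigr do rewrite coefZ coefXn.
  case: ifP => tF.
    rewrite (bigD1_seq t tF (fset_uniq F)) /= eqxx mulr1 big1 ?addr0 // => i /negPf it.
    by rewrite eq_sym it mulr0.
  rewrite big_seq big1 // => i iF; case: eqP => [E|_]; last exact: mulr0.
  by rewrite E iF in tF.
have vp k : (0 < k <= m)%N -> v`_(minsupp (x k)) = c k.
  move=> km; rewrite coef_sum (bigD1_seq k) ?iota_uniq ?mem_index_iota //=.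
  rewrite coefZ coefXn eqxx mulr1 big_seq_cond big1 ?addr0 // => j.
  rewrite mem_index_iota => /andP[jm /eqP jk]; rewrite coefZ coefXn.
  case: eqP => [E|_]; last exact: mulr0.
  by case: jk; apply: pinj => //; nlia.
(* the last vector only needs a large enough next entry *)
pose nk' k := if (k <= m)%N then nk k else (nk m + (maxsupp (x m)).+1)%N.
exists eps, m, x, c, nk'; split; last exact: XE.
have jump' k : (0 < k < m)%N -> (nk k < nk k.+1)%N -> (maxsupp (x k))%:R <= (2 ^+ (nk k.+1 - nk k) : R).
  move=> km kk; have := jump k km.
  rewrite mulrC ltr_pdivrMr ?exprn_gt0 // => /ltW.
  by rewrite expfB // mulrC.
split=> //.
- by move=> k km; case/andP: (c01 k km).
- (* evaluation at 1 adds up the coefficients *)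
  have := congr1 (fun p => p.[1]) vE; rewrite !horner_sum.
  under eq_bigr do rewrite hornerZ hornerXn expr1n mulr1.
  by under [X in _ = X]eq_bigr do rewrite hornerZ hornerXn expr1n mulr1; rewrite c'1.
- move=> P SP; pose G := [fset t in minima m x P | t \in F]%fset.
  have -> : \sum_(1 <= k < m.+1 | P k) c k = \sum_(t <- G) c' t.
    rewrite (sum_range_eq (m := m) (F' := fun k => v`_(minsupp (x k)))); last first.
      by move=> k km _; rewrite vp.
    rewrite [RHS](eq_big_seq (fun t => v`_t)); last first.
      by move=> t; rewrite !inE => /andP[_ tF]; rewrite vF tF.
    rewrite /= -big_filter -(big_map (fun k => minsupp (x k)) xpredT (fun t => v`_t)).
    rewrite [LHS](bigID (mem F)) /= [X in _ + X]big1 ?addr0; last first.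
      by move=> t /negPf tF; rewrite vF tF.
    rewrite -big_filter; apply/perm_big/uniq_perm.
    + rewrite filter_uniq // map_inj_in_uniq ?filter_uniq ?iota_uniq // => k k'.
      rewrite !mem_filter !mem_iota => /andP[_ km] /andP[_ k'm].
      by apply: pinj; nlia.
    + exact: fset_uniq.
    + by move=> t; rewrite mem_filter !inE andbC /index_iota subSS subn0.
  have [G0|G0] := eqVneq G fset0.
    rewrite big_seq big1; first by case/andP: heps.
    by move=> t; rewrite [G]G0 inE.
  apply: massF.
    by apply/fsubsetP => t; rewrite !inE => /andP[].
  by apply: schreier_sub SP G0 _ => t; rewrite !inE => /andP[].
- move=> k h km Wh; apply: le_trans (nx k km); exact: (act_le_normX hs).
- move=> k n h km Wh Th; rewrite /nk' (_ : (k <= m)%N); last by case/andP: km.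
  by move=> nn; exact: ltW (Ha k km n h Wh Th nn).
- move=> k km; rewrite /nk' (_ : (k <= m)%N); last by case/andP: km.
  case: ltnP => km'; first by apply: jump' => //; [nlia|apply: nkS; nlia].
  have -> : k = m by nlia.
  rewrite addKn -natrX ler_nat; apply: ltnW; apply: ltn_trans (ltnSn _) _; exact: ltn_expl.
- move=> k km; rewrite /nk' (_ : (k <= m)%N); last by case/andP: km.
  case: (ltnP k m) => km'; first by apply: nkS; nlia.
  by rewrite (_ : k = m) ?addnS ?ltnS ?leq_addr //; nlia.
- by rewrite /nk' m0.
Qed.

(** What the estimates for dependent sequences use about the vectors of an exact
    pair of weight [w]; the constants are those for [C = 5], enlarged by the factor
    [36 / 35] since the exact vector is divided by [f(x') > 35 / 36]. *)
Record tame (w : nat) (v : {poly R}) : Prop := Tame {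
  tame_w : (10 <= w)%N;
  tame_c00 : v`_0 = 0;
  tame_nz : v != 0;
  tame_min : (40 * 2 ^ (2 * w) <= minsupp v)%N;
  tame_bound : forall h a b, W h -> `|act h (restr a b v)| <= 27;
  tame_tail : forall avg n d a sz (s0 : R) A B,
    is_average s L1 sigma avg -> (n.+2 <= w)%N -> average_family avg n d a sz ->
    0 < s0 -> (forall j, (0 < j <= d)%N -> s0 <= (sz j)%:R) ->
    `|act (average_sum n d a) (restr A B v)| <=
      2 ^- n * (31 / s0 + 6 * 2 ^- w) + 2 * (2 ^- w) ^+ 2;
  tame_high : forall d f g w' F (e e' : nat -> R) a b A B,
    special_on L1 sigma W d f g w' F ->
    (forall j, j \in F -> `|e j| <= 2^-1 /\ `|e' j| <= 2^-1) ->
    let term j := e j *: f j + e' j *: g j in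
    W (restr a b (\sum_(j <- F) term j)) ->
    `|act (restr a b (\sum_(j <- F | (2 * w <= w' j)%N) term j)) (restr A B v)| <= 16 * 2 ^- w }.

Lemma exact_pair_tame w v h : exact_pair s L1 sigma w v h -> (10 <= w)%N -> tame w v.
Proof.
move=> [Wh Th _ _ [X [evX /andP[hX1 hX2] ->]]] w10.
have [eps [m [x [c [nk [ed XE]]]]]] := exact_vector_data evX w10.
set t := act h X in hX1 hX2 *; have t0 : 0 < t by lra.
have tE : `|t^-1| <= 36 / 35.
  rewrite ger0_norm ?invr_ge0 ?(ltW t0) // -[t^-1]mul1r ler_pdivrMr //; lra.
have q0 := q_gt0 R w; have q1 := q_lt ed.
have scale h' A B M : `|act h' (restr A B X)| <= M ->
    `|act h' (restr A B (t^-1 *: X))| <= 36 / 35 * M.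
  move=> HM; rewrite restrZ actZr normrM; apply: ler_pM => //.
have Xnz : X != 0.
  by apply: contraTneq t0 => X0; rewrite /t X0 act0r ltxx.
have supp i : X`_i != 0 -> (minsupp (x 1%N) <= i)%N.
  apply: contraR; rewrite -ltnNge => ip; rewrite XE coefZ coef_sum big_nat big1 ?mulr0 // => k km.
  rewrite coefZ lt_minsupp ?mulr0 //; apply: leq_trans ip _.
  case: (ltngtP 1 k) => [k1|k1|<- //]; last nlia.
  by have := ed_plt ed (k := 1) (k' := k) isT ltac:(nlia); nlia.
split=> //.
- rewrite coefZ; case: (eqVneq X`_0 0) => [->|/supp]; first exact: mulr0.
  by have := ed_le ed (k := 1) ltac:(rewrite (ed_m ed)); nlia.
- by rewrite scaler_eq0 negb_or invr_eq0 gt_eqF.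
- have mX : (minsupp (x 1%N) <= minsupp (t^-1 *: X))%N.
    apply: supp; have := @nz_minsupp R (t^-1 *: X); rewrite scaler_eq0 negb_or invr_eq0 gt_eqF // => /(_ Xnz).
    by rewrite coefZ mulf_eq0 negb_or => /andP[].
  apply: leq_trans mX; have := ed_min ed.
  by rewrite -(ler_nat R) natrM natrX (_ : 8 * 5 = 40%:R :> R) //; ring.
- move=> h' a b Wh'; apply: le_trans (scale _ _ _ _ (_ : _ <= 5 * 5 * 1 + 5 * (1 / 1000))) _; last lra.
  rewrite XE; apply: le_trans (exact_bounded_W hs hL hsigma ed Wh' a b) _.
  have := mass_le1 ed a b; lra.
- move=> avg n d a sz s0 A B Havg nw AF s00 Hs.
  have := typeI_exact hs hL hsigma ed A B Havg nw AF s00 Hs; rewrite -XE => /scale.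
  move=> /le_trans; apply; have is0 : 0 < s0^-1 by rewrite invr_gt0.
  have n0' : 0 <= (2 ^- n : R) := pow2_ge0 R n.
  have q20 : 0 <= (2 ^- w : R) ^+ 2 by rewrite exprn_ge0 // ltW.
  rewrite mulrDr; apply: lerD; last lra.
  rewrite mulrCA ler_wpM2l //; lra.
- move=> d f g w' F e e' a b A B so eM term Whr.
  have := high_exact hs hL hsigma ed A B so eM Whr; rewrite -XE => /scale /le_trans; apply.
  by lra.
Qed.

End Tame.

(** * Dependent sequences *)

Section Main.
Variables (R : realType) (s : nat -> R -> R) (L1 L2 L3 : set nat).
Variable sigma : seq {poly R} -> nat.
Hypotheses (hs : dense_in_sphere s) (hL : coding_sets R L1 L2 L3).
Hypothesis hsigma : coding_function L2 sigma.
Notation W := (W s L1 sigma).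
Notation tame := (tame s L1 sigma).
Notation is_average := (is_average s L1 sigma).
Variables (x y f g : nat -> {poly R}) (wt : nat -> nat).
Hypothesis hnode : forall j, (0 < j)%N -> exact_node s L1 sigma (wt j) (x j) (y j) (f j) (g j).
Hypothesis hnext : forall j, (0 < j)%N -> (maxsupp (g j) < minsupp (x j.+1))%N.
Hypothesis hsp : forall d, special L1 sigma W d f g wt.

Lemma dep_w10 j : (0 < j)%N -> (10 <= wt j)%N.
Proof. by move=> j0; apply: (special_ge10 hs hL hsigma (hsp j)); rewrite j0 leqnn. Qed.

Lemma dep_tame j : (0 < j)%N -> tame (wt j) (x j) /\ tame (wt j) (y j).
Proof.
move=> j0; have [px py _] := hnode j0; have w10 := dep_w10 j0.
by split; [exact: (exact_pair_tame hs hL hsigma px)|exact: (exact_pair_tame hs hL hsigma py)].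
Qed.

Lemma exact_pair_act w v h : exact_pair s L1 sigma w v h -> act h v = 1.
Proof.
by move=> [_ _ _ _ [v' [_ /andP[v1 _] ->]]]; rewrite actZr mulVf // gt_eqF //; lra.
Qed.

Lemma dep_order j : (0 < j)%N ->
  [/\ (minsupp (x j) <= minsupp (f j))%N, (minsupp (x j) <= maxsupp (x j) <= maxsupp (f j))%N,
      (maxsupp (f j) < minsupp (y j))%N, (minsupp (y j) <= minsupp (g j))%N
    & (minsupp (y j) <= maxsupp (y j) <= maxsupp (g j))%N].
Proof.
move=> j0; have [[_ _ x1 x2 _] [_ _ y1 y2 _] fy] := hnode j0; have [tx ty] := dep_tame j0.
by rewrite (min_le_maxsupp (tame_nz tx)) (min_le_maxsupp (tame_nz ty)).
Qed.

Lemma dep_lt j j' : (0 < j < j')%N -> (maxsupp (g j) < minsupp (x j'))%N.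
Proof.
move=> /andP[j0]; elim: j' => // j' IH; rewrite ltnS leq_eqVlt => /orP[/eqP <-|jj'].
  exact: hnext.
have j'0 : (0 < j')%N by nlia.
have [? ? ? ? ?] := dep_order j'0.
by have := IH jj'; have := hnext j'0; nlia.
Qed.

Lemma dep_wt_gt j j' : (0 < j < j')%N -> (maxsupp (g j) < wt j')%N.
Proof.
move=> /andP[j0 jj']; have j'0 : (0 < j'.-1)%N by nlia.
have := special_growth hs hsigma (hsp j') (q := j'.-1) ltac:(nlia).
rewrite prednK; last nlia.
have [E|jj''] := eqVneq j j'.-1; first by rewrite -E.
have [? ? ? ? ?] := dep_order j'0; have := @dep_lt j j'.-1 ltac:(nlia); nlia.
Qed.

Lemma dep_wt_min j : (0 < j)%N -> (40 * 2 ^ (2 * wt j) <= minsupp (x j))%N.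
Proof. by move=> /dep_tame[tx _]; exact: tame_min tx. Qed.

Lemma dep_wt_lt j j' : (0 < j < j')%N -> (wt j < wt j')%N.
Proof.
move=> jj; have j0 : (0 < j)%N by nlia.
have [? ? ? ? ?] := dep_order j0; have := dep_wt_gt jj; have := dep_wt_min j0.
by have := ltn_expl (2 * wt j) (ltnSn 1); nlia.
Qed.

Lemma dep_wt_ge j : (0 < j)%N -> (j <= wt j)%N.
Proof.
elim: j => // -[_ _|j IH _]; first by have := @dep_w10 1 isT; nlia.
by have := IH isT; have := @dep_wt_lt j.+1 j.+2 ltac:(nlia); nlia.
Qed.

Lemma dep_L0 j : (0 < j)%N -> (L1 `|` L2 `|` L3) (wt j).
Proof. by move=> j0; apply: (special_L0 L3 hs hsigma (hsp j)); rewrite j0 leqnn. Qed.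

Lemma tame_coef w v t : tame w v -> `|v`_t| <= 27.
Proof.
move=> tv; have [->|t0] := posnP t; first by rewrite (tame_c00 tv) normr0.
have := tame_bound tv 0 (maxsupp v) (@W_Xn R s L1 sigma t t0).
by rewrite restr_id // act_Xn.
Qed.

Definition node j := x j - y j.

Lemma act_node h A B j :
  act h (restr A B (node j)) = act h (restr A B (x j)) - act h (restr A B (y j)).
Proof. by rewrite restrD restrN actDr actNr. Qed.

Lemma act_node_le h A B j M : `|act h (restr A B (x j))| <= M ->
  `|act h (restr A B (y j))| <= M -> `|act h (restr A B (node j))| <= 2 * M.
Proof. by move=> hx hy; rewrite act_node (le_trans (ler_normB _ _)) //; lra. Qed.

Lemma node_bound h A B j : (0 < j)%N -> W h -> `|act h (restr A B (node j))| <= 54.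
Proof.
move=> j0 Wh; have [tx ty] := dep_tame j0; rewrite (_ : 54 = 2 * 27 :> R); last by ring.
by apply: act_node_le; [exact: (tame_bound tx)|exact: (tame_bound ty)].
Qed.

Lemma node_coef0 j t : (0 < j)%N -> (t < minsupp (x j))%N -> (node j)`_t = 0.
Proof.
move=> j0 tj; have [? ? ? ? ?] := dep_order j0.
by rewrite coefB !lt_minsupp ?subrr //; nlia.
Qed.

Lemma node_coef1 j t : (0 < j)%N -> (maxsupp (g j) < t)%N -> (node j)`_t = 0.
Proof.
move=> j0 tj; have [? ? ? ? ?] := dep_order j0.
by rewrite coefB !gt_maxsupp ?subrr //; nlia.
Qed.

Lemma branch_node A B j j' : (0 < j)%N -> (0 < j')%N -> j != j' ->
  act (f j) (restr A B (node j')) = 0 /\ act (g j) (restr A B (node j')) = 0.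
Proof.
move=> j0 j'0 /eqP jj.
have [? ? ? ? ?] := dep_order j0; have [? ? ? ? ?] := dep_order j'0.
rewrite !act_node !act_restr_apart ?subrr //.
all: case: (ltngtP j j') jj => // jj _.
all: by [have := @dep_lt j j' ltac:(nlia); nlia|have := @dep_lt j' j ltac:(nlia); nlia].
Qed.

Lemma branch_node_self A B j : (0 < j)%N ->
  act (f j) (restr A B (node j)) = act (f j) (restr A B (x j)) /\
  act (g j) (restr A B (node j)) = - act (g j) (restr A B (y j)).
Proof.
move=> j0; have [? ? ? ? ?] := dep_order j0; rewrite !act_node.
rewrite [act (f j) (restr A B (y j))]act_restr_apart; last by apply/orP; left; nlia.
by rewrite [act (g j) (restr A B (x j))]act_restr_apart ?subr0 ?sub0r //; apply/orP; right; nlia.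
Qed.

Variables (m : nat) (k : nat -> nat) (c : nat -> R).
Hypotheses (hm : (0 < m)%N) (hk1 : (m <= k 1)%N).
Hypothesis hk : forall i, (0 < i < m)%N -> (k i < k i.+1)%N.

Notation q j := (2 ^- wt j : R).
Notation P := (minsupp (x (k 1%N))).

Lemma k_mono i i' : (0 < i < i')%N -> (i' <= m)%N -> (k i < k i')%N.
Proof.
move=> /andP[i0]; elim: i' => // i' IH; rewrite ltnS leq_eqVlt => /orP[/eqP <-|ii'] im.
  by apply: hk; nlia.
by have := IH ii' ltac:(nlia); have := hk (i := i') ltac:(nlia); nlia.
Qed.

Lemma k_gt0 i : (0 < i <= m)%N -> (0 < k i)%N.
Proof.
move=> im; have [E|i1] := eqVneq i 1%N; first by rewrite E; nlia.
by have := @k_mono 1 i ltac:(nlia) ltac:(nlia); nlia.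
Qed.

Lemma k_inj i i' : (0 < i <= m)%N -> (0 < i' <= m)%N -> k i = k i' -> i = i'.
Proof.
move=> im im' E; case: (ltngtP i i') => // ii.
  by have := @k_mono i i' ltac:(nlia) ltac:(nlia); nlia.
by have := @k_mono i' i ltac:(nlia) ltac:(nlia); nlia.
Qed.

Definition coef_vector : {poly R} := \sum_(1 <= i < m.+1) c i *: 'X^(k i).
Notation U := (norm_u s coef_vector).

Lemma U_ge0 : 0 <= U. Proof. exact: (norm_u_ge0 hs). Qed.

Lemma coef_vector_k i : (0 < i <= m)%N -> coef_vector`_(k i) = c i.
Proof.
move=> im; rewrite coef_sum (bigD1_seq i) ?iota_uniq ?mem_index_iota //=.
rewrite coefZ coefXn eqxx mulr1 big_seq_cond big1 ?addr0 // => j.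
rewrite mem_index_iota => /andP[jm /eqP ji]; rewrite coefZ coefXn.
case: eqP => [E|_]; last exact: mulr0.
by case: ji; apply: k_inj => //; nlia.
Qed.

Lemma c_le_U i : (0 < i <= m)%N -> `|c i| <= U.
Proof. by move=> im; rewrite -coef_vector_k //; apply: (norm_u_coef hs); exact: k_gt0. Qed.

Definition combination (I : pred nat) : {poly R} :=
  \sum_(1 <= i < m.+1 | I i) c i *: node (k i).

Lemma act_combination h A B (I : pred nat) : act h (restr A B (combination I)) =
  \sum_(1 <= i < m.+1 | I i) c i * act h (restr A B (node (k i))).
Proof.
rewrite restr_sum act_sumr; apply: eq_bigr => i _.
by rewrite restrZ actZr.
Qed.

Lemma node_before i i' t : (0 < i < i')%N -> (i' <= m)%N -> (minsupp (x (k i')) <= t)%N ->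
  (node (k i))`_t = 0.
Proof.
move=> ii im ti; have k0 : (0 < k i)%N by apply: k_gt0; nlia.
apply: (node_coef1 k0).
by apply: leq_trans ti; apply: dep_lt; rewrite k0 k_mono.
Qed.

Lemma node_after i i' t : (0 < i <= i')%N -> (i' <= m)%N -> (t < minsupp (x (k i)))%N ->
  (node (k i'))`_t = 0.
Proof.
move=> ii im ti; have k0 : (0 < k i)%N by apply: k_gt0; nlia.
have k0' : (0 < k i')%N by apply: k_gt0; nlia.
apply: (node_coef0 k0').
case: (ltngtP i i') => [lt|lt|<- //]; last nlia.
have := dep_lt (j := k i) (j' := k i') ltac:(rewrite k0 k_mono //; nlia).
by have [? ? ? ? ?] := dep_order k0; nlia.
Qed.

Lemma combination_supp (I : pred nat) t : (t < P)%N -> (combination I)`_t = 0.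
Proof.
move=> tP; rewrite coef_sum big_nat_cond big1 // => i /andP[im _].
by rewrite coefZ (@node_after 1 i) ?mulr0 //; nlia.
Qed.

(** Bounds for all the restrictions of the combination thus also hold for the part
    of it that consists of the nodes of large weight. *)
Lemma combination_upper (I : pred nat) : (forall i i', (0 < i <= i')%N -> (i' <= m)%N -> I i -> I i') ->
  exists A0 B0, combination I = restr A0 B0 (combination xpredT).
Proof.
move=> up; have [|e em He] := @downward_threshold m (fun i => ~~ I i).
  by move=> i i' i0 ii; apply: contra; apply: up; nlia.
have [me|em'] := leqP m e.
  exists 1%N, 0%N; apply/polyP => t; rewrite coef_restr.
  rewrite (_ : (1 <= t <= 0)%N = false); last by case: t.
  rewrite coef_sum big_nat_cond big1 // => i /andP[im Ii].
  by have := He i ltac:(nlia); rewrite Ii; nlia.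
exists (minsupp (x (k e.+1))), (maxsupp (combination xpredT)).
apply/polyP => t; rewrite coef_restr.
have [tle|tlt] /= := leqP (minsupp (x (k e.+1))) t; last first.
  rewrite coef_sum big_nat_cond big1 // => i /andP[im Ii].
  rewrite coefZ (@node_after e.+1 i) ?mulr0 //; last nlia.
  by have := He i ltac:(nlia); rewrite Ii; nlia.
have [tm|tm] := leqP t (maxsupp (combination xpredT)); last first.
  have := gt_maxsupp tm; rewrite !coef_sum => E; rewrite -[RHS]E big_mkcond.
  rewrite big_nat [RHS]big_nat; apply: eq_bigr => i im; case: ifP => // Ii.
  rewrite coefZ (@node_before i e.+1) ?mulr0 //.
  by have := He i ltac:(nlia); rewrite Ii; nlia.
rewrite !coef_sum big_mkcond big_nat [RHS]big_nat; apply: eq_bigr => i im; case: ifP => // Ii.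
rewrite coefZ (@node_before i e.+1) ?mulr0 //.
by have := He i ltac:(nlia); rewrite Ii; nlia.
Qed.

Definition tail_bound n j : R := 2 * (2 ^- n * (31 * 2 ^- P + 6 * q j) + 2 * q j ^+ 2).

Lemma tail_node avg n d (a : nat -> {poly R}) sz A B j :
  is_average avg -> (0 < j)%N -> (n.+2 <= wt j)%N -> average_family avg n d a sz ->
  (forall i, (0 < i <= d)%N -> (2 ^+ P : R) <= (sz i)%:R) ->
  `|act (average_sum n d a) (restr A B (node j))| <= tail_bound n j.
Proof.
move=> Havg j0 nw AF Hs; have [tx ty] := dep_tame j0.
have P0 : 0 < (2 ^+ P : R) by rewrite exprn_gt0.
by apply: act_node_le; [apply: (tame_tail tx _ _ Havg nw AF P0 Hs)
  |apply: (tame_tail ty _ _ Havg nw AF P0 Hs)].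
Qed.

(** The first average acting on the nodes of [I] is estimated on all of them
    together, the later ones on each node separately. *)
Lemma typeI_low avg n d (a : nat -> {poly R}) sz (I : pred nat) A B M :
  is_average avg -> (forall i, (0 < i <= m)%N -> I i -> (n.+2 <= wt (k i))%N) ->
  average_family avg n d a sz -> 0 <= M ->
  (forall j, (0 < j <= d)%N -> `|act (a j) (restr A B (combination I))| <= M) ->
  `|act (average_sum n d a) (restr A B (combination I))| <=
  2 ^- n * M + \sum_(1 <= i < m.+1 | I i) U * tail_bound n (k i).
Proof.
move=> Havg HI AF M0 HM; have U0 := U_ge0.
have tb0 i : 0 <= tail_bound n (k i).
  by rewrite !(mulr_ge0, addr_ge0) ?pow2_ge0 ?exprn_ge0 ?pow2_ge0.
have [/le_trans|[d' [a' [sz' [AF' Hs /le_trans]]]]] :=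
    head_tail AF (@combination_supp I) M0 HM; apply.
  by rewrite lerDl; apply: sumr_ge0 => i _; rewrite mulr_ge0.
rewrite lerD2l act_combination; apply: le_trans (ler_norm_sum _ _ _) _.
rewrite big_nat_cond [leRHS]big_nat_cond; apply: ler_sum => i /andP[im Ii].
have ir : (0 < i <= m)%N by nlia.
rewrite normrM; apply: ler_pM => //; first exact: c_le_U.
by apply: tail_node Havg (k_gt0 ir) (HI i ir Ii) AF' Hs.
Qed.

Definition node_error j : R := 62 * 2 ^- P + 20 * q j.

Lemma q_props j : (0 < j)%N ->
  [/\ 0 < q j, q j <= 1 / 1000, (wt j)%:R * q j <= 1 / 100 & q j ^+ 2 <= q j / 1000].
Proof.
move=> j0; have [q1 q2] := q_small R (dep_w10 j0); have q0 := q_gt0 R (wt j); split=> //.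
by have := ler_wpM2l (ltW q0) q1; rewrite expr2; lra.
Qed.

Lemma sum_q_le : \sum_(1 <= i < m.+1) q (k i) <= 1 / 500.
Proof.
rewrite -(big_map (fun i => wt (k i)) xpredT (fun v => 2 ^- v)).
apply: (@le_trans _ _ (2 * 2 ^- 10)); last by have [] := q_small R (v := 10) isT; lra.
apply: sum_geom_le.
  rewrite map_inj_in_uniq ?iota_uniq // => i i'; rewrite !mem_index_iota => im im' /= E.
  apply: k_inj; [nlia|nlia|]; have k0 : (0 < k i)%N by apply: k_gt0; nlia.
  have k0' : (0 < k i')%N by apply: k_gt0; nlia.
  case: (ltngtP (k i) (k i')) => // kk.
    by have := dep_wt_lt (j := k i) (j' := k i'); rewrite k0 kk => /(_ isT); nlia.
  by have := dep_wt_lt (j := k i') (j' := k i); rewrite k0' kk => /(_ isT); nlia.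
move=> v /mapP[i]; rewrite mem_index_iota => im ->; apply: dep_w10; apply: k_gt0; nlia.
Qed.

Lemma m_le_P : (m <= P)%N /\ (10 <= P)%N.
Proof.
have k1 : (0 < k 1)%N by apply: k_gt0; rewrite hm.
have := dep_wt_ge k1; have := dep_wt_min k1; have := dep_w10 k1.
by have := ltn_expl (2 * wt (k 1%N)) (ltnSn 1); nlia.
Qed.

Lemma sum_error_le : \sum_(1 <= i < m.+1) node_error (k i) <= 2 / 3.
Proof.
rewrite big_split /= sumr_const_nat subn1 /= -mulr_sumr.
have [mP P10] := m_le_P; have [_ HP] := q_small R P10.
have : 62 * 2 ^- P *+ m <= 62 / 100 :> R.
  rewrite -[_ *+ m]mulr_natl; apply: (@le_trans _ _ (P%:R * (62 * 2 ^- P))); last lra.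
  by rewrite ler_wpM2r ?mulr_ge0 ?pow2_ge0 // ler_nat.
have := sum_q_le; lra.
Qed.

Notation Z := (combination xpredT).

(** If [n >= maxsupp (y j)], the coordinates of the functional, at most [2 ^- n],
    are too small for vectors supported up to [n]; if [n + 1 < wt j], averages of
    large size are small on the node by [tail_node]. At most one node escapes both
    cases. *)
Lemma tail_node_error avg n d (a : nat -> {poly R}) sz A B j :
  is_average avg -> (0 < j)%N -> average_family avg n d a sz ->
  (forall i, (0 < i <= d)%N -> (2 ^+ P : R) <= (sz i)%:R) ->
  `|act (average_sum n d a) (restr A B (node j))| <=
    node_error j + (if (wt j <= n.+1)%N && (n < maxsupp (y j))%N then 54 else 0).
Proof.
move=> Havg j0 AF Hs; have HT := average_family_sum AF; have [n0 _ _ _ _] := AF; have [q0 q1 q2 q3] := q_props j0.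
have PP : 0 <= (2 ^- P : R) := pow2_ge0 R P.
have WT := schreier_average_W Havg HT; set T := average_sum _ _ _ in HT WT *.
have e0 : 0 <= node_error j by rewrite /node_error; lra.
have [nw|wn] := ltnP n.+1 (wt j).
  rewrite addr0; apply: le_trans (tail_node A B Havg j0 nw AF Hs) _.
  have n1 : (2 ^- n : R) <= 1 by rewrite invf_le1 ?exprn_gt0 // exprn_ege1 // ler1n.
  have : 2 ^- n * (31 * 2 ^- P + 6 * q j) <= 1 * (31 * 2 ^- P + 6 * q j).
    by rewrite ler_wpM2r //; lra.
  by rewrite /tail_bound /node_error; lra.
rewrite /=; case: (ltnP n (maxsupp (y j))) => [ny|yn].
  by apply: le_trans (node_bound A B j0 WT) _; lra.
rewrite addr0; apply: (@le_trans _ _ (q j)); last by rewrite /node_error; lra.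
have [r1 r2 r3 r4 r5] := dep_order j0; have [tx ty] := dep_tame j0.
have small v : tame (wt j) v -> (maxsupp v <= n)%N -> `|act T (restr A B v)| <= 2 ^- n * 27 * n%:R.
  move=> tv vn; rewrite -act_restr; apply: act_le_sup => //; rewrite ?pow2_ge0 //.
  - exact: (tame_c00 tv).
  - move=> i; rewrite coef_restr; case: ifP => _; last by rewrite normr0 pow2_ge0.
    apply: schreier_sum_coef HT => l b Hb i'; apply: (W_coef hs); exact: is_average_W Havg Hb.
  - by move=> i; exact: tame_coef tv.
apply: le_trans (act_node_le (small _ tx _) (small _ ty yn)) _; first nlia.
have nbig : (54 * n * 2 ^ wt j <= 2 ^ n)%N.
  have := dep_wt_min j0; have w10 := dep_w10 j0.
  have := mul100_le_exp2 w10; have : (2 ^ (2 * wt j) = 2 ^ wt j * 2 ^ wt j)%N by rewrite mul2n -addnn expnD.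
  move=> -> H1 H2; have n4 : (4 <= n)%N by nlia.
  apply: leq_trans (sqr_le_exp2 n4); have H3 : (54 * 2 ^ wt j <= n)%N by nia.
  by rewrite -mulnA mulnCA -mulnn leq_mul2l H3 orbT.
move: nbig; rewrite -(ler_nat R) !natrM !natrX => nbig.
have e1 : 0 < (2 ^+ n : R) by rewrite exprn_gt0.
have e2 : 0 < (2 ^+ wt j : R) by rewrite exprn_gt0.
rewrite -[q j]mul1r ler_pdivlMr //.
rewrite (_ : 2 * (2 ^- n * 27 * n%:R) * 2 ^+ wt j = (54 * n%:R * 2 ^+ wt j) / 2 ^+ n); last by ring.
by rewrite ler_pdivrMr // mul1r.
Qed.

Lemma typeI_combination avg n d (a : nat -> {poly R}) sz A B :
  is_average avg -> average_family avg n d a sz ->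
  (forall j, (0 < j <= d)%N -> `|act (a j) (restr A B Z)| <= 146 * U) ->
  `|act (average_sum n d a) (restr A B Z)| <= 146 * U.
Proof.
move=> Havg AF HM; have U0 := U_ge0; have [n0 _ _ _ _] := AF.
have M0 : 0 <= 146 * U by rewrite mulr_ge0.
have hd : 2 ^- n * (146 * U) <= 2^-1 * (146 * U) by rewrite ler_wpM2r ?pow2_le_half.
have [/le_trans|[d' [a' [sz' [AF' Hs /le_trans]]]]] :=
    head_tail AF (@combination_supp xpredT) M0 HM; apply; first lra.
set T := average_sum _ _ _.
pose exc i : bool := (wt (k i) <= n.+1)%N && (n < maxsupp (y (k i)))%N.
suff : `|act T (restr A B Z)| <= U * (2 / 3) + U * 54 by lra.
rewrite act_combination; apply: le_trans (ler_norm_sum _ _ _) _.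
apply: (@le_trans _ _ (\sum_(1 <= i < m.+1) (U * node_error (k i) + U * (if exc i then 54 else 0)))).
  rewrite big_nat [leRHS]big_nat; apply: ler_sum => i im.
  have ir : (0 < i <= m)%N by nlia.
  rewrite normrM -mulrDr; apply: ler_pM => //; first exact: c_le_U.
  exact: tail_node_error Havg (k_gt0 ir) AF' Hs.
rewrite big_split /= -!mulr_sumr; apply: lerD; first by rewrite ler_wpM2l ?sum_error_le.
rewrite ler_wpM2l //; apply: le_trans (ler_norm _) _.
apply: sum_at_most_one; rewrite ?iota_uniq //.
  by move=> i _ _; case: ifP; rewrite ?normr0 // ger0_norm.
move=> i i'; rewrite !mem_index_iota => im im' _ _.
case: ifP => [/andP[w1 y1] _|_]; last by rewrite eqxx.
case: ifP => [/andP[w2 y2] _|_]; last by rewrite eqxx.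
have one i1 i2 : (0 < i1 < i2)%N -> (i2 <= m)%N -> (n < maxsupp (y (k i1)))%N ->
    (wt (k i2) <= n.+1)%N -> False.
  move=> ii i2m yy ww; have k1 : (0 < k i1)%N by apply: k_gt0; nlia.
  have := dep_wt_gt (j := k i1) (j' := k i2); rewrite k1 k_mono // => /(_ isT).
  by have [? ? ? ? ?] := dep_order k1; nlia.
case: (ltngtP i i') => // ii.
  by case: (@one i i'); nlia.
by case: (@one i' i); nlia.
Qed.

(** The gaps in the coding set keep the weights of two special sequences far apart
    unless they coincide. *)
Lemma weight_trichotomy u v : (L1 `|` L2 `|` L3) u -> (L1 `|` L2 `|` L3) v ->
  [\/ (u.+2 <= v)%N, u = v | (2 * v <= u)%N].
Proof.
move=> Lu Lv; case: (ltngtP u v) => [uv|vu|->]; [|by constructor 3; have := coding_gap hL Lv Lu vu;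
  have := ltn_expl (2 * v) (ltnSn 1); nlia|by constructor 2].
constructor 1; have := coding_gap hL Lu Lv uv.
by have := ltn_expl (2 * u) (ltnSn 1); have := coding_ge10 hL Lu; nlia.
Qed.

Section TypeTwoCombination.
Variables (G : set {poly R}) (d : nat) (f' g' : nat -> {poly R}) (w' : nat -> nat).
Variables (F : {fset nat}) (e e' : nat -> R).
Hypothesis GW : G `<=` W.
Hypothesis GZ : forall h A B, G h -> `|act h (restr A B Z)| <= 146 * U.
Hypothesis so : special_on L1 sigma G d f' g' w' F.
Hypothesis eM : forall j, j \in F -> `|e j| <= 2^-1 /\ `|e' j| <= 2^-1.
Let term j := e j *: f' j + e' j *: g' j.
Hypothesis Wsum : W (\sum_(j <- F) term j).

Let F_range j : j \in F -> (0 < j <= d)%N. Proof. by have [_ H _] := so; exact: H. Qed.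
Let spW : special L1 sigma W d f' g' w'.
Proof. by have [sp _ _] := so; exact: special_mono GW sp. Qed.

Let weight_inj j j' : j \in F -> j' \in F -> w' j = w' j' -> j = j'.
Proof.
by move=> jF j'F; exact: (special_weight_inj hs hL hsigma spW (F_range jF) (F_range j'F)).
Qed.

Let term_le j v M : j \in F -> `|act (f' j) v| <= M -> `|act (g' j) v| <= M ->
  `|act (term j) v| <= M.
Proof. by move=> jF fM gM; have [e1 e2] := eM jF; exact: act_pair_le. Qed.

(* The pieces of weight well below that of a node: their first averages are
   estimated on the whole combination, and their weights are summable. *)
Let low_part A B :
  `|\sum_(j <- F) act (term j) (restr A B (combination (fun i => (w' j).+2 <= wt (k i))%N))|
  <= U.
Proof.
have U0 := U_ge0; apply: le_trans (ler_norm_sum _ _ _) _.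
apply: (@le_trans _ _ (\sum_(j <- F) (2 ^- w' j * (146 * U) +
    \sum_(1 <= i < m.+1 | ((w' j).+2 <= wt (k i))%N) U * tail_bound (w' j) (k i)))).
  rewrite big_seq [leRHS]big_seq; apply: ler_sum => j jF.
  pose I i := ((w' j).+2 <= wt (k i))%N.
  have upI i i' : (0 < i <= i')%N -> (i' <= m)%N -> I i -> I i'.
    move=> ii im; rewrite /I => H; apply: leq_trans H _.
    move: ii => /andP[i0]; rewrite leq_eqVlt => /orP[/eqP -> //|ii].
    apply/ltnW/dep_wt_lt; rewrite k_gt0 ?k_mono ?i0 //; nlia.
  have [A0 [B0 VE]] := combination_upper upI.
  have [[sp1 _ _ _] _ _] := so.
  have [Gf Gg Tf Tg] := sp1 j (F_range jF).
  have one h : G h -> typeIa G (w' j) h -> `|act h (restr A B (combination I))| <=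
      2 ^- w' j * (146 * U) + \sum_(1 <= i < m.+1 | I i) U * tail_bound (w' j) (k i).
    move=> Gh [h' [sg [a [b [/schreier_sumP[dd [al [sz [AF ->]]]] ->]]]]].
    have [_ _ _ _ Ha] := AF.
    rewrite actZl normrMsign act_restr restr_restr.
    have avg : is_average (alpha_average W) by left.
    have {}AF := average_family_mono (fun k' b => @alpha_average_mono _ _ _ k' b GW) AF.
    have M0 : 0 <= 146 * U by rewrite mulr_ge0.
    apply: (typeI_low avg _ AF M0) => // i id.
    by have [Gi _] := Ha i id; rewrite VE restr_restr; exact: GZ.
  by apply: term_le => //; exact: one.
rewrite big_split /= -mulr_suml.
have V10 v : v \in [seq w' j | j <- F] -> (10 <= v)%N.
  by move=> /mapP[j jF ->]; exact: (special_ge10 hs hL hsigma spW (F_range jF)).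
have uV : uniq [seq w' j | j <- F] by rewrite map_inj_in_uniq ?fset_uniq.
have sumw : \sum_(j <- F) (2 ^- w' j : R) <= 1 / 500.
  rewrite -(big_map w' xpredT (fun v => 2 ^- v)).
  apply: le_trans (sum_geom_le _ uV V10) _.
  by have [] := q_small R (v := 10) isT; lra.
have : \sum_(j <- F) (2 ^- w' j : R) * (146 * U) <= 1 / 500 * (146 * U).
  by rewrite -mulr_suml ler_wpM2r // mulr_ge0.
rewrite -mulr_suml => H1.
suff : \sum_(j <- F) \sum_(1 <= i < m.+1 | ((w' j).+2 <= wt (k i))%N) U * tail_bound (w' j) (k i)
    <= U * (2 / 3) by move: H1; lra.
under eq_bigr => j _ do rewrite big_mkcond.
rewrite exchange_big /=; apply: (@le_trans _ _ (\sum_(1 <= i < m.+1) U * node_error (k i))).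
  rewrite big_nat [leRHS]big_nat; apply: ler_sum => i im.
  have k0 : (0 < k i)%N by apply: k_gt0; nlia.
  have [q0 q1 q2 q3] := q_props k0; have PP : 0 <= (2 ^- P : R) := pow2_ge0 R P.
  rewrite -big_mkcond -mulr_sumr ler_wpM2l // /tail_bound.
  under eq_bigr => j _ do rewrite mulrDr.
  rewrite big_split /= -mulr_sumr -mulr_suml.
  have S1 : \sum_(j <- F | ((w' j).+2 <= wt (k i))%N) (2 ^- w' j : R) <= 1 / 500.
    apply: le_trans sumw; rewrite [leRHS](bigID (fun j => (w' j).+2 <= wt (k i))%N) /= lerDl.
    by apply: sumr_ge0 => j _; exact: pow2_ge0.
  have S2 : \sum_(j <- F | ((w' j).+2 <= wt (k i))%N) 2 * (2 * q (k i) ^+ 2) <=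
      (wt (k i))%:R * (4 * q (k i) ^+ 2).
    rewrite (_ : 2 * (2 * q (k i) ^+ 2) = 4 * q (k i) ^+ 2); last by ring.
    rewrite -big_filter big_const_seq count_predT iter_addr_0 -[_ *+ size _]mulr_natl.
    rewrite ler_wpM2r ?mulr_ge0 ?exprn_ge0 ?(ltW q0) // ler_nat.
    rewrite -(size_map w') -[X in (_ <= X)%N](size_iota 0); apply: uniq_leq_size.
      rewrite map_inj_in_uniq ?filter_uniq ?fset_uniq // => j j'.
      by rewrite !mem_filter => /andP[_ jF] /andP[_ j'F]; exact: weight_inj.
    by move=> v /mapP[j]; rewrite mem_filter mem_iota => /andP[jw _] ->; nlia.
  have S3 : (wt (k i))%:R * (4 * q (k i) ^+ 2) <= q (k i).
    rewrite (_ : _ * _ = 4 * q (k i) * ((wt (k i))%:R * q (k i))); last by ring.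
    have := ler_wpM2l (_ : 0 <= 4 * q (k i)) q2; rewrite mulr_ge0 ?(ltW q0) // => /(_ isT); lra.
  have := ler_wpM2r (_ : 0 <= 31 * 2 ^- P + 6 * q (k i)) S1.
  rewrite addr_ge0 ?mulr_ge0 ?(ltW q0) // => /(_ isT) S4.
  by rewrite /node_error; lra.
by rewrite -mulr_sumr ler_wpM2l // sum_error_le.
Qed.

Let high_part A B j : (0 < j)%N ->
  `|act (\sum_(i <- F | (2 * wt j <= w' i)%N) term i) (restr A B (node j))| <= 32 * q j.
Proof.
move=> j0; have [tx ty] := dep_tame j0.
have one v : tame (wt j) v ->
    `|act (\sum_(i <- F | (2 * wt j <= w' i)%N) term i) (restr A B v)| <= 16 * q j.
  move=> tv; rewrite -act_restr -{1}(restr_id (leq0n (minsupp v)) (leqnn (maxsupp v))).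
  apply: (tame_high tv) => //; last exact: (norming_restr (W_closed s L1 sigma)).
  exact: special_on_mono GW so.
by rewrite (_ : 32 * q j = 2 * (16 * q j)); [exact: act_node_le (one _ tx) (one _ ty)|ring].
Qed.

(* By injectivity of the coding, equal weights occur at equal positions. *)
Let same_weight i : (0 < i <= m)%N ->
  \sum_(j <- F | w' j == wt (k i)) term j =
  if (k i \in F) && (w' (k i) == wt (k i)) then term (k i) else 0.
Proof.
move=> im; have k0 := k_gt0 im.
have only j : j \in F -> w' j = wt (k i) -> j = k i.
  move=> jF E; have [] := special_coding hs hL hsigma spW (hsp (k i)) (F_range jF) _ E => //.
  by rewrite k0 leqnn.
case: ifP => [/andP[kF kw]|nk].
  rewrite big_mkcond (bigD1_seq (k i)) ?fset_uniq //= kw big_seq_cond big1 ?addr0 //.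
  move=> j /andP[jF /eqP jk]; case: eqP => // E; case: jk; exact: only.
rewrite big_seq_cond big1 // => j /andP[jF /eqP E].
have jk := only j jF E; rewrite -jk in E nk.
by rewrite jF E eqxx in nk.
Qed.

Let agree i : bool := `[< f' (k i) = f (k i) /\ g' (k i) = g (k i) >].
Let J i : bool := (k i \in F) && (w' (k i) == wt (k i)).

(* On the nodes where the functional follows the branch it acts by its
   coefficients, except for the two nodes cut by the interval. *)
Let agree_part A B i : (0 < i <= m)%N -> J i -> agree i ->
  `|act (term (k i)) (restr A B (node (k i))) -
    (if (A <= minsupp (x (k i)))%N && (maxsupp (y (k i)) <= B)%N then e (k i) - e' (k i) else 0)| <=
  27 * ((minsupp (x (k i)) < A <= maxsupp (y (k i)))%N%:R +
        (minsupp (x (k i)) <= B < maxsupp (y (k i)))%N%:R).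
Proof.
move=> im /andP[kF _] /asboolP[Ef Eg]; have k0 := k_gt0 im; have [e1 e2] := eM kF.
have [r1 r2 r3 r4 r5] := dep_order k0; have [tx ty] := dep_tame k0.
have [px py _] := hnode k0; have [Wf _ _ _ _] := px; have [Wg _ _ _ _] := py.
rewrite actDl !actZl Ef Eg.
have [-> ->] := branch_node_self A B k0.
have bx := tame_bound tx A B Wf; have b_y := tame_bound ty A B Wg.
case: ifPn => [/andP[Ax yB]|cov].
  rewrite !restr_id; try nlia.
  rewrite (exact_pair_act px) (exact_pair_act py) mulr1 mulrN1 subrr normr0.
  by rewrite mulr_ge0 // addr_ge0.
rewrite subr0; have [miss|hit] := boolP ((maxsupp (y (k i)) < A) || (B < minsupp (x (k i))))%N.
  rewrite !restr_eq0; [|nlia|nlia]; rewrite !act0r oppr0 !mulr0 addr0 normr0.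
  by rewrite mulr_ge0 // addr_ge0.
apply: (@le_trans _ _ 27).
  apply: le_trans (ler_normD _ _) _; rewrite !normrM normrN.
  apply: (@le_trans _ _ (2^-1 * 27 + 2^-1 * 27)); last lra.
  by apply: lerD; apply: ler_pM.
have [cA|cA] := boolP (minsupp (x (k i)) < A <= maxsupp (y (k i)))%N.
  by rewrite mulrDr mulr1 lerDl mulr_ge0.
have -> : (minsupp (x (k i)) <= B < maxsupp (y (k i)))%N = true by nlia.
by rewrite mulrDr mulr1 lerDr mulr_ge0.
Qed.

(** The coefficients give [U], by hypothesis; the two nodes cut by the interval
    [27 * U] each; the only node at which the functional leaves the branch [54 * U];
    the pieces of lower and of higher weight at most [U] each. *)
Lemma typeII_combination A B :
  (forall I : pred nat, `|\sum_(1 <= i < m.+1 | I i && (k i \in F)) c i * (e (k i) - e' (k i))| <= U) ->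
  `|act (\sum_(j <- F) term j) (restr A B Z)| <= 146 * U.
Proof.
move=> main; have U0 := U_ge0.
have splitF i : (0 < i <= m)%N -> \sum_(j <- F) term j =
    \sum_(j <- F | ((w' j).+2 <= wt (k i))%N) term j +
    (\sum_(j <- F | w' j == wt (k i)) term j + \sum_(j <- F | (2 * wt (k i) <= w' j)%N) term j).
  move=> im; have k0 := k_gt0 im; have w10 := dep_w10 k0.
  rewrite (bigID (fun j => (w' j).+2 <= wt (k i))%N) /=; congr (_ + _).
  rewrite (bigID (fun j => w' j == wt (k i))) /=; congr (_ + _).
    by apply: eq_bigl => j; case: eqP => [->|_]; rewrite ?andbF // andbT; nlia.
  rewrite big_seq_cond [RHS]big_seq_cond; apply: eq_bigl => j.
  have [jF|//] := boolP (j \in F); rewrite /=.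
  have Lj := special_L0 L3 hs hsigma spW (F_range jF).
  have T := weight_trichotomy Lj (dep_L0 k0); apply/andP/idP => [[a1 a2]|a3].
    by case: T => // H; [rewrite H in a1|rewrite H eqxx in a2].
  by split; [nlia|apply/eqP; nlia].
rewrite act_combination.
pose eqp i := act (if J i then term (k i) else 0) (restr A B (node (k i))).
pose hi i := act (\sum_(j <- F | (2 * wt (k i) <= w' j)%N) term j) (restr A B (node (k i))).
have -> : \sum_(1 <= i < m.+1) c i * act (\sum_(j <- F) term j) (restr A B (node (k i))) =
    \sum_(j <- F) act (term j) (restr A B (combination (fun i => (w' j).+2 <= wt (k i))%N)) +
    (\sum_(1 <= i < m.+1) c i * eqp i + \sum_(1 <= i < m.+1) c i * hi i).
  under [in RHS]eq_bigr => j _ do rewrite act_combination big_mkcond.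
  rewrite exchange_big -!big_split /= big_nat [RHS]big_nat; apply: eq_bigr => i im.
  have ir : (0 < i <= m)%N by nlia.
  rewrite [in LHS](splitF i ir) !actDl (same_weight ir) !mulrDr; congr (_ + _).
  by rewrite -big_mkcond act_suml mulr_sumr.
have hiU : `|\sum_(1 <= i < m.+1) c i * hi i| <= U.
  apply: le_trans (ler_norm_sum _ _ _) _.
  apply: (@le_trans _ _ (\sum_(1 <= i < m.+1) U * (32 * q (k i)))).
    rewrite big_nat [leRHS]big_nat; apply: ler_sum => i im; have ir : (0 < i <= m)%N by nlia.
    rewrite normrM; apply: ler_pM => //; first exact: c_le_U.
    by apply: high_part; exact: k_gt0.
  rewrite -!mulr_sumr; have := sum_q_le => H.
  have : U * (32 * \sum_(1 <= i < m.+1) q (k i)) <= U * 1 by rewrite ler_wpM2l //; lra.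
  by rewrite mulr1.
pose cov i := (A <= minsupp (x (k i)))%N && (maxsupp (y (k i)) <= B)%N.
pose mainp i := if [&& J i, agree i & cov i] then e (k i) - e' (k i) else 0.
have mainU : `|\sum_(1 <= i < m.+1) c i * mainp i| <= U.
  rewrite (_ : \sum_(1 <= i < m.+1) c i * mainp i = \sum_(1 <= i < m.+1 |
    [&& J i, agree i & cov i] && (k i \in F)) c i * (e (k i) - e' (k i))); first exact: main.
  rewrite [RHS]big_mkcond; apply: eq_bigr => i _; rewrite /mainp.
  have [/andP[kF _]|_] := boolP (J i); last by rewrite mulr0.
  by rewrite kF andbT; case: ifP; rewrite ?mulr0.
have cutU (cut : nat -> bool) : (forall i i', (0 < i <= m)%N -> (0 < i' <= m)%N ->
    cut i -> cut i' -> i = i') -> \sum_(1 <= i < m.+1) (U * (27 * (cut i)%:R)) <= 27 * U.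
  move=> uc; rewrite -!mulr_sumr mulrCA ler_wpM2l // -[leRHS]mulr1 ler_wpM2l //.
  apply: le_trans (ler_norm _) _; apply: sum_at_most_one; rewrite ?iota_uniq //.
    by move=> i _ _; case: (cut i); rewrite ?normr0 ?normr1.
  move=> i i'; rewrite !mem_index_iota => im im' _ _.
  case E: (cut i); last by rewrite eqxx.
  case E': (cut i'); last by rewrite eqxx.
  by move=> _ _; apply: uc; nlia.
have apart i i' : (0 < i < i')%N -> (i' <= m)%N ->
    (maxsupp (y (k i)) < minsupp (x (k i')))%N.
  move=> ii im; have k0 : (0 < k i)%N by apply: k_gt0; nlia.
  have := dep_lt (j := k i) (j' := k i'); rewrite k0 k_mono // => /(_ isT).
  by have [? ? ? ? ?] := dep_order k0; nlia.
pose cutA i := (minsupp (x (k i)) < A <= maxsupp (y (k i)))%N.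
pose cutB i := (minsupp (x (k i)) <= B < maxsupp (y (k i)))%N.
pose leaving i := J i && ~~ agree i.
have eqU : `|\sum_(1 <= i < m.+1) c i * (eqp i - mainp i)| <= 27 * U + 27 * U + 54 * U.
  apply: le_trans (ler_norm_sum _ _ _) _.
  apply: (@le_trans _ _ (\sum_(1 <= i < m.+1) (U * (27 * (cutA i)%:R) + U * (27 * (cutB i)%:R) +
      U * (if leaving i then 54 else 0)))).
    rewrite big_nat [leRHS]big_nat; apply: ler_sum => i im; have ir : (0 < i <= m)%N by nlia.
    rewrite normrM -!mulrDr; apply: ler_pM => //; first exact: c_le_U.
    rewrite /eqp /mainp /leaving; case: (boolP (J i)) => [Ji|nJ] /=; last first.
      by rewrite act0l subr0 normr0 addr0 mulr_ge0 // addr_ge0.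
    case: (boolP (agree i)) => [ai|na] /=.
      by rewrite addr0; exact: agree_part.
    rewrite subr0; apply: (@le_trans _ _ 54); last by rewrite lerDr mulr_ge0 // addr_ge0.
    have kF : k i \in F by case/andP: Ji.
    have [sp1 _ _ _] := spW; have [Wf Wg _ _] := sp1 _ (F_range kF).
    by apply: term_le => //; apply: node_bound => //; exact: k_gt0.
  rewrite !big_split /=; apply: lerD; first apply: lerD.
  - apply: cutU => i i' im im'; rewrite /cutA => H H'; case: (ltngtP i i') => // ii.
      by have := apart i i' ltac:(nlia) ltac:(nlia); nlia.
    by have := apart i' i ltac:(nlia) ltac:(nlia); nlia.
  - apply: cutU => i i' im im'; rewrite /cutB => H H'; case: (ltngtP i i') => // ii.
      by have := apart i i' ltac:(nlia) ltac:(nlia); nlia.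
    by have := apart i' i ltac:(nlia) ltac:(nlia); nlia.
  rewrite -mulr_sumr mulrC ler_wpM2r //; apply: le_trans (ler_norm _) _.
  apply: sum_at_most_one; rewrite ?iota_uniq //.
    by move=> i _ _; case: ifP; rewrite ?normr0 // ger0_norm.
  (* the coding: two indices of common weight force agreement at the first *)
  have first i i' : (0 < i < i')%N -> (i' <= m)%N -> J i' -> agree i.
    move=> ii im /andP[kF /eqP E]; have k0 : (0 < k i')%N by apply: k_gt0; nlia.
    have kr : (0 < k i' <= k i')%N by rewrite k0 leqnn.
    have [_ H] := special_coding hs hL hsigma spW (hsp (k i')) (F_range kF) kr E.
    by apply/asboolP; apply: H; rewrite k_mono // k_gt0 //; nlia.
  move=> i i'; rewrite !mem_index_iota => im im' _ _.
  case: ifP => [/andP[Ji ai] _|_]; last by rewrite eqxx.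
  case: ifP => [/andP[Ji' ai'] _|_]; last by rewrite eqxx.
  case: (ltngtP i i') => // ii.
    by move: ai; rewrite (first i i') //; nlia.
  by move: ai'; rewrite (first i' i) //; nlia.
have -> : \sum_(1 <= i < m.+1) c i * eqp i =
    \sum_(1 <= i < m.+1) c i * (eqp i - mainp i) + \sum_(1 <= i < m.+1) c i * mainp i.
  by rewrite -big_split /=; apply: eq_bigr => i _; rewrite -mulrDr subrK.
have := low_part A B; move: hiU mainU eqU.
set a1 := \sum_(_ <= _ < _) _; set a2 := \sum_(_ <= _ < _) _; set a3 := \sum_(_ <= _ < _) _.
set a4 := \sum_(_ <- _) _ => H1 H2 H3 H4.
have := ler_normD a4 (a3 + a2 + a1); have := ler_normD (a3 + a2) a1; have := ler_normD a3 a2.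
lra.
Qed.

End TypeTwoCombination.

Let node_le A B n i : (0 < i <= m)%N -> (0 < n)%N ->
  `|c i * act 'X^n (restr A B (node (k i)))| <= 146 * U.
Proof.
move=> im n0; rewrite normrM mulrC; apply: (@le_trans _ _ (54 * U)); last by have := U_ge0; lra.
apply: ler_pM => //; last exact: (c_le_U im).
by apply: node_bound; [exact: k_gt0|exact: W_Xn].
Qed.

(** Functionals of type I reproduce every constant from [2 * (54 + 2 / 3)] on, and
    functionals of type II every constant from 111 on. *)
Lemma combination_bounded h A B : W h -> `|act h (restr A B Z)| <= 146 * U.
Proof.
move=> Wh; move: h Wh A B; apply: (@W_ind R s L1 sigma (fun h => forall A B, `|act h (restr A B Z)| <= 146 * U)).
- move=> n n0 A B; rewrite act_combination; apply: sum_at_most_one; rewrite ?iota_uniq ?mulr_ge0 ?U_ge0 //.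
    by move=> i; rewrite mem_index_iota => im _; apply: node_le => //; nlia.
  have nz i : (0 < i <= m)%N -> c i * act 'X^n (restr A B (node (k i))) != 0 ->
      (minsupp (x (k i)) <= n <= maxsupp (g (k i)))%N.
    move=> im; have k0 := k_gt0 im.
    rewrite act_Xn coef_restr; case: ifP => _; last by rewrite mulr0 eqxx.
    rewrite mulf_eq0 negb_or => /andP[_]; apply: contraR; rewrite negb_and -!ltnNge.
    move=> /orP[nx|ng]; apply/eqP.
      exact: (node_coef0 k0 nx).
    exact: (node_coef1 k0 ng).
  have apart i i' : (0 < i < i')%N -> (i' <= m)%N -> (maxsupp (g (k i)) < minsupp (x (k i')))%N.
    move=> ii im; apply: dep_lt.
    by rewrite k_gt0 ?k_mono //; nlia.
  move=> i i'; rewrite !mem_index_iota => im im' _ _.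
  move=> /(nz i ltac:(nlia)) Hi /(nz i' ltac:(nlia)) Hi'.
  case: (ltngtP i i') => // ii.
    by have := apart i i' ltac:(nlia) ltac:(nlia); nlia.
  by have := apart i' i ltac:(nlia) ltac:(nlia); nlia.
- by move=> h _ Ph A B; rewrite actNl normrN.
- by move=> a b h _ Ph A B; rewrite act_restr restr_restr.
- move=> n h r _ Ph r0 r1 A B; rewrite act_suml; apply: le_trans (ler_norm_sum _ _ _) _.
  apply: (@le_trans _ _ (\sum_i ratr (r i) * (146 * U))).
    apply: ler_sum => i _; rewrite actZl normrM ger0_norm ?ler0q //.
    by rewrite ler_wpM2l ?ler0q //; exact: Ph.
  by rewrite -mulr_suml -rmorph_sum /= r1 rmorph1 mul1r.
- move=> n h _ /schreier_sumP[d [a [sz [AF ->]]]] A B; have [_ _ _ _ Ha] := AF.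
  apply: (@typeI_combination (alpha_average W) n d a sz); first by left.
  + by apply: average_family_mono AF => k' b; apply: alpha_average_mono => ? [].
  + by move=> i id; have [[_ Pa] _] := Ha i id; exact: Pa.
- move=> n h _ /schreier_sumP[d [a [sz [AF ->]]]] A B; have [_ _ _ _ Ha] := AF.
  apply: (@typeI_combination (beta_average s L1 sigma W) n d a sz); first by right.
  + by apply: average_family_mono AF => k' b; apply: beta_average_mono => ? [].
  + by move=> i id; have [[_ Pa] _] := Ha i id; exact: Pa.
- move=> d f' g' w' F so; rewrite sum_plusE => Wh A B.
  apply: (typeII_combination _ _ so) => //.
  + by move=> h A' B' [].
  + by move=> j _; rewrite ger0_norm ?invr_ge0.
  + by move=> I; rewrite big1 ?normr0 ?U_ge0 // => i _; rewrite subrr mulr0.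
- move=> d f' g' w' F lam so lo; rewrite sum_minusE => Wh A B.
  apply: (typeII_combination _ _ so) => //.
  + by move=> h A' B' [].
  + have [_ Fd _] := so => j jF; apply: (lam_half hs lo jF).
    by case/andP: (Fd _ jF).
  + move=> I.
    (* the part of the coefficients in I, whose norm is at most U *)
    pose a : {poly R} := \sum_(1 <= i < m.+1 | I i) c i *: 'X^(k i).
    have aE j : a`_j = \sum_(1 <= i < m.+1 | I i) c i * (j == k i)%:R.
      by rewrite coef_sum; apply: eq_bigr => i _; rewrite coefZ coefXn.
    have ak i : (0 < i <= m)%N -> a`_(k i) = if I i then c i else 0.
      move=> im; rewrite aE big_mkcond (bigD1_seq i) ?iota_uniq ?mem_index_iota //=.
      rewrite eqxx mulr1 big_seq_cond big1 ?addr0 // => j.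
      rewrite mem_index_iota => /andP[jm /eqP ji]; case: ifP => // _.
      case: eqP => [E|_]; last exact: mulr0.
      by case: ji; apply: k_inj => //; nlia.
    have a0 j : (forall i, (0 < i <= m)%N -> j != k i) -> a`_j = 0.
      move=> H; rewrite aE big_nat_cond big1 // => i /andP[im _].
      by rewrite (negPf (H i _)) ?mulr0 //; nlia.
    have ca : c00 a by apply: a0 => i im; have := k_gt0 im; nlia.
    have -> : \sum_(1 <= i < m.+1 | I i && (k i \in F)) c i * (ratr (lam (k i)) / 2 - - (ratr (lam (k i)) / 2)) =
        act (\sum_(j <- F) ratr (lam j) *: 'X^j) a.
      rewrite act_lam; under [in RHS]eq_bigr => j _ do rewrite aE mulr_sumr.
      rewrite exchange_big /= big_mkcondr; apply: eq_bigr => i _.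
      have [kF|kF] := boolP (k i \in F).
        rewrite (bigD1_seq (k i)) ?fset_uniq //= eqxx big1 ?addr0; last first.
          by move=> j /negPf ->; rewrite !mulr0.
        by rewrite mulr1 opprK mulrC; congr (_ * _); lra.
      rewrite big_seq big1 // => j jF; case: eqP => [E|_]; last by rewrite !mulr0.
      by rewrite -E jF in kF.
    apply: le_trans (dual_norm_act hs lo ca) _; apply: (norm_u_suppress hs) => j.
    have [[i im ->]|no] := pselect (exists2 i, (0 < i <= m)%N & j = k i).
      rewrite ak // (coef_vector_k im); by case: ifP; [left|right].
    by right; apply: a0 => i im; apply/eqP => E; apply: no; exists i.
Qed.

Lemma combination_upper_bound : normX s L1 sigma Z <= 146 * U.
Proof.
apply: normX_le => h Wh; apply: le_trans (ler_norm _) _.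
rewrite -[Z](restr_id (leq0n (minsupp Z)) (leqnn (maxsupp Z))).
exact: combination_bounded.
Qed.

Let Fk : {fset nat} := [fset j in [seq k i | i <- iota 1 m]]%fset.

Let FkP j : reflect (exists2 i, (0 < i <= m)%N & j = k i) (j \in Fk).
Proof.
rewrite in_fset /=; apply: (iffP mapP) => -[i].
  by rewrite mem_iota => im ->; exists i => //; nlia.
by move=> im ->; exists i => //; rewrite mem_iota; nlia.
Qed.

Let special_Fk : special_on L1 sigma W (k m) f g wt Fk.
Proof.
split; first exact: hsp.
  move=> _ /FkP[i im ->]; rewrite k_gt0 //=.
  have [->//|im'] := eqVneq i m; apply/ltnW/k_mono; nlia.
have k10 : (0 < k 1)%N by apply: k_gt0; rewrite hm.
exists (k 1%N).
  split; first by apply/FkP; exists 1%N => //; rewrite hm.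
  move=> _ /FkP[i im ->]; have [->//|i1] := eqVneq i 1%N; apply/ltnW/k_mono; nlia.
have card : (#|` Fk| <= m)%N.
  rewrite -[X in (_ <= X)%N](size_iota 1) -(size_map k); apply: uniq_leq_size.
    exact: fset_uniq.
  by move=> j /FkP[i im ->]; apply/mapP; exists i => //; rewrite mem_iota; nlia.
have := dep_wt_ge k10.
have := dep_wt_min k10.
have := ltn_expl (2 * wt (k 1%N)) (ltnSn 1); have [? ? ? ? ?] := dep_order k10.
nlia.
Qed.

Let node_pair j j' : (0 < j)%N -> (0 < j')%N ->
  act (f j - g j) (node j') = if j == j' then 2 else 0.
Proof.
move=> j0 j'0; rewrite actDl actNl.
pose B := maxn (maxsupp (x j')) (maxsupp (y j')).
have fx : restr 0 B (x j') = x j' by rewrite restr_id // leq_maxl.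
have fy : restr 0 B (y j') = y j' by rewrite restr_id // leq_maxr.
have full : restr 0 B (node j') = node j' by rewrite restrD restrN fx fy.
rewrite -full; have [E|jj] := eqVneq j j'; last first.
  by have [-> ->] := branch_node 0 B j0 j'0 jj; rewrite subrr.
have [px py _] := hnode j0; rewrite -E in fx fy *.
have [-> ->] := branch_node_self 0 B j0.
by rewrite fx fy (exact_pair_act px) (exact_pair_act py) opprK.
Qed.

Lemma rational_approx (r e : R) : 0 < e -> exists q : rat, `|ratr q - r| <= e.
Proof.
move=> e0; have [q] := @rat_in_itvoo R (r - e) (r + e) ltac:(lra).
rewrite in_itv /= => /andP[H1 H2]; exists q; rewrite ler_norml; apply/andP; split; lra.
Qed.

Lemma sum_fset_inter (F G : {fset nat}) (V : nat -> R) :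
  (forall j, j \in F -> j \notin G -> V j = 0) ->
  \sum_(j <- F) V j = \sum_(j <- G | j \in F) V j.
Proof.
move=> V0; have off : \sum_(j <- F | j \notin G) V j = 0.
  by rewrite big_seq_cond big1 // => j /andP[]; exact: V0.
rewrite (bigID (fun j => j \in G)) /= off addr0 -[LHS]big_filter -[RHS]big_filter.
apply: perm_big; apply: uniq_perm; rewrite ?filter_uniq ?fset_uniq //.
by move=> j; rewrite !mem_filter andbC.
Qed.

(** The functionals of type II_- along the branch norm the combination: the values of the
    functions [s j] at a point, with a finite set of coordinates selected, form a
    sequence of dual norm at most 1. Shrinking it by the factor [1 - e] leaves room
    for a rational approximation. *)
Lemma combination_lower_bound : U <= normX s L1 sigma Z.
Proof.
apply: norm_u_le => F t F0 t01; set S := \sum_(_ <- F) _.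
pose T := `|S| + \sum_(1 <= i < m.+1) `|c i| + 1.
have T1 : 1 <= T.
  have : 0 <= `|S| by [].
  have : 0 <= \sum_(1 <= i < m.+1) `|c i| by apply: sumr_ge0 => i _.
  by rewrite /T; lra.
suff approx (e : R) : 0 < e -> e <= 1 -> `|S| <= normX s L1 sigma Z + e * T.
  apply/ler_addgt0Pr => e e0; pose e1 := Num.min 1 (e / T).
  have T0 : 0 < T by lra.
  have e10 : 0 < e1 by rewrite lt_min ltr01 divr_gt0.
  have := approx e1 e10; rewrite ge_min lexx => /(_ isT)/le_trans; apply.
  by rewrite lerD2l -ler_pdivlMr // ge_min lexx orbT.
move=> e0 e1.
have [sg Hsg sgS] : exists2 sg : R, `|sg| = 1 & sg * S = `|S|.
  have [S0|S0] := leP 0 S; first by exists 1; rewrite ?normr1 // mul1r ger0_norm.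
  by exists (-1); rewrite ?normrN1 // mulN1r ltr0_norm.
pose b j : R := if j \in F then sg * s j t else 0.
have m0 : 0 < m%:R :> R by rewrite ltr0n.
have /choice[lam Hlam] j : exists q : rat, `|ratr q - (1 - e) * b j| <= e / m%:R.
  by apply: rational_approx; rewrite divr_gt0.
have FkF0 j : j \in Fk -> (0 < j)%N by move=> /FkP[i im ->]; exact: k_gt0.
have sumFk (V : nat -> R) : \sum_(j <- Fk) V j = \sum_(1 <= i < m.+1) V (k i).
  rewrite -(big_map k xpredT V); apply/perm_big/uniq_perm; first exact: fset_uniq.
    rewrite map_inj_in_uniq ?iota_uniq // => i i'; rewrite !mem_index_iota => im im'.
    by apply: k_inj; nlia.
  move=> j; apply/FkP/mapP => -[i im ->]; exists i => //; move: im; rewrite mem_index_iota; nlia.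
have bsum (a : {poly R}) : \sum_(j <- Fk) b j * a`_j =
    sg * \sum_(j <- [fset j in Fk | j \in F]%fset) a`_j * s j t.
  rewrite mulr_sumr big_fset /= [RHS]big_mkcond; apply: eq_bigr => j _.
  by rewrite /b; case: ifP; rewrite ?mul0r // mulrAC -mulrA.
have lo : lam_ok s lam Fk.
  apply: dual_norm_le1 => // a ca; rewrite act_lam.
  have -> : \sum_(j <- Fk) ratr (lam j) * a`_j = (1 - e) * (\sum_(j <- Fk) b j * a`_j) +
      \sum_(j <- Fk) (ratr (lam j) - (1 - e) * b j) * a`_j.
    by rewrite mulr_sumr -big_split /=; apply: eq_bigr => j _; ring.
  have na0 := norm_u_ge0 hs a.
  have H1 : (1 - e) * (\sum_(j <- Fk) b j * a`_j) <= (1 - e) * norm_u s a.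
    rewrite ler_wpM2l ?subr_ge0 //; apply: le_trans (ler_norm _) _.
    rewrite bsum normrM Hsg mul1r; apply: (norm_u_ge hs) => // j.
    by rewrite in_fset /= => /andP[jF _]; exact: FkF0.
  have H2 : \sum_(j <- Fk) (ratr (lam j) - (1 - e) * b j) * a`_j <= e * norm_u s a.
    rewrite sumFk; apply: (@le_trans _ _ (\sum_(1 <= i < m.+1) e / m%:R * norm_u s a)).
      rewrite big_nat [leRHS]big_nat; apply: ler_sum => i im.
      apply: le_trans (ler_norm _) _; rewrite normrM; apply: ler_pM => //.
      by apply: (norm_u_coef hs); apply: k_gt0; nlia.
    rewrite sumr_const_nat subn1 /= -[_ *+ m]mulr_natl mulrA mulrCA divff ?mulr1 //.
    by rewrite gt_eqF.
  lra.
have Wh := norming_IIminus (W_closed s L1 sigma) special_Fk lo.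
have := act_le_normX hs Z Wh; move=> /(le_trans (ler_norm _)).
have -> : act (sum_minus f g lam Fk) Z = \sum_(1 <= i < m.+1) c i * ratr (lam (k i)).
  rewrite act_sumr big_nat [RHS]big_nat; apply: eq_bigr => i im; rewrite actZr; congr (_ * _).
  rewrite actZl act_suml sumFk (bigD1_seq i) ?iota_uniq ?mem_index_iota //=.
  rewrite actZl node_pair ?k_gt0 ?eqxx; try nlia.
  rewrite big_seq_cond big1; last first.
    move=> j; rewrite mem_index_iota => /andP[jm /eqP ji].
    rewrite actZl node_pair ?k_gt0; try nlia.
    by case: eqP => [E|_]; [case: ji; apply: (k_inj _ im E); nlia|rewrite mulr0].
  by rewrite addr0 mulrCA mulVf ?mulr1 // pnatr_eq0.
have SE : `|S| = \sum_(1 <= i < m.+1) c i * b (k i).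
  rewrite -sgS /S; transitivity (\sum_(j <- Fk) b j * (coef_vector)`_j); last first.
    rewrite sumFk big_nat [RHS]big_nat; apply: eq_bigr => i im.
    rewrite coef_vector_k; first exact: mulrC.
    by nlia.
  rewrite bsum; congr (_ * _); rewrite big_fset /=; apply: sum_fset_inter => j _ jF.
  rewrite /coef_vector coef_sum big_nat big1 ?mul0r // => i im.
  rewrite coefZ coefXn; case: eqP => [E|_]; last exact: mulr0.
  by case/negP: jF; apply/FkP; exists i => //; nlia.
have E2 : `|\sum_(1 <= i < m.+1) c i * (ratr (lam (k i)) - (1 - e) * b (k i))| <=
    e * \sum_(1 <= i < m.+1) `|c i|.
  apply: le_trans (ler_norm_sum _ _ _) _; rewrite mulr_sumr; apply: ler_sum => i _.
  rewrite normrM mulrC ler_wpM2r //; apply: le_trans (Hlam _) _.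
  by rewrite ler_pdivrMr // ler_peMr ?ler1n // ltW.
have -> : \sum_(1 <= i < m.+1) c i * ratr (lam (k i)) =
   (1 - e) * `|S| + \sum_(1 <= i < m.+1) c i * (ratr (lam (k i)) - (1 - e) * b (k i)).
  by rewrite SE mulr_sumr -big_split /=; apply: eq_bigr => i _; ring.
move: E2; rewrite ler_norml => /andP[E2 _] H; rewrite /T !mulrDr mulr1; lra.
Qed.

End Main.

Theorem proposition7p9 (R : realType)
  (s : nat -> R -> R) (hs : dense_in_sphere s)
  (L1 L2 L3 : set nat) (hL : coding_sets R L1 L2 L3)
  (sigma : seq {poly R} -> nat) (hsigma : coding_function L2 sigma)
  (x y f g : nat -> {poly R}) (hdep : dependent_sequence s L1 sigma x y f g)
  (m : nat) (hm : (0 < m)%N)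
  (k : nat -> nat) (hk1 : (m <= k 1)%N)
  (hk : forall i, (0 < i < m)%N -> (k i < k i.+1)%N)
  (c : nat -> R) :
  let z j := x j - y j in
  let u : R := norm_u s (\sum_(1 <= i < m.+1) c i *: 'X^(k i)) in
  u <= normX s L1 sigma (\sum_(1 <= i < m.+1) c i *: z (k i)) <= 146 * u.
Proof.
have [wt [hnode hnext hsp]] := hdep; apply/andP; split.
  exact: (combination_lower_bound hs hL hsigma hnode hnext hsp c hm hk1 hk).
exact: (combination_upper_bound hs hL hsigma hnode hnext hsp c hm hk1 hk).
Qed.
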